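(* There exists a sequence of configurations $C_n$ of smooth cubic curves in the complex projective plane $\mathbb{P}^2$ (i.e. each $C_n$ is a reduced union of finitely many smooth plane cubic curves) such that, denoting by $\mathrm{Sing}(C_n)$ the set of singular points of $C_n$, $$\lim_{n\to\infty}H(C_n,\mathrm{Sing}(C_n))=-4,$$ and therefore $-4\geq H_{El,\mathbb{P}^2}\geq H_{\mathbb{P}^2}$.
   Context: For a smooth projective complex surface $X$, a reduced curve $C\subset X$ and a finite set $\mathcal{P}$ of $s>0$ distinct points of $X$, let $\bar C$ be the strict transform of $C$ in the blow-up of $X$ at $\mathcal{P}$, and put $H(C,\mathcal{P})=\bar C^{2}/s$. The $H$-constant of $X$ is $H_X=\inf_{C,\mathcal{P}}H(C,\mathcal{P})$, over all reduced curves $C$ on $X$ and all non-empty finite sets $\mathcal{P}$ of points. The elliptic $H$-constant $H_{El,X}$ is the infimum of $H(C,\mathcal{P})$ where $C$ ranges only over (reduced, finite) unions of smooth elliptic curves (smooth genus one curves) on $X$ and $\mathcal{P}$ over all non-empty finite sets of points. *)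

(* Defs.v *)
From HB Require Import structures.
From mathcomp Require Import all_boot all_order all_algebra.
From mathcomp Require Import complex finmap mpoly.
From mathcomp Require Import all_classical reals ereal topology normedtype.
From mathcomp Require Import sequences.

Set Implicit Arguments.
Unset Strict Implicit.
Unset Printing Implicit Defensive.

Import Order.TTheory GRing.Theory Num.Theory.

Local Open Scope classical_set_scope.
Local Open Scope ring_scope.

(** * The projective plane and its curves *)

Definition linear_subspace (K : fieldType) (k : nat) :=
  {U : {vspace 'rV[K]_3} | \dim U == k}.

Definition proj_point (K : fieldType) := linear_subspace K 1.
Definition proj_line (K : fieldType) := linear_subspace K 2.

Definition on_line (K : fieldType) (p : proj_point K) (l : proj_line K) :=
  (val p <= val l)%VS.

(* Only meant for homogeneous [F], so that the choice of homogeneous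
   coordinates of [p] is irrelevant. *)
Definition vanishes (K : fieldType) (F : {mpoly K[3]}) (p : proj_point K) :=
  F.@[vpick (val p) 0] = 0.

Definition homogeneous (K : fieldType) (F : {mpoly K[3]}) (d : nat) :=
  F \is d.-homog for mdeg.

(* The plane curve [F = 0], possibly with multiple components. *)
Definition plane_curve (K : fieldType) (F : {mpoly K[3]}) :=
  F != 0 /\ exists2 d, (0 < d)%N & homogeneous F d.

Definition reduced_curve (K : fieldType) (F : {mpoly K[3]}) :=
  plane_curve F /\ forall g h : {mpoly K[3]}, F = g ^+ 2 * h -> (msize g <= 1)%N.

Definition Sing (K : fieldType) (F : {mpoly K[3]}) : set (proj_point K) :=
  [set p | vanishes F p /\ forall i : 'I_3, vanishes F^`M(i) p].

(* Over an algebraically closed field a curve satisfying this is reduced and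
   irreducible, as two plane curves always meet. *)
Definition smooth_curve (K : fieldType) (F : {mpoly K[3]}) :=
  plane_curve F /\ Sing F = set0.

Definition smooth_cubic (K : fieldType) (F : {mpoly K[3]}) :=
  smooth_curve F /\ homogeneous F 3.

(* [dim V / (I \cap V) = n], for subspaces [V] and [I] of [E]. *)
Definition quotient_dim (K : fieldType) (E : lmodType K) (V I : E -> Prop)
    (n : nat) :=
  exists2 b : 'I_n -> E, (forall i, V (b i)) &
    forall v, V v -> exists! c : 'rV[K]_n, I (v - \sum_i c 0 i *: b i).

Definition hilbert_function (K : fieldType) (F : {mpoly K[3]}) (m n : nat) :=
  quotient_dim (fun G => homogeneous G m) (fun G => exists h, G = h * F) n.

(* The Hilbert polynomial of a curve of degree [d] is [d * m + 1 - g]; for a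
   smooth curve the arithmetic genus [g] is the genus. *)
Definition has_genus (K : fieldType) (F : {mpoly K[3]}) (g : nat) :=
  exists d N : nat, forall m, (N <= m)%N ->
    exists2 n, hilbert_function F m n & (n + g = d * m + 1)%N.

Definition smooth_elliptic (K : fieldType) (F : {mpoly K[3]}) :=
  smooth_curve F /\ has_genus F 1.

Definition reduced_union_of (K : fieldType) (Q : {mpoly K[3]} -> Prop)
    (F : {mpoly K[3]}) :=
  reduced_curve F /\
  exists2 s : seq {mpoly K[3]}, (forall G, G \in s -> Q G) & F = \prod_(G <- s) G.

Definition cubic_configuration (K : fieldType) (F : {mpoly K[3]}) :=
  reduced_union_of (@smooth_cubic K) F.

Definition elliptic_configuration (K : fieldType) (F : {mpoly K[3]}) :=
  reduced_union_of (@smooth_elliptic K) F.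

(** * Blow-up of the plane at a finite set of points *)

(* [(q, None)] is the point of the blow-up over a point [q] which is not blown
   up; [(p, Some l)] is the point of the exceptional curve [E_p] given by the
   tangent direction at [p] of a line [l] through [p]. *)
Definition blowup_point (K : fieldType) : Type := proj_point K * option (proj_line K).

Definition blowup (K : fieldType) (P : set (proj_point K)) : set (blowup_point K) :=
  [set x | if x.2 is Some l then P x.1 /\ on_line x.1 l else ~ P x.1].

Definition adapted_frame (K : fieldType) (x : blowup_point K) (B : 'M[K]_3) :=
  [/\ B \in unitmx, row 0 B \in val x.1 &
      if x.2 is Some l then row 1 B \in val l else true].

(* With [u0, u1, u2] the rows of an adapted frame, the affine coordinates
   [(s, t)] centred at [x] are those for which the blow-down map is
   [(s, t) |-> [u0 + s u1 + t u2]] if [x = (q, None)], and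
   [(s, t) |-> [u0 + s (u1 + t u2)]] if [x = (p, Some l)]. In the second case
   [E_p] is [s = 0]. *)
Definition coord_s (K : fieldType) : {mpoly K[2]} := 'X_ord0.
Definition coord_t (K : fieldType) : {mpoly K[2]} := 'X_ord_max.

Definition chart_weight (K : fieldType) (x : blowup_point K) (i : 'I_3) :
    {mpoly K[2]} :=
  nth 0 [:: 1; coord_s K;
            if x.2 is Some _ then coord_s K * coord_t K else coord_t K] i.

Definition pullback (K : fieldType) (x : blowup_point K) (B : 'M[K]_3)
    (F : {mpoly K[3]}) : {mpoly K[2]} :=
  F \mPo [tuple \sum_(i < 3) B i j *: chart_weight x i | j < 3].

Definition split_exceptional (K : fieldType) (f : {mpoly K[2]}) (m : nat)
    (f0 : {mpoly K[2]}) :=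
  f = coord_s K ^+ m * f0 /\ ~ exists h, f0 = coord_s K * h.

(* The vanishing order along [E_p] of the total transform of [F = 0]; it does
   not depend on the point [x] of [E_p] at which it is computed. *)
Definition exceptional_order (K : fieldType) (P : set (proj_point K)) (p : proj_point K)
    (F : {mpoly K[3]}) (m : nat) :=
  exists x B f0, [/\ blowup P x, x.1 = p, adapted_frame x B &
                     split_exceptional (pullback x B F) m f0].

(* The effective divisor [G' + \sum_(p in P) a_p E_p], where [G'] is the strict
   transform of the curve [G = 0], [G = div_curve D] and [a = div_exc D]. All
   effective divisors on the blow-up are of this form. *)
Record divisor (K : fieldType) := Divisor {
  div_curve : {mpoly K[3]};
  div_exc : proj_point K -> nat
}.

Definition effective (K : fieldType) (D : divisor K) :=
  div_curve D != 0 /\ exists d, homogeneous (div_curve D) d.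

Definition strict_transform (K : fieldType) (F : {mpoly K[3]}) : divisor K :=
  Divisor F (fun=> 0%N).

Definition add_divisor (K : fieldType) (D D' : divisor K) : divisor K :=
  Divisor (div_curve D * div_curve D') (fun p => div_exc D p + div_exc D' p)%N.

(* [D - D'] is the divisor on the blow-up of the rational function [a / b]. *)
Definition lin_equiv (K : fieldType) (P : set (proj_point K)) (D D' : divisor K) :=
  exists (d : nat) (a b : {mpoly K[3]}),
    [/\ a != 0, b != 0, homogeneous a d, homogeneous b d &
        div_curve D * b = div_curve D' * a /\
        forall p, P p -> exists m n,
          [/\ exceptional_order P p a m, exceptional_order P p b n &
              (div_exc D p + n = div_exc D' p + m)%N]].

Definition no_common_component (K : fieldType) (P : set (proj_point K))
    (D D' : divisor K) :=
  (forall g h h' : {mpoly K[3]}, div_curve D = g * h -> div_curve D' = g * h' ->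
     (msize g <= 1)%N) /\
  (forall p, P p -> div_exc D p = 0%N \/ div_exc D' p = 0%N).

Definition local_equation (K : fieldType) (x : blowup_point K) (B : 'M[K]_3)
    (D : divisor K) (f : {mpoly K[2]}) :=
  if x.2 is Some _ then
    exists m f0, split_exceptional (pullback x B (div_curve D)) m f0 /\
                 f = coord_s K ^+ div_exc D x.1 * f0
  else f = pullback x B (div_curve D).

(* [p] belongs to the ideal [(f, g)] of the local ring of the plane at 0. *)
Definition local_ideal (K : fieldType) (f g p : {mpoly K[2]}) :=
  exists u a b : {mpoly K[2]}, u.@[fun=> 0] != 0 /\ u * p = a * f + b * g.

(* The dimension of [O / (f, g)], with [O] the local ring of the blow-up at
   [x] and [f], [g] local equations. Polynomials suffice: when
   [K[s, t] / (K[s, t] \cap (f, g))] is finite-dimensional it is isomorphic to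
   [O / (f, g)]. *)
Definition local_intersection (K : fieldType) (x : blowup_point K)
    (D D' : divisor K) (n : nat) :=
  exists B f g, [/\ adapted_frame x B, local_equation x B D f,
    local_equation x B D' g & quotient_dim (fun=> True) (local_ideal f g) n].

Definition intersection_number (K : fieldType) (P : set (proj_point K))
    (D D' : divisor K) (n : nat) :=
  exists i : blowup_point K -> nat,
    [/\ forall x, blowup P x -> local_intersection x D D' (i x),
        finite_set [set x | blowup P x /\ i x <> 0%N] &
        n = \big[addn/0%N]_(x \in blowup P) i x].

(* [D ^ 2 = D . D1 - D . D2] for any effective [D1], [D2] without common
   component with [D] such that [D] is linearly equivalent to [D1 - D2]. *)
Definition self_intersection (K : fieldType) (P : set (proj_point K)) (D : divisor K)
    (n : int) :=
  exists (D1 D2 : divisor K) (n1 n2 : nat),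
    [/\ effective D1 /\ effective D2,
        no_common_component P D D1 /\ no_common_component P D D2,
        lin_equiv P (add_divisor D D2) D1,
        intersection_number P D D1 n1 /\ intersection_number P D D2 n2 &
        n = n1%:Z - n2%:Z].

(** * H-constants of the complex projective plane *)

(* [H (C, P) = h]. *)
Definition H_value (R : realType) (F : {mpoly R[i][3]}) (P : set (proj_point R[i]))
    (h : R) :=
  [/\ finite_set P, P !=set0 &
      exists2 n : int, self_intersection P (strict_transform F) n &
                       h = n%:~R / #|` fset_set P|%:R].

Definition H_P2 (R : realType) : \bar R :=
  ereal_inf [set h%:E | h in
    [set h : R | exists F P, reduced_curve F /\ H_value F P h]].

Definition H_El_P2 (R : realType) : \bar R :=
  ereal_inf [set h%:E | h in
    [set h : R | exists F P, elliptic_configuration F /\ H_value F P h]].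

(* Main.v *)
Require Import Defs.
From HB Require Import structures.
From mathcomp Require Import all_boot all_order all_algebra.
From mathcomp Require Import complex finmap mpoly ring zify.
From mathcomp Require Import all_classical reals ereal topology normedtype.
From mathcomp Require Import sequences.

Set Implicit Arguments.
Unset Strict Implicit.
Unset Printing Implicit Defensive.

Import Order.TTheory GRing.Theory Num.Theory.
Import numFieldNormedType.Exports.

Local Open Scope classical_set_scope.
Local Open Scope ring_scope.

(* Consider the four pencils of cubics [pencil_cubic w k], [k < 4], spanned by
   the Fermat cubics and by their three Hesse transforms. Their base points are
   the 12 triple points of the dual Hesse arrangement, each a base point of
   three of the pencils, and the parameters of the four members through another
   point are collinear by threes, up to sign, as points of the elliptic curve
   [v ^ 3 = u ^ 3 - 1]. Hence, if from each pencil one takes the [M] members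
   whose parameters come from [n]-th level torsion points, two of these that
   meet outside the base points meet in a quadruple point of the configuration.
   There are then 12 points of multiplicity [3 M] and [3 M ^ 2 - O(M)] quadruple
   points. Since the members are smooth, the self-intersection of the strict
   transform is the square [(12 M) ^ 2] of the degree minus the sum of the
   squared multiplicities, namely [36 M ^ 2 - 48 M ^ 2 + O(M)], and dividing by
   [3 M ^ 2 + O(M)] points gives the limit [-4]. *)

(** * Polynomials in several variables *)

Lemma mpoly_ring_ind (n : nat) (R : comNzRingType) (P : {mpoly R[n]} -> Prop) :
  (forall c, P c%:MP) -> (forall i, P 'X_i) ->
  (forall p q, P p -> P q -> P (p + q)) -> (forall p q, P p -> P q -> P (p * q)) ->
  forall p, P p.
Proof.
move=> PC PX PD PM p; rewrite [p]mpolyE.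
apply: (big_ind P); [by rewrite -mpolyC0 | exact: PD |] => m _.
rewrite -mul_mpolyC; apply/PM => //; rewrite mpolyXE_id.
apply: (big_ind P); [by rewrite -mpolyC1 | exact: PM |] => i _.
elim: (m i) => [|k ih]; first by rewrite expr0 -mpolyC1.
by rewrite exprS; apply/PM.
Qed.

Lemma mpoly_rmorph_ext (n : nat) (R : comNzRingType) (S : nzRingType)
    (f g : {rmorphism {mpoly R[n]} -> S}) :
  (forall c, f c%:MP = g c%:MP) -> (forall i, f 'X_i = g 'X_i) -> f =1 g.
Proof.
move=> fgC fgX; elim/mpoly_ring_ind => // p q fgp fgq.
  by rewrite !rmorphD fgp fgq.
by rewrite !rmorphM fgp fgq.
Qed.

Lemma mpolyX_neq0 (n : nat) (R : nzRingType) (m : 'X_{1..n}) : 'X_[R, m] != 0.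
Proof. by rewrite -msize_poly_eq0 msizeX. Qed.

Lemma mderivXU (n : nat) (R : comNzRingType) (i j : 'I_n) :
  ('X_i)^`M(j) = (i == j)%:R :> {mpoly R[n]}.
Proof.
rewrite mderivX mnm1E; case: eqP => [->|_]; last by rewrite scale0r.
by rewrite -{1}[U_(j)%MM]add0m addmK mpolyX0 scale1r.
Qed.

Lemma meval_taylor1 (n : nat) (R S : comNzRingType) (f : {rmorphism R -> S})
    (x : 'I_n -> R) (s : S) (h : 'I_n -> S) (F : {mpoly R[n]}) :
  exists r, mmap f (fun j => f (x j) + s * h j) F =
    f F.@[x] + s * (\sum_j f F^`M(j).@[x] * h j) + s ^+ 2 * r.
Proof.
elim/mpoly_ring_ind: F => [c|i|F G [r rE] [r' r'E]|F G [r rE] [r' r'E]].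
- exists 0; rewrite mmapC mevalC mulr0 addr0 big1 ?mulr0 ?addr0 // => j _.
  by rewrite mderivC meval0 rmorph0 mul0r.
- exists 0; rewrite mmapX mmap1U mevalXU mulr0 addr0; congr (_ + _ * _).
  rewrite (bigD1 i) //= big1 => [|j ji]; rewrite mderivXU.
    by rewrite eqxx meval1 rmorph1 mul1r addr0.
  by rewrite eq_sym (negPf ji) meval0 rmorph0 mul0r.
- exists (r + r'); rewrite mmapD rE r'E mevalD rmorphD /=.
  under [in RHS]eq_bigr => j _ do rewrite mderivD mevalD rmorphD mulrDl.
  by rewrite big_split /=; ring.
set A := \sum_j _ in rE; set B := \sum_j _ in r'E.
exists (A * B + f F.@[x] * r' + f G.@[x] * r + s * (A * r' + B * r) + s ^+ 2 * r * r').
rewrite rmorphM /= rE r'E mevalM rmorphM /=.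
have -> : \sum_j f (F * G)^`M(j).@[x] * h j = f G.@[x] * A + f F.@[x] * B.
  rewrite !mulr_sumr -big_split; apply: eq_bigr => j _ /=.
  by rewrite mderivM mevalD !mevalM rmorphD !rmorphM /=; ring.
by ring.
Qed.

Section Homogeneous.
Variables (n : nat) (R : comNzRingType) (d : nat) (F : {mpoly R[n]}).
Hypothesis homF : F \is d.-homog for mdeg.

Lemma meval_homogZ (c : R) (v : 'rV[R]_n) : F.@[(c *: v) 0] = c ^+ d * F.@[v 0].
Proof.
rewrite !mevalE mulr_sumr !big_seq; apply: eq_bigr => m /(dhomog_mf homF) /= <-.
rewrite mulrCA mdegE; congr (_ * _); rewrite -prodrXr -big_split /=.
by apply: eq_bigr => i _; rewrite mxE exprMn.
Qed.

Lemma euler_homog : \sum_i 'X_i * F^`M(i) = d%:R *: F.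
Proof.
rewrite {2}[F]mpolyE scaler_sumr.
under eq_bigr => i _ do rewrite {1}[F]mpolyE linear_sum mulr_sumr /=.
rewrite exchange_big /= !big_seq; apply: eq_bigr => m /(dhomog_mf homF) /= <-.
under eq_bigr => i _ do rewrite linearZ /= mderivX -scalerAr -scalerAr.
rewrite -scaler_sumr scalerA mulrC -scalerA mdegE natr_sum scaler_suml.
congr (_ *: _); apply: eq_bigr => i _.
have [->|mi] := eqVneq (m i) 0%N; first by rewrite !scale0r.
by rewrite -mpolyXD addmC submK // lep1mP.
Qed.

Lemma mderiv_homog i : F^`M(i) \is d.-1.-homog for mdeg.
Proof.
apply/dhomogP => m; rewrite mcoeff_msupp mcoeff_mderiv => Fm.
have : (m + U_(i))%MM \in msupp F.
  by rewrite mcoeff_msupp; apply: contraNneq Fm => ->; rewrite mul0rn.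
by move=> /(dhomog_mf homF) /= <-; rewrite mdegD mdeg1 addn1.
Qed.

End Homogeneous.

Lemma homog_quotient (R : idomainType) (n d e : nat) (F G h : {mpoly R[n]}) :
  F \is (d + e).-homog for mdeg -> G \is e.-homog for mdeg -> F = h * G ->
  exists2 h', h' \is d.-homog for mdeg & F = h' * G.
Proof.
move=> homF homG FE; exists (pihomog mdeg d h); first exact: pihomogP.
pose k := (mmeasure mdeg h + d.+1)%N.
have hk : (mmeasure mdeg h <= k)%N by rewrite leq_addr.
have dk : (d < k)%N by rewrite /k addnS ltnS leq_addl.
rewrite -[LHS](pihomog_dE homF) FE [X in pihomog _ _ (X * _)](pihomog_partitionE hk).
rewrite mulr_suml linear_sum /= (bigD1 (Ordinal dk)) //= big1 ?addr0 => [|i id].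
  by rewrite pihomog_dE //; apply: dhomogM => //; apply: pihomogP.
apply: (@pihomog_ne0 _ _ _ (i + e)%N).
  by rewrite eqn_add2r; apply: contraNneq id => e'; apply/eqP/val_inj.
by apply: dhomogM => //; apply: pihomogP.
Qed.

(** * Restriction of a polynomial to a line *)

Section LineRestriction.
Variables (n : nat) (R : comNzRingType).
Implicit Types (u w : 'rV[R]_n) (F : {mpoly R[n]}) (p q : {poly R}).

Definition line_restrict u w : {mpoly R[n]} -> {poly R} :=
  mmap (@polyC R) (fun j => (u 0 j)%:P + 'X * (w 0 j)%:P).

HB.instance Definition _ u w := GRing.RMorphism.copy (line_restrict u w)
  (mmap (@polyC R) (fun j => (u 0 j)%:P + 'X * (w 0 j)%:P)).

Lemma line_restrictC u w c : line_restrict u w c%:MP = c%:P.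
Proof. exact: mmapC. Qed.

Lemma line_restrictX u w j : line_restrict u w 'X_j = (u 0 j)%:P + 'X * (w 0 j)%:P.
Proof. by rewrite /line_restrict mmapX mmap1U. Qed.

Lemma horner_line_restrict u w c F : (line_restrict u w F).[c] = F.@[(u + c *: w) 0].
Proof.
apply: (mpoly_rmorph_ext (f := horner_eval c \o line_restrict u w)) => [a|j] /=.
  by rewrite line_restrictC /horner_eval hornerC mevalC.
by rewrite line_restrictX /horner_eval !hornerE mevalXU !mxE.
Qed.

Lemma line_restrict_shift u w c F :
  line_restrict (u + c *: w) w F = line_restrict u w F \Po ('X + c%:P).
Proof.
apply: (mpoly_rmorph_ext (g := comp_poly ('X + c%:P) \o line_restrict u w)) => [a|j] /=.
  by rewrite !line_restrictC comp_polyC.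
by rewrite !line_restrictX !mxE comp_polyD comp_polyM comp_polyX !comp_polyC; ring.
Qed.

Definition has_top_coef d p c := (size p <= d.+1)%N /\ p`_d = c.

Lemma has_top_coefM d e p q a b :
  has_top_coef d p a -> has_top_coef e q b -> has_top_coef (d + e) (p * q) (a * b).
Proof.
move=> [sp <-] [sq <-]; split.
  apply: (leq_trans (size_polyMleq _ _)).
  by have := leq_add sp sq; rewrite addnS addSn; case: (size p + size q)%N.
have dle : (d < (d + e).+1)%N by rewrite ltnS leq_addr.
rewrite coefM (bigD1 (Ordinal dle)) //= addKn big1 ?addr0 // => i id.
have [lt|lt|eq] := ltngtP i d; last by case/eqP: id; apply: val_inj.
- rewrite [q`_ _]nth_default ?mulr0 // (leq_trans sq) // ltn_subRL.
  by rewrite ltn_add2r.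
- by rewrite [p`_ _](nth_default _ (leq_trans sp lt)) mul0r.
Qed.

Lemma has_top_coef1 : has_top_coef 0 1 1.
Proof. by split; rewrite ?size_poly1 ?coefC. Qed.

Lemma has_top_coef_prod (I : Type) (r : seq I) (d : I -> nat) (p : I -> {poly R})
    (a : I -> R) : (forall i, has_top_coef (d i) (p i) (a i)) ->
  has_top_coef (\sum_(i <- r) d i) (\prod_(i <- r) p i) (\prod_(i <- r) a i).
Proof.
move=> top; elim: r => [|i r ih]; first by rewrite !big_nil; apply: has_top_coef1.
by rewrite !big_cons; apply: has_top_coefM.
Qed.

Lemma has_top_coefX d p a k :
  has_top_coef d p a -> has_top_coef (k * d) (p ^+ k) (a ^+ k).
Proof.
move=> top; elim: k => [|k ih]; first exact: has_top_coef1.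
by rewrite mulSn !exprS; apply: has_top_coefM.
Qed.

Lemma line_restrict_monomial_top u w m :
  has_top_coef (mdeg m) (line_restrict u w 'X_[m]) 'X_[m].@[w 0].
Proof.
rewrite mpolyXE_id !rmorph_prod mdegE; apply: has_top_coef_prod => i /=.
rewrite !rmorphXn -[X in has_top_coef X]muln1 /=; apply: has_top_coefX.
rewrite line_restrictX mevalXU; split.
  rewrite (leq_trans (size_polyD _ _)) // geq_max (leq_trans (size_polyC_leq1 _)) //=.
  by rewrite (leq_trans (size_polyMleq _ _)) // size_polyX /= ltnS size_polyC_leq1.
by rewrite coefD coefC coefXM coefC add0r.
Qed.

Lemma line_restrict_top u w F d :
  F \is d.-homog for mdeg -> has_top_coef d (line_restrict u w F) F.@[w 0].
Proof.
move=> /dhomogP homF; rewrite [F]mpolyE !rmorph_sum /= !big_seq.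
apply: (big_ind2 (has_top_coef d)) => [|p a q b [sp <-] [sq <-]|m /homF md].
- by split; rewrite ?size_poly0 ?coef0.
- by split; rewrite ?coefD // (leq_trans (size_polyD _ _)) // geq_max sp.
- rewrite -mul_mpolyC !rmorphM /= line_restrictC mevalC -[d]add0n -md.
  apply: has_top_coefM; last exact: line_restrict_monomial_top.
  by split; rewrite ?coefC // size_polyC_leq1.
Qed.

End LineRestriction.

Lemma poly_eq0_everywhere (R : numDomainType) (p : {poly R}) :
  (forall c, p.[c] = 0) -> p = 0.
Proof.
move=> p0; apply: (@roots_geq_poly_eq0 _ _ [seq i%:R | i <- iota 0 (size p)]).
- by apply/allP => c _; rewrite rootE p0.
- by rewrite map_inj_uniq ?iota_uniq // => i j /eqP; rewrite eqr_nat => /eqP.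
- by rewrite size_map size_iota.
Qed.

Section VanishingEverywhere.
Variables (n : nat) (R : numDomainType).
Implicit Types (F h : {mpoly R[n]}).

Lemma mderiv_eq0_everywhere F i :
  (forall v : 'rV_n, F.@[v 0] = 0) -> forall v : 'rV_n, F^`M(i).@[v 0] = 0.
Proof.
move=> F0 v; pose e : 'rV[R]_n := delta_mx 0 i.
have [r] := meval_taylor1 (@polyC R) (v 0) 'X (fun j => (e 0 j)%:P) F.
rewrite -/(line_restrict v e F) F0 [line_restrict _ _ _]poly_eq0_everywhere; last first.
  by move=> c; rewrite horner_line_restrict.
rewrite (bigD1 i) //= big1 ?addr0 => [|j ji];
  last by rewrite mxE (negPf ji) andbF polyC0 mulr0.
rewrite mxE !eqxx mulr1 => /(congr1 (coefp 1)); rewrite /coefp.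
by rewrite !coefD coefXM !coefC coefXnM /= add0r addr0 => <-.
Qed.

Lemma mpoly_eq0_everywhere F : (forall v : 'rV_n, F.@[v 0] = 0) -> F = 0.
Proof.
have mderivm0 m : (forall v : 'rV_n, F.@[v 0] = 0) ->
    forall v : 'rV_n, F^`M[m].@[v 0] = 0.
  rewrite mderivm_foldr => F0.
  by elim: flatten => //= i s ih; apply: mderiv_eq0_everywhere.
move=> F0; apply/mpolyP => m; have := mcoeff_mderivm m F 0.
rewrite addm0 mcoeff0.
rewrite (mpoly_rmorph_ext (f := mcoeff 0%MM) (g := meval ((0 : 'rV[R]_n) 0))).
- rewrite /= mderivm0 // => /esym/eqP; rewrite mulrn_eq0 => /orP[|/eqP //].
  by rewrite -leqn0 leqNgt prodn_gt0 // => i; rewrite ffactnn fact_gt0.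
- by move=> c; rewrite /= mcoeffC eqxx mulr1 mevalC.
- by move=> i; rewrite /= mcoeffX mevalXU mxE mnm1_eq0.
Qed.

Lemma mpoly_eq0_off_hypersurface F h :
  F != 0 -> (forall v : 'rV_n, F.@[v 0] != 0 -> h.@[v 0] = 0) -> h = 0.
Proof.
move=> F0 h0; have /eqP : F * h = 0.
  apply: mpoly_eq0_everywhere => v; rewrite mevalM.
  by have [->|/h0 ->] := eqVneq F.@[v 0] 0; rewrite ?mul0r ?mulr0.
by rewrite mulf_eq0 (negPf F0) => /eqP.
Qed.

End VanishingEverywhere.

(** * Dimensions of quotients *)

Section QuotientDim.
Variable K : fieldType.
Local Notation everything := (fun=> True).

Lemma quotient_dim0 (E : lmodType K) (V I : E -> Prop) :
  (forall v, V v -> I v) -> quotient_dim V I 0.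
Proof.
move=> VI; exists (fun=> 0) => [[]//|v Vv]; exists 0; split=> [|c _].
  by rewrite big_ord0 subr0; apply: VI.
by rewrite !thinmx0.
Qed.

(* The sequence [0 -> E' / P' -> E / P -> E / Q -> 0] induced by [f] is exact. *)
Lemma quotient_dim_exact (E E' : lmodType K) (f : {linear E' -> E}) (P Q : E -> Prop)
    (P' : E' -> Prop) (m n : nat) :
  (forall x y, P x -> P y -> P (x + y)) -> (forall x, P x -> P (- x)) ->
  (forall x y, Q x -> Q y -> Q (x + y)) -> (forall x, P x -> Q x) ->
  (forall x, Q (f x)) ->
  (forall x, Q x -> exists y, P (x - f y)) -> (forall x, P (f x) <-> P' x) ->
  quotient_dim everything Q m -> quotient_dim everything P' n ->
  quotient_dim everything P (m + n).
Proof.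
move=> PD PN QD PQ Qf lift Pf [b _ bP] [b' _ b'P].
pose bb (i : 'I_(m + n)) :=
  match fintype.split i with inl l => b l | inr l => f (b' l) end.
have bbE (c : 'rV_(m + n)) : \sum_i c 0 i *: bb i =
    \sum_l lsubmx c 0 l *: b l + f (\sum_l rsubmx c 0 l *: b' l).
  rewrite big_split_ord linear_sum /=; congr (_ + _); apply: eq_bigr => l _.
    by rewrite mxE /bb (unsplitK (inl l)).
  by rewrite mxE /bb (unsplitK (inr l)) linearZ.
exists bb => // v _; have [c [Qc c_uniq]] := bP v I.
have [d Pd] := lift _ Qc; have [c' [P'c' c'_uniq]] := b'P d I.
exists (row_mx c c'); split.
  rewrite bbE row_mxKl row_mxKr opprD addrA.
  by have := PD _ _ Pd ((Pf _).2 P'c'); rewrite linearB addrA subrK.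
move=> e; rewrite bbE => Pe.
have cE : c = lsubmx e.
  apply: c_uniq; have := QD _ _ (PQ _ Pe) (Qf (\sum_l rsubmx e 0 l *: b' l)).
  by rewrite opprD addrA subrK.
rewrite -[e]hsubmxK -cE; congr row_mx; apply/c'_uniq/Pf.
have := PD _ _ (PN _ Pd) Pe; rewrite -cE [f (d - _)]linearB.
by rewrite opprB [- (_ + f _)]opprD [v + (_ + _)]addrA [X in P X -> _]addrA subrK.
Qed.

Lemma quotient_dim_image (E E' : lmodType K) (f : {linear E -> E'}) (P : E -> Prop)
    (V' P' : E' -> Prop) (n : nat) :
  (forall x', V' x' <-> exists x, x' = f x) -> (forall x, P' (f x) <-> P x) ->
  quotient_dim everything P n -> quotient_dim V' P' n.
Proof.
move=> Vf P'f [b _ bP]; exists (f \o b) => [i|_ /Vf [v ->]].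
  by apply/Vf; exists (b i).
have fE (c : 'rV_n) : f v - \sum_i c 0 i *: f (b i) = f (v - \sum_i c 0 i *: b i).
  rewrite [RHS]linearB [f (\sum__ _)]linear_sum; congr (_ - _).
  by apply: eq_bigr => i _; rewrite linearZ.
have [c [Pc c_uniq]] := bP v I; exists c; split=> [|c']; rewrite fE P'f //.
exact: c_uniq.
Qed.

Lemma quotient_dim_vspace (E : vectType K) (U : {vspace E}) :
  quotient_dim everything (fun v => v \in U) (\dim {:E} - \dim U).
Proof.
rewrite -dimv_compl; set C := (U^C)%VS.
have CE (c : 'rV[K]_(\dim C)) : \sum_i c 0 i *: (vbasis C)`_i \in C.
  by apply: memv_suml => i _; apply/memvZ/vbasis_mem/mem_nth; rewrite size_tuple.
exists (fun i => (vbasis C)`_i) => // v _.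
have /memv_addP [v1 Uv1 [v2 Cv2 ->]] : v \in (U + C)%VS by rewrite addv_complf memvf.
exists (\row_i coord (vbasis C) i v2); split.
  under eq_bigr => i _ do rewrite mxE.
  by rewrite -(coord_vbasis Cv2) addrK.
move=> c Uc; have /eqP : v2 - \sum_i c 0 i *: (vbasis C)`_i = 0.
  apply/eqP; rewrite -memv0 -(capv_compl U) memv_cap; apply/andP; split;
    last exact: memvB (CE c).
  by rewrite -[v2](addKr v1) -addrA memvD // memvN.
rewrite subr_eq0 => /eqP ->; apply/rowP => i.
by rewrite mxE coord_sum_free // (basis_free (vbasisP C)).
Qed.

End QuotientDim.

(** * Local intersection multiplicities in the plane *)

Section LocalIdeal.
Variable K : fieldType.
Implicit Types (f g h u v : {mpoly K[2]}).

Section Closure.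
Variables f g : {mpoly K[2]}.

Lemma local_idealD u v :
  local_ideal f g u -> local_ideal f g v -> local_ideal f g (u + v).
Proof.
move=> [r [a [b [r0 uE]]]] [r' [a' [b' [r'0 vE]]]].
exists (r * r'), (r' * a + r * a'), (r' * b + r * b'); rewrite mevalM mulf_neq0 //.
split=> //; rewrite mulrDr [r * r']mulrC -mulrA uE [r' * r]mulrC -mulrA vE; ring.
Qed.

Lemma local_idealM u v : local_ideal f g v -> local_ideal f g (u * v).
Proof.
move=> [r [a [b [r0 vE]]]]; exists r, (u * a), (u * b).
by rewrite mulrCA vE; split=> //; ring.
Qed.

Lemma local_idealN v : local_ideal f g v -> local_ideal f g (- v).
Proof. by rewrite -mulN1r; apply: local_idealM. Qed.

Lemma local_idealZ c v : local_ideal f g v -> local_ideal f g (c *: v).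
Proof. by rewrite -mul_mpolyC; apply: local_idealM. Qed.

Lemma local_ideal0 : local_ideal f g 0.
Proof. by exists 1, 0, 0; rewrite meval1 oner_neq0 !mul0r mulr0 addr0. Qed.

Lemma local_ideal_sum (I : finType) (F : I -> {mpoly K[2]}) :
  (forall i, local_ideal f g (F i)) -> local_ideal f g (\sum_i F i).
Proof.
by move=> IF; apply: (big_ind (local_ideal f g)) => //;
  [exact: local_ideal0 | exact: local_idealD].
Qed.

Lemma local_ideal_gen a b : local_ideal f g (a * f + b * g).
Proof. by exists 1, a, b; rewrite meval1 oner_neq0 mul1r. Qed.

Lemma local_ideal_cancel u v :
  u.@[fun=> 0] != 0 -> local_ideal f g (u * v) -> local_ideal f g v.
Proof.
move=> u0 [r [a [b [r0 E]]]]; exists (r * u), a, b.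
by rewrite mevalM mulf_neq0 // -mulrA.
Qed.

Lemma quotient_dim_local_unitl :
  f.@[fun=> 0] != 0 -> quotient_dim (fun=> True) (local_ideal f g) 0.
Proof.
by move=> f0; apply: quotient_dim0 => v _; exists f, v, 0; split=> //; ring.
Qed.

Lemma quotient_dim_local_unitr :
  g.@[fun=> 0] != 0 -> quotient_dim (fun=> True) (local_ideal f g) 0.
Proof.
by move=> g0; apply: quotient_dim0 => v _; exists g, 0, v; split=> //; ring.
Qed.

(* Multiplication by [u] is injective on the finite-dimensional quotient, hence onto. *)
Lemma local_unit_inverse n u : quotient_dim (fun=> True) (local_ideal f g) n ->
  u.@[fun=> 0] != 0 -> exists u', local_ideal f g (1 - u * u').
Proof.
move=> [b _ bP] u0; pose comb (c : 'rV[K]_n) := \sum_i c 0 i *: b i.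
have comb_eq0 c : local_ideal f g (comb c) -> c = 0.
  have [c0 [_ uniq_c0]] := bP 0 I => Ic.
  have /oppr_inj -> // : - c = - 0; rewrite oppr0 -(uniq_c0 0); last first.
    by rewrite big1 => [|i _]; [rewrite subr0; apply: local_ideal0 | rewrite mxE scale0r].
  apply/esym/uniq_c0; rewrite sub0r -sumrN.
  by under eq_bigr => i _ do rewrite mxE scaleNr opprK.
have /choice [A AP] : forall i, exists c : 'rV[K]_n, local_ideal f g (u * b i - comb c).
  by move=> i; have [c []] := bP (u * b i) I; exists c.
have [e [Ie _]] := bP 1 I; pose M := \matrix_i A i.
have combM c : local_ideal f g (u * comb c - comb (c *m M)).
  have -> : u * comb c - comb (c *m M) = \sum_i c 0 i *: (u * b i - comb (A i)).
    under [RHS]eq_bigr => i _ do rewrite scalerBr.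
    rewrite sumrB mulr_sumr; congr (_ - _).
      by apply: eq_bigr => i _; rewrite scalerAr.
    under [RHS]eq_bigr => i _ do rewrite scaler_sumr.
    rewrite exchange_big; apply: eq_bigr => j _ /=; rewrite mxE scaler_suml.
    by apply: eq_bigr => i _; rewrite !mxE scalerA.
  by apply: local_ideal_sum => i; apply/local_idealZ/AP.
have uM : M \in unitmx.
  rewrite -row_free_unit; apply: inj_row_free => c cM0; apply: comb_eq0.
  apply: (local_ideal_cancel u0); have := combM c; rewrite cM0.
  rewrite [X in _ - X]big1 ?subr0 // => i _.
  by rewrite mxE scale0r.
exists (comb (e *m invmx M)).
have := local_idealD Ie (local_idealN (combM (e *m invmx M))).
by rewrite mulmxKV // opprB addrA subrK.
Qed.

End Closure.

Lemma local_ideal_mulW f g h v : local_ideal f (g * h) v -> local_ideal f g v.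
Proof.
by move=> [u [a [b [u0 E]]]]; exists u, a, (b * h); rewrite E; split=> //; ring.
Qed.

Lemma local_ideal_mulE f g h v :
  g != 0 -> (forall a b, a * f = b * g -> exists c, a = c * g) ->
  local_ideal f (g * h) (g * v) <-> local_ideal f h v.
Proof.
move=> g0 regular; split=> -[u [a [b [u0 E]]]]; last first.
  by exists u, (g * a), b; rewrite mulrCA E; split=> //; ring.
have [|c aE] := regular a (u * v - b * h).
  by apply: (addIr (b * (g * h))); rewrite -E; ring.
exists u, c, b; split=> //; apply: (mulfI g0).
by rewrite mulrCA E aE; ring.
Qed.

Lemma quotient_dim_local_mul f g h m n :
  g != 0 -> (forall a b, a * f = b * g -> exists c, a = c * g) ->
  quotient_dim (fun=> True) (local_ideal f g) m ->
  quotient_dim (fun=> True) (local_ideal f h) n ->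
  quotient_dim (fun=> True) (local_ideal f (g * h)) (m + n).
Proof.
move=> g0 regular dim_g dim_h.
apply: (@quotient_dim_exact _ _ _ (g \*o idfun) _ (local_ideal f g)
  (local_ideal f h)) => //=.
- exact: local_idealD.
- exact: local_idealN.
- exact: local_idealD.
- by move=> v; apply: local_ideal_mulW.
- by move=> v; have := local_ideal_gen f g 0 v; rewrite mul0r add0r mulrC.
- move=> v [u [a [b [u0 E]]]]; have [u' Iu'] := local_unit_inverse dim_h u0.
  exists (u' * b); apply: (local_ideal_cancel u0).
  have -> : u * (v - g * (u' * b)) = g * (b * (1 - u * u')) + a * f.
    by rewrite mulrBr E; ring.
  apply: local_idealD; first by apply/local_ideal_mulE/local_idealM.
  by have := local_ideal_gen f (g * h) a 0; rewrite mul0r addr0.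
- by move=> v; apply: local_ideal_mulE.
Qed.

End LocalIdeal.

Section Axes.
Variable K : fieldType.
Implicit Types (f u v : {mpoly K[2]}) (p q : {poly K}) (i j : 'I_2).

Definition axis_restrict j : {mpoly K[2]} -> {poly K} := line_restrict 0 (delta_mx 0 j).
HB.instance Definition _ j := GRing.RMorphism.copy (axis_restrict j)
  (line_restrict 0 (delta_mx 0 j)).

Lemma axis_restrictC j c : axis_restrict j c%:MP = c%:P.
Proof. exact: line_restrictC. Qed.

Lemma axis_restrictX i j : axis_restrict j 'X_i = if i == j then 'X else 0.
Proof.
rewrite /axis_restrict line_restrictX !mxE eqxx add0r.
by case: eqP; rewrite ?mulr1 ?mulr0.
Qed.

Lemma axis_restrict_horner0 j v : (axis_restrict j v).[0] = v.@[fun=> 0].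
Proof.
by rewrite horner_line_restrict scale0r addr0; apply: meval_eq => i; rewrite mxE.
Qed.

Lemma axis_restrict_alg j : cancel (horner_alg 'X_j) (axis_restrict j).
Proof.
elim/poly_ind => [|p c ih]; first by rewrite !rmorph0.
rewrite !rmorphD !rmorphM /= ih horner_algX horner_algC alg_mpolyC.
by rewrite axis_restrictC axis_restrictX eqxx.
Qed.

Section Decomposition.
Variables i j : 'I_2.
Hypothesis ij : i != j.

Let restrictX0 : axis_restrict j 'X_i = 0.
Proof. by rewrite axis_restrictX (negPf ij). Qed.

Lemma axis_decomposition v : exists r, v = horner_alg 'X_j (axis_restrict j v) + 'X_i * r.
Proof.
elim/mpoly_ring_ind: v => [c|l|v v' [r ->] [r' ->]|v v' [r ->] [r' ->]].
- by exists 0; rewrite axis_restrictC horner_algC alg_mpolyC mulr0 addr0.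
- rewrite axis_restrictX; have [->|lj] := eqVneq l j.
    by exists 0; rewrite horner_algX mulr0 addr0.
  have -> : l = i.
    by case: i j l ij lj => [[|[]//] ?] [[|[]//] ?] [[|[]//] ?] // _ _; apply: val_inj.
  by exists 1; rewrite rmorph0 mulr1 add0r.
- exists (r + r'); rewrite !rmorphD !rmorphM /= restrictX0 !axis_restrict_alg.
  by rewrite rmorph0 !mul0r !addr0; ring.
- set a := horner_alg _ _; set b := horner_alg _ _.
  exists (a * r' + r * b + 'X_i * r * r').
  rewrite !rmorphM !rmorphD !rmorphM /= restrictX0 !axis_restrict_alg.
  by rewrite rmorph0 !mul0r !addr0 -/a -/b; ring.
Qed.

Lemma axis_restrict_eq0 v : axis_restrict j v = 0 -> exists r, v = 'X_i * r.
Proof.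
by move=> v0; have [r] := axis_decomposition v; rewrite v0 rmorph0 add0r; exists r.
Qed.

Variables (f : {mpoly K[2]}) (k : nat) (g : {poly K}).
Hypotheses (fE : axis_restrict j f = 'X^k * g) (g0 : g.[0] != 0).

Lemma coprimep_Xn_axis u : u.@[fun=> 0] != 0 -> coprimep 'X^k (axis_restrict j u).
Proof.
move=> u0; rewrite coprimep_sym; apply: coprimep_expr.
by rewrite -['X]subr0 -polyC0 coprimep_XsubC rootE axis_restrict_horner0.
Qed.

Lemma local_ideal_axisP v : local_ideal f 'X_i v <-> 'X^k %| axis_restrict j v.
Proof.
split=> [[u [a [b [u0 /(congr1 (axis_restrict j))]]]]|/dvdpP [q vE]].
  rewrite rmorphM rmorphD !rmorphM /= restrictX0 mulr0 addr0 fE => E.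
  rewrite -(Gauss_dvdpr _ (coprimep_Xn_axis u0)) E.
  by rewrite dvdp_mull // dvdp_mulr.
have [r rE] := axis_decomposition v; have [h hE] := axis_decomposition f.
exists (horner_alg 'X_j g), (horner_alg 'X_j q),
  (horner_alg 'X_j g * r - horner_alg 'X_j q * h).
split; first by rewrite -(axis_restrict_horner0 j) axis_restrict_alg.
rewrite {1}rE {1}hE fE vE !rmorphM /=; ring.
Qed.

Lemma quotient_dim_local_axis : quotient_dim (fun=> True) (local_ideal f 'X_i) k.
Proof.
exists (fun l : 'I_k => horner_alg 'X_j 'X^l) => // v _.
set p := axis_restrict j v.
have restrictE (c : 'rV_k) :
    axis_restrict j (v - \sum_l c 0 l *: horner_alg 'X_j 'X^l) = p - rVpoly c.
  rewrite rmorphB rmorph_sum /= /rVpoly poly_def; congr (_ - _).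
  apply: eq_bigr => l _; rewrite -mul_mpolyC rmorphM /= axis_restrictC axis_restrict_alg.
  by rewrite mul_polyC insubT // => lt_lk; congr (c _ _ *: _); apply: val_inj.
exists (poly_rV (take_poly k p)); split.
  apply/local_ideal_axisP; rewrite restrictE poly_rV_K ?size_take_poly //.
  by rewrite -{1}(poly_take_drop k p) addrAC subrr add0r dvdp_mull.
move=> c /local_ideal_axisP; rewrite restrictE => dvd_c.
apply: (can_inj rVpolyK); rewrite poly_rV_K ?size_take_poly //.
apply/eqP; rewrite -subr_eq0; apply: contraTT dvd_c => ne_c.
have -> : p - rVpoly c = drop_poly k p * 'X^k + (take_poly k p - rVpoly c).
  by rewrite -{1}(poly_take_drop k p); ring.
rewrite dvdp_addr ?dvdp_mull // gtNdvdp // size_polyXn ltnS.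
by rewrite (leq_trans (size_polyD _ _)) // geq_max size_polyN size_take_poly size_poly.
Qed.

Lemma axis_regular a b : a * f = b * 'X_i -> exists c, a = c * 'X_i.
Proof.
move=> E; have [|r ->] := @axis_restrict_eq0 a; last by exists r; rewrite mulrC.
have f0 : axis_restrict j f != 0.
  rewrite fE mulf_neq0 ?expf_neq0 ?polyX_eq0 //.
  by apply: contraNneq g0 => ->; rewrite horner0.
apply: (mulIf f0); rewrite mul0r -rmorphM /= E rmorphM /=.
by rewrite restrictX0 mulr0.
Qed.

Lemma quotient_dim_local_axis_exp e :
  quotient_dim (fun=> True) (local_ideal f ('X_i ^+ e)) (e * k).
Proof.
elim: e => [|e ih].
  by rewrite expr0; apply: quotient_dim_local_unitr; rewrite meval1 oner_neq0.
rewrite exprS mulSn; apply: quotient_dim_local_mul => //; first exact: mpolyX_neq0.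
- exact: axis_regular.
- exact: quotient_dim_local_axis.
Qed.

End Decomposition.
End Axes.

(** * Frames, points and lines *)

Section LinearForms.
Variables (n : nat) (R : comNzRingType).
Implicit Types (A : 'M[R]_n) (v : 'rV[R]_n).

Definition linear_form A i : {mpoly R[n]} := \sum_j A j i *: 'X_j.

Lemma meval_linear_form A i v : (linear_form A i).@[v 0] = (v *m A) 0 i.
Proof.
rewrite /linear_form raddf_sum mxE; apply: eq_bigr => j _ /=.
by rewrite mevalZ mevalXU mulrC.
Qed.

Lemma linear_form_homog A i : linear_form A i \is 1.-homog for mdeg.
Proof. by apply: rpred_sum => j _; apply/rpredZ; rewrite dhomogX /= mdeg1. Qed.

Lemma mderiv_linear_form A i j : (linear_form A i)^`M(j) = (A j i)%:MP.
Proof.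
rewrite /linear_form raddf_sum (bigD1 j) //= big1 => [|k kj].
  by rewrite addr0 mderivZ mderivXU eqxx -mul_mpolyC mulr1.
by rewrite mderivZ mderivXU (negPf kj) scaler0.
Qed.

End LinearForms.

Section Frames.
Variables (n : nat) (K : fieldType).
Implicit Types (B : 'M[K]_n) (v : 'rV[K]_n) (i : 'I_n).

Lemma row_mul_invmx B i : B \in unitmx -> row i B *m invmx B = delta_mx 0 i.
Proof. by move=> uB; rewrite -row_mul mulmxV // row1. Qed.

Lemma unitmx_mulmx_eq0 B v : B \in unitmx -> (v *m B == 0) = (v == 0).
Proof.
move=> uB; apply/eqP/eqP => [vB0|->]; last exact: mul0mx.
by rewrite -[v](mulmxK uB) vB0 mul0mx.
Qed.

Lemma linear_form_row B i j :
  B \in unitmx -> (linear_form (invmx B) j).@[row i B 0] = (i == j)%:R.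
Proof. by move=> uB; rewrite meval_linear_form row_mul_invmx // mxE eqxx eq_sym. Qed.

Lemma linear_form_neq0 B i : B \in unitmx -> linear_form (invmx B) i != 0.
Proof.
move=> uB; have := linear_form_row i i uB; rewrite eqxx; apply: contra_eqN => /eqP ->.
by rewrite meval0 eq_sym oner_eq0.
Qed.

Lemma free_rows B (s : seq 'I_n) : B \in unitmx -> uniq s -> free [seq row i B | i <- s].
Proof.
move=> uB; elim: s => [|i s ih] /= => [_|/andP [is_ /ih frees]]; first exact: nil_free.
rewrite free_cons frees andbT; pose f : 'Hom('rV[K]_n, 'M[K]_1) :=
  linfun (mulmxr (invmx B *m delta_mx i 0)).
have fE j : f (row j B) = delta_mx 0 0 *+ (j == i).
  by rewrite lfunE /= mulmxA row_mul_invmx // mul_delta_mx_cond.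
have le_ker : (<<[seq row j B | j <- s]>> <= lker f)%VS.
  apply/span_subvP => _ /mapP [j js ->]; rewrite memv_ker fE.
  by have /negPf -> : j != i by apply: contraNneq is_ => <-.
apply/negP => /(subvP le_ker); rewrite memv_ker fE eqxx => /eqP/matrixP/(_ 0 0).
by rewrite !mxE eqxx => /eqP; rewrite oner_eq0.
Qed.

Lemma exists_frame (X : seq 'rV[K]_n) : free X ->
  exists2 B, B \in unitmx & forall i, (i < size X)%N -> row i B = X`_i.
Proof.
move=> freeX; pose C := (<<X>>^C)%VS; pose Y := X ++ vbasis C.
have spanC : (<<vbasis C>> = C)%VS by apply/span_basis/vbasisP.
have freeY : free Y.
  rewrite cat_free freeX (basis_free (vbasisP C)) spanC.
  by apply/directv_addP; rewrite capv_compl.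
have sizeY : size Y = n.
  rewrite size_cat size_tuple dimv_compl dimvf /dim /= mul1n (eqP freeX) subnKC //.
  by have := dimvS (subvf <<X>>); rewrite dimvf /dim /= mul1n (eqP freeX).
exists (\matrix_(i < n) Y`_i) => [|i iX]; last by rewrite rowK nth_cat iX.
rewrite -row_free_unit; apply: inj_row_free => c cY.
have [Y' YE] : exists Y' : n.-tuple 'rV[K]_n, Y = Y'.
  by exists (tcast sizeY (in_tuple Y)); rewrite val_tcast.
apply/rowP => i; rewrite mxE; rewrite YE in freeY cY *; move/freeP: freeY; apply.
by rewrite -[RHS]cY mulmx_sum_row; apply: eq_bigr => j _; rewrite rowK.
Qed.

End Frames.

Lemma ord3_ind (P : 'I_3 -> Prop) : P 0 -> P 1 -> P 2 -> forall i, P i.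
Proof.
move=> P0 P1 P2 i; have : i \in [:: 0; 1; 2] by case: i => [[|[|[|//]]] ?].
by rewrite !inE => /or3P [] /eqP ->.
Qed.

Lemma big_ord3 (V : nmodType) (F : 'I_3 -> V) : \sum_i F i = F 0 + F 1 + F 2.
Proof.
by rewrite !big_ord_recl big_ord0 addr0 addrA; congr (_ + F _ + F _); apply: val_inj.
Qed.

Section Row3.
Variable K : fieldType.
Implicit Types (a b c : K) (u v : 'rV[K]_3) (B : 'M[K]_3).

Definition row3 a b c : 'rV[K]_3 := \row_j nth 0 [:: a; b; c] j.

Lemma row3E a b c : (row3 a b c 0 0 = a) * (row3 a b c 0 1 = b) * (row3 a b c 0 2 = c).
Proof. by rewrite !mxE. Qed.

Lemma row3P u v : u 0 0 = v 0 0 -> u 0 1 = v 0 1 -> u 0 2 = v 0 2 -> u = v.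
Proof. by move=> e0 e1 e2; apply/rowP; apply: ord3_ind. Qed.

Lemma row3K v : row3 (v 0 0) (v 0 1) (v 0 2) = v.
Proof. by apply: row3P; rewrite row3E. Qed.

Lemma scale_row3 c x y z : c *: row3 x y z = row3 (c * x) (c * y) (c * z).
Proof. by apply: row3P; rewrite mxE !row3E. Qed.

Lemma row3_eq a b c a' b' c' :
  (row3 a b c == row3 a' b' c') = [&& a == a', b == b' & c == c'].
Proof.
apply/eqP/and3P => [e|[/eqP -> /eqP -> /eqP -> //]].
by have := row3E a b c; rewrite e !row3E => -[[-> ->] ->].
Qed.

Lemma row3_eq0 a b c : (row3 a b c == 0) = [&& a == 0, b == 0 & c == 0].
Proof. by rewrite -row3_eq; congr (_ == _); apply: row3P; rewrite row3E mxE. Qed.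

Lemma row3_neq0 v : (v != 0) = [|| v 0 0 != 0, v 0 1 != 0 | v 0 2 != 0].
Proof. by rewrite -[v in LHS]row3K row3_eq0 !negb_and. Qed.

Lemma mul_row3 a b c B : row3 a b c *m B = a *: row 0 B + b *: row 1 B + c *: row 2 B.
Proof. by rewrite mulmx_sum_row big_ord3 !row3E. Qed.

Definition frame3 (u0 u1 u2 : 'rV[K]_3) : 'M[K]_3 :=
  \matrix_(i < 3) nth 0 [:: u0; u1; u2] i.

Lemma row_frame3 u0 u1 u2 : (row 0 (frame3 u0 u1 u2) = u0) *
  (row 1 (frame3 u0 u1 u2) = u1) * (row 2 (frame3 u0 u1 u2) = u2).
Proof. by rewrite !rowK. Qed.

Lemma mul_row3_line x y B : row3 x y 0 *m B = x *: row 0 B + y *: row 1 B.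
Proof. by rewrite mul_row3 scale0r addr0. Qed.

Lemma frame_line_eq0 B x y :
  B \in unitmx -> (x *: row 0 B + y *: row 1 B == 0) = (x == 0) && (y == 0).
Proof. by move=> uB; rewrite -mul_row3_line unitmx_mulmx_eq0 // row3_eq0 eqxx andbT. Qed.

End Row3.

Section Points.
Variable K : fieldType.
Implicit Types (u v : 'rV[K]_3) (p q : proj_point K) (l : proj_line K).
Implicit Types (F G : {mpoly K[3]}) (B : 'M[K]_3).

Definition pt_vec p : 'rV[K]_3 := vpick (val p).

Lemma pt_vec_neq0 p : pt_vec p != 0.
Proof. by rewrite vpick0 -dimv_eq0 (eqP (valP p)). Qed.

Lemma mem_pt_vec p : pt_vec p \in val p.
Proof. exact: memv_pick. Qed.

Lemma val_point p v : v != 0 -> v \in val p -> val p = <[v]>%VS.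
Proof.
move=> v0 vp; apply/esym/eqP.
by rewrite eqEdim dim_vline v0 (eqP (valP p)) leqnn andbT -memvE.
Qed.

Lemma val_pt_vec p : val p = <[pt_vec p]>%VS.
Proof. exact: val_point (pt_vec_neq0 p) (mem_pt_vec p). Qed.

Lemma mem_pointP p v : v != 0 -> v \in val p -> exists2 c, c != 0 & v = c *: pt_vec p.
Proof.
rewrite val_pt_vec => v0 /vlineP [c vE]; exists c => //.
by apply: contraNneq v0 => c0; rewrite vE c0 scale0r.
Qed.

Lemma point_eq p q v : v != 0 -> v \in val p -> v \in val q -> p = q.
Proof.
by move=> v0 vp vq; apply: val_inj; rewrite /= (val_point v0 vp) (val_point v0 vq).
Qed.

Definition point_of u (u0 : u != 0) : proj_point K :=
  exist (fun U : {vspace 'rV[K]_3} => \dim U == 1%N) <[u]>%VS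
    (introT eqP (etrans (dim_vline u) (congr1 nat_of_bool u0))).

Lemma mem_point_of u (u0 : u != 0) : u \in val (point_of u0).
Proof. exact: memv_line. Qed.

Definition on_curve F p := F.@[pt_vec p 0] == 0.

Lemma on_curveP F p : reflect (vanishes F p) (on_curve F p).
Proof. exact: eqP. Qed.

Lemma on_curve_mem F d p v :
  homogeneous F d -> v != 0 -> v \in val p -> on_curve F p = (F.@[v 0] == 0).
Proof.
move=> homF v0 /(mem_pointP v0) [c c0 ->].
by rewrite (meval_homogZ homF) mulf_eq0 expf_eq0 (negPf c0) andbF.
Qed.

Lemma on_curve_prod (cs : seq {mpoly K[3]}) p :
  on_curve (\prod_(G <- cs) G) p = has (on_curve^~ p) cs.
Proof.
rewrite /on_curve; elim: cs => [|G cs ih]; first by rewrite big_nil meval1 oner_eq0.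
by rewrite big_cons mevalM mulf_eq0 ih.
Qed.

Lemma exists_line_through p : exists l, on_line p l.
Proof.
have [|B uB B0] := @exists_frame 3 K [:: pt_vec p];
  first by rewrite seq1_free pt_vec_neq0.
have dl : \dim <<[:: row 0 B; row 1 B]%R>> == 2%N.
  by have := free_rows (s := [:: 0; 1]) uB isT; rewrite /free.
exists (exist (fun U : {vspace 'rV[K]_3} => \dim U == 2%N) _ dl).
have r0 : row 0 B = pt_vec p := B0 0 isT.
by rewrite /on_line val_pt_vec -memvE memv_span // -r0 mem_head.
Qed.

Lemma exists_adapted_frame x : (if x.2 is Some l then on_line x.1 l else true) ->
  exists2 B, adapted_frame x B & row 0 B = pt_vec x.1.
Proof.
case: x => p [l|] /= pl; last first.
  have [|B uB B0] := @exists_frame 3 K [:: pt_vec p];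
    first by rewrite seq1_free pt_vec_neq0.
  have r0 : row 0 B = pt_vec p := B0 0 isT.
  by exists B => //; split=> //=; rewrite r0 mem_pt_vec.
have /subvPn [v vl vp] : ~~ (val l <= val p)%VS.
  by apply/negP => /dimvS; rewrite (eqP (valP p)) (eqP (valP l)).
have [|B uB Bi] := @exists_frame 3 K [:: pt_vec p; v].
  rewrite (perm_free (permEl (perm_catC [:: pt_vec p] [:: v]))) free_cons seq1_free.
  by rewrite span_seq1 -val_pt_vec vp pt_vec_neq0.
have r0 : row 0 B = pt_vec p := Bi 0 isT; have r1 : row 1 B = v := Bi 1 isT.
by exists B => //; split=> //=; rewrite ?r0 ?r1 ?mem_pt_vec.
Qed.

Lemma adapted_frame_line p l B : on_line p l -> adapted_frame (p, Some l) B ->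
  val l = <<[:: row 0 B; row 1 B]%R>>%VS.
Proof.
move=> pl [uB /= r0 r1]; apply/esym/eqP; rewrite eqEdim (eqP (valP l)).
have /eqP -> := free_rows (s := [:: 0; 1]) uB isT.
rewrite andbT; apply/span_subvP => v; rewrite !inE => /orP [] /eqP -> //.
exact: (subvP pl).
Qed.

End Points.

(** * Tangent spaces *)

Section Differential.
Variable K : fieldType.

Section AnyDimension.
Variable n : nat.
Implicit Types (u v : 'rV[K]_n) (F : {mpoly K[n]}) (B : 'M[K]_n).

Definition gradient F u : 'cV[K]_n := \col_j F^`M(j).@[u 0].
Definition differential F u v := (v *m gradient F u) 0 0.

Lemma differentialE F u v : differential F u v = \sum_j F^`M(j).@[u 0] * v 0 j.
Proof. by rewrite /differential mxE; apply: eq_bigr => j _; rewrite mxE mulrC. Qed.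

Lemma differential_euler F d u :
  F \is d.-homog for mdeg -> F.@[u 0] = 0 -> differential F u u = 0.
Proof.
move=> /euler_homog /(congr1 (meval (u 0))) + Fu; rewrite mevalZ Fu mulr0 => <-.
rewrite differentialE raddf_sum /=; apply: eq_bigr => j _.
by rewrite mevalM mevalXU mulrC.
Qed.

Definition smooth_at u F := F.@[u 0] = 0 -> gradient F u != 0.

Lemma differential_frame F u B : B \in unitmx ->
  (forall i, differential F u (row i B) = 0) -> gradient F u = 0.
Proof.
move=> uB d0; rewrite -[gradient F u](mulKmx uB) (_ : B *m _ = 0) ?mulmx0 //.
apply/colP => i; rewrite [RHS]mxE -[RHS](d0 i) /differential -row_mul.
by rewrite [RHS]mxE.
Qed.

End AnyDimension.

Implicit Types (u v : 'rV[K]_3) (p : proj_point K) (F : {mpoly K[3]}) (B : 'M[K]_3).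

Lemma smooth_curve_at F p : smooth_curve F -> smooth_at (pt_vec p) F.
Proof.
move=> [_ Sing0] Fp; apply/eqP => grad0; have : Sing F p; last by rewrite Sing0.
by split=> // i; move/colP/(_ i): grad0; rewrite !mxE.
Qed.

Lemma differential_row2 F d B :
  homogeneous F d -> B \in unitmx -> smooth_at (row 0 B) F ->
  F.@[row 0 B 0] = 0 -> differential F (row 0 B) (row 1 B) = 0 ->
  differential F (row 0 B) (row 2 B) != 0.
Proof.
move=> homF uB smF Fu d1; apply: contraNneq (smF Fu) => d2.
apply/eqP/(differential_frame uB).
have d0 := differential_euler homF Fu.
exact: ord3_ind.
Qed.

Definition tangent_space F p : {vspace 'rV[K]_3} :=
  lker (linfun (mulmxr (gradient F (pt_vec p)))).

Lemma mem_tangent_space F p v :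
  (v \in tangent_space F p) = (differential F (pt_vec p) v == 0).
Proof.
rewrite memv_ker lfunE /= /differential; apply/eqP/eqP => [->|d0]; first by rewrite mxE.
by apply/matrixP => i j; rewrite !ord1 d0 mxE.
Qed.

Lemma dim_tangent_space F p :
  smooth_at (pt_vec p) F -> on_curve F p -> \dim (tangent_space F p) == 2%N.
Proof.
move=> smF /eqP Fp; have := smF Fp; rewrite /tangent_space; set f := linfun _ => grad0.
have dimT := limg_ker_dim f fullv; rewrite capfv dimvf /dim /= mul1n in dimT.
have dim_im : \dim (limg f) = 1%N.
  apply/eqP; rewrite eqn_leq; apply/andP; split.
    by have := dimvS (subvf (limg f)); rewrite dimvf /dim /= mul1n.
  rewrite lt0n dimv_eq0; apply: contraNneq grad0 => im0.
  apply/eqP/(@differential_frame _ _ _ 1%:M) => [|i]; first exact: unitmx1.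
  have := memv_img f (memvf (row i 1%:M)); rewrite im0 memv0 lfunE /= => /eqP dE.
  by rewrite /differential dE mxE.
by move: dimT; rewrite dim_im addn1 => -[->].
Qed.

Lemma tangent_line F d p l B :
  homogeneous F d -> smooth_at (pt_vec p) F -> on_curve F p ->
  on_line p l -> adapted_frame (p, Some l) B -> row 0 B = pt_vec p ->
  (differential F (pt_vec p) (row 1 B) == 0) = (tangent_space F p == val l).
Proof.
move=> homF smF Fp pl aB r0; rewrite -mem_tangent_space.
apply/idP/eqP => [r1T|->]; last by have [] := aB.
apply/esym/eqP; rewrite eqEdim (eqP (dim_tangent_space smF Fp)) (eqP (valP l)) andbT.
rewrite (adapted_frame_line pl aB); apply/span_subvP => v.
rewrite !inE => /orP [] /eqP -> //.
by rewrite mem_tangent_space r0 (differential_euler homF (eqP Fp)).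
Qed.

End Differential.

(** * Local equations on the blow-up *)

Section Pullback.
Variable K : fieldType.
Implicit Types (F G : {mpoly K[3]}) (B : 'M[K]_3) (p : proj_point K) (x : blowup_point K).
Implicit Types (f : {mpoly K[2]}) (m k : nat).

HB.instance Definition _ x B := GRing.RMorphism.copy (pullback x B)
  (comp_mpoly [tuple \sum_(i < 3) B i j *: chart_weight x i | j < 3]).

Lemma pullbackX x B j : pullback x B 'X_j = \sum_(i < 3) B i j *: chart_weight x i.
Proof. by rewrite /pullback comp_mpolyXU -tnth_nth tnth_mktuple. Qed.

Lemma meval0_chart_weight x i : (chart_weight x i).@[fun=> 0] = (i == 0)%:R.
Proof.
elim/ord3_ind: i; rewrite /chart_weight /= ?meval1 ?mevalXU //.
by case: x.2 => [l|]; rewrite ?mevalM !mevalXU ?mul0r.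
Qed.

Lemma meval0_pullback x B F : (pullback x B F).@[fun=> 0] = F.@[row 0 B 0].
Proof.
rewrite comp_mpoly_meval; apply: meval_eq => j; rewrite tnth_mktuple big_ord3.
by rewrite !mevalD !mevalZ !meval0_chart_weight mulr1 !mulr0 !addr0 mxE.
Qed.

Lemma pullback_linear_form x B (A : 'M[K]_3) (k : 'I_3) : pullback x B (linear_form A k) =
  \sum_(i < 3) (linear_form A k).@[row i B 0] *: chart_weight x i.
Proof.
rewrite /linear_form rmorph_sum /=.
under [in LHS]eq_bigr => j _ do rewrite -mul_mpolyC rmorphM /= pullbackX mulr_sumr.
rewrite exchange_big; apply: eq_bigr => i _ /=.
rewrite -/(linear_form A k) meval_linear_form.
rewrite mxE scaler_suml; apply: eq_bigr => j _.
by rewrite {1}/pullback comp_mpolyC mul_mpolyC scalerA mxE mulrC.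
Qed.

Lemma pullback_line_restrict p B F :
  axis_restrict ord0 (pullback (p, None) B F) = line_restrict (row 0 B) (row 1 B) F.
Proof.
apply: (mpoly_rmorph_ext (f := axis_restrict ord0 \o pullback (p, None) B)) => [c|j] /=.
  by rewrite /pullback comp_mpolyC axis_restrictC line_restrictC.
rewrite pullbackX line_restrictX big_ord3 /chart_weight /= !rmorphD /=.
rewrite -!mul_mpolyC !rmorphM /=.
rewrite !axis_restrictC !axis_restrictX /= rmorph1 mulr1 mulr0 addr0 !mxE.
by rewrite ['X * _]mulrC.
Qed.

Lemma pullback_exceptional p l B F : exists r, pullback (p, Some l) B F =
  F.@[row 0 B 0]%:MP + coord_s K * ((differential F (row 0 B) (row 1 B))%:MP
     + (differential F (row 0 B) (row 2 B))%:MP * coord_t K) + coord_s K ^+ 2 * r.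
Proof.
pose h j : {mpoly K[2]} := (B 1 j)%:MP + (B 2 j)%:MP * coord_t K.
have [r rE] := meval_taylor1 (@mpolyC 2 K) (row 0 B 0) (coord_s K) h F.
exists r.
transitivity (mmap (@mpolyC 2 K) (fun j => (row 0 B 0 j)%:MP + coord_s K * h j) F).
  rewrite /pullback /comp_mpoly /mmap; apply: eq_bigr => m _; congr (_ * _).
  apply: mmap1_eq => j; rewrite tnth_mktuple big_ord3 /chart_weight /h /=.
  rewrite mxE -!mul_mpolyC.
  by ring.
rewrite rE; congr (_ + _ * _ + _); rewrite !differentialE !raddf_sum mulr_suml -big_split.
by apply: eq_bigr => j _ /=; rewrite !mxE !mpolyCM /h; ring.
Qed.

(* The curve with total transform [f] has multiplicity [m] at the blown-up
   point, and its strict transform meets the exceptional curve [s = 0] at the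
   origin of the chart with multiplicity [k]. *)
Definition exceptional_type f m k f0 := f = coord_s K ^+ m * f0 /\
  exists2 g : {poly K}, axis_restrict ord_max f0 = 'X^k * g & g.[0] != 0.

Lemma exceptional_type_unit f : f.@[fun=> 0] != 0 -> exceptional_type f 0 0 f.
Proof.
move=> f0; rewrite /exceptional_type expr0 mul1r; split=> //.
by exists (axis_restrict ord_max f); rewrite ?mul1r // axis_restrict_horner0.
Qed.

Lemma exceptional_typeM f m k f0 f' m' k' f0' :
  exceptional_type f m k f0 -> exceptional_type f' m' k' f0' ->
  exceptional_type (f * f') (m + m') (k + k') (f0 * f0').
Proof.
move=> [-> [g fE g0]] [-> [g' f'E g'0]]; split; first by rewrite exprD mulrACA.
by exists (g * g'); rewrite ?rmorphM /= ?fE ?f'E ?exprD 1?mulrACA // hornerM mulf_neq0.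
Qed.

Lemma split_exceptional_type f m k f0 :
  exceptional_type f m k f0 -> split_exceptional f m f0.
Proof.
move=> [fE [g f0E g0]]; split=> // -[h hE]; move/eqP: f0E; apply/negP.
rewrite hE rmorphM /= axis_restrictX mul0r eq_sym mulf_neq0 ?expf_neq0 ?polyX_eq0 //.
by apply: contraNneq g0 => ->; rewrite horner0.
Qed.

Lemma quotient_dim_exceptional f m k f0 e : exceptional_type f m k f0 ->
  quotient_dim (fun=> True) (local_ideal f0 (coord_s K ^+ e)) (e * k).
Proof.
by move=> [_ [g f0E g0]]; apply: (@quotient_dim_local_axis_exp _ _ ord_max _ f0 k g).
Qed.

Lemma pullback_exceptional_type p l B F d :
  B \in unitmx -> homogeneous F d -> smooth_at (row 0 B) F ->
  exists f0, exceptional_type (pullback (p, Some l) B F) (F.@[row 0 B 0] == 0)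
    ((F.@[row 0 B 0] == 0) && (differential F (row 0 B) (row 1 B) == 0)) f0.
Proof.
move=> uB homF smF; have [F0|F0] /= := eqVneq; last first.
  exists (pullback (p, Some l) B F).
  by apply: exceptional_type_unit; rewrite meval0_pullback.
have [r ->] := pullback_exceptional p l B F.
set d1 := differential _ _ (row 1 B); set d2 := differential _ _ (row 2 B).
exists (d1%:MP + d2%:MP * coord_t K + coord_s K * r).
split; first by rewrite F0 mpolyC0 expr1 /=; ring.
have restrictE : axis_restrict ord_max (d1%:MP + d2%:MP * coord_t K + coord_s K * r) =
    d1%:P + d2%:P * 'X.
  by rewrite !rmorphD !rmorphM /= !axis_restrictC !axis_restrictX /= mul0r addr0.
have [d10|d10] /= := eqVneq d1 0.
  exists d2%:P; first by rewrite restrictE d10 add0r mulrC.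
  by rewrite hornerC (differential_row2 homF).
by exists (d1%:P + d2%:P * 'X); rewrite ?restrictE ?mul1r // !hornerE.
Qed.

Lemma pullback_exceptional_type_prod p l B (cs : seq {mpoly K[3]}) :
  B \in unitmx ->
  (forall G, G \in cs -> smooth_at (row 0 B) G /\ exists d, homogeneous G d) ->
  exists f0, exceptional_type (pullback (p, Some l) B (\prod_(G <- cs) G))
    (count (fun G => G.@[row 0 B 0] == 0) cs)
    (count (fun G => (G.@[row 0 B 0] == 0) &&
                     (differential G (row 0 B) (row 1 B) == 0)) cs) f0.
Proof.
move=> uB; elim: cs => [|G cs ih] csP /=.
  exists 1; rewrite big_nil rmorph1.
  by apply: exceptional_type_unit; rewrite meval1 oner_neq0.
have [smG [d homG]] := csP G (mem_head _ _).
have [f0 f0P] := @pullback_exceptional_type p l B G d uB homG smG.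
have [|f1 f1P] := ih; first by move=> H Hcs; apply: csP; rewrite inE Hcs orbT.
by exists (f0 * f1); rewrite big_cons rmorphM; apply: exceptional_typeM.
Qed.

End Pullback.

(** * Polynomials over an algebraically closed field *)

Section Avoidance.
Variables (n : nat) (K : numFieldType).
Implicit Types (U : {vspace 'rV[K]_n}) (v : 'rV[K]_n) (F : {mpoly K[n]}).

Lemma exists_meval_neq0 F : F != 0 -> exists v : 'rV_n, F.@[v 0] != 0.
Proof.
move=> F0; apply: contrapT => /forallNP F_eq0; case/eqP: F0.
apply: mpoly_eq0_everywhere => v.
by apply/eqP/negPn/negP/F_eq0.
Qed.

Lemma subspace_linear_form U : (\dim U < n)%N ->
  exists2 F, F != 0 & forall v : 'rV_n, v \in U -> F.@[v 0] = 0.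
Proof.
move=> dimU; have [B uB BE] := exists_frame (basis_free (vbasisP U)).
pose i := Ordinal dimU; exists (linear_form (invmx B) i); first exact: linear_form_neq0.
move=> v /coord_vbasis ->; rewrite meval_linear_form mulmx_suml summxE big1 // => j _.
have lt_jn := ltn_trans (ltn_ord j) dimU.
have <- : row (Ordinal lt_jn) B = (vbasis U)`_j by apply: BE; rewrite size_tuple /=.
rewrite -scalemxAl mxE row_mul_invmx // mxE eqxx -val_eqE /=.
by rewrite gtn_eqF ?mulr0.
Qed.

Lemma subspaces_hypersurface (s : seq {vspace 'rV[K]_n}) :
  (forall U, U \in s -> (\dim U < n)%N) -> exists2 F, F != 0 &
    forall U v, U \in s -> v \in U -> F.@[v 0] = 0.
Proof.
elim: s => [|U s ih] dims; first by exists 1; rewrite ?oner_neq0.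
have [F F0 FU] := subspace_linear_form (dims U (mem_head _ _)).
have [|G G0 Gs] := ih; first by move=> V Vs; apply: dims; rewrite inE Vs orbT.
exists (F * G); first exact: mulf_neq0.
move=> V v; rewrite inE mevalM => /predU1P [->|Vs] vV; first by rewrite FU ?mul0r.
by rewrite (Gs V) ?mulr0.
Qed.

Lemma avoid_subspaces (s : seq {vspace 'rV[K]_n}) :
  (forall U, U \in s -> (\dim U < n)%N) -> exists v, forall U, U \in s -> v \notin U.
Proof.
move=> /subspaces_hypersurface [F /exists_meval_neq0 [v Fv] Fs]; exists v => U Us.
by apply: contra Fv => /(Fs _ _ Us) ->.
Qed.

Lemma avoid_planes v (L : seq 'rV[K]_n) : (2 < n)%N ->
  exists2 w, w \notin <[v]>%VS & forall u, u \in L -> w \notin (<[v]> + <[u]>)%VS.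
Proof.
move=> n2; have [|w w_avoids] :=
  @avoid_subspaces (<[v]>%VS :: [seq (<[v]> + <[u]>)%VS | u <- L]).
  move=> U; rewrite inE => /predU1P [->|/mapP [u _ ->]].
    by rewrite dim_vline (leq_ltn_trans (leq_b1 _)) // ltnW.
  rewrite (leq_ltn_trans (dimv_add_leqif _ _)) // (leq_ltn_trans _ n2) // !dim_vline.
  exact: leq_add (leq_b1 _) (leq_b1 _).
exists w => [|u uL]; apply: w_avoids; first exact: mem_head.
by rewrite inE; apply/orP; right; apply/mapP; exists u.
Qed.

End Avoidance.

Section ClosedField.
Variable K : numClosedFieldType.

Lemma closed_poly_const (p : {poly K}) a b : (forall c, p.[c] != 0) -> p.[a] = p.[b].
Proof.
move=> p_neq0; have [/size1_polyC ->|lt1p] := leqP (size p) 1; first by rewrite !hornerC.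
have /closed_rootP [c] : size p != 1%N by rewrite gtn_eqF.
by rewrite rootE (negPf (p_neq0 c)).
Qed.

Lemma comp_prod_roots (c r : K) (rs : seq K) : c != 0 ->
  exists2 g,
    (c *: \prod_(z <- rs) ('X - z%:P)) \Po ('X + r%:P) = 'X^(count_mem r rs) * g &
    g.[0] != 0.
Proof.
move=> c0; elim: rs => [|z rs [g gE g0]] /=.
  exists c%:P; rewrite ?hornerC // big_nil comp_polyZ.
  by rewrite -polyC1 comp_polyC mul1r -mul_polyC mulr1.
rewrite big_cons scalerAr comp_polyM gE comp_polyB comp_polyX comp_polyC.
have [->|zr] := eqVneq z r; first by exists g; rewrite // addrK add1n exprS mulrA.
exists (('X + r%:P - z%:P) * g); first by rewrite mulrCA.
by rewrite hornerM mulf_neq0 // !hornerE subr_eq0 eq_sym.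
Qed.

Section AnyDimension.
Variable n : nat.
Implicit Types (u v w : 'rV[K]_n) (F g : {mpoly K[n]}).

Lemma line_restrict_roots u w F d : F \is d.-homog for mdeg -> F.@[w 0] != 0 ->
  exists2 rs : seq K, size rs = d &
    line_restrict u w F = F.@[w 0] *: \prod_(z <- rs) ('X - z%:P).
Proof.
move=> /(line_restrict_top u w) [le_size top] Fw.
have sizeE : size (line_restrict u w F) = d.+1.
  apply/eqP; rewrite eqn_leq le_size ltnNge; apply: contra Fw => le_d.
  by rewrite -top nth_default.
have [rs rsE] := closed_field_poly_normal (line_restrict u w F).
have lcE : lead_coef (line_restrict u w F) = F.@[w 0] by rewrite lead_coefE sizeE.
exists rs; last by rewrite {1}rsE lcE.
by move: sizeE; rewrite rsE lcE size_scale // size_prod_XsubC => -[].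
Qed.

Lemma meval_const_on_plane g v w :
  (forall x y, (x != 0) || (y != 0) -> g.@[(x *: v + y *: w) 0] != 0) ->
  g.@[v 0] = g.@[(0 : 'rV_n) 0].
Proof.
move=> g_neq0.
have gw t : t != 0 -> g.@[(t *: w) 0] = g.@[v 0].
  move=> t0; transitivity g.@[(v + t *: w) 0].
    have := closed_poly_const (p := line_restrict (t *: w) v g) 0 1.
    rewrite !horner_line_restrict scale0r scale1r addr0 [t *: w + v]addrC; apply=> c.
    by rewrite horner_line_restrict addrC g_neq0 // t0 orbT.
  have := closed_poly_const (p := line_restrict v (t *: w) g) 1 0.
  rewrite !horner_line_restrict scale0r scale1r addr0; apply=> c.
  by rewrite horner_line_restrict scalerA -[v]scale1r g_neq0 // oner_neq0.
have /eqP : 'X * (line_restrict 0 w g - g.@[v 0]%:P) = 0.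
  apply: poly_eq0_everywhere => c; rewrite !hornerE horner_line_restrict add0r.
  by have [->|c0] := eqVneq c 0; rewrite ?mul0r // gw // subrr mulr0.
rewrite mulf_eq0 polyX_eq0 /= subr_eq0 => /eqP /(congr1 (horner^~ 0)).
by rewrite horner_line_restrict scale0r addr0 hornerC => ->.
Qed.

(* In projective terms: a hypersurface of dimension at least 1 is infinite. *)
Lemma zeros_on_lines_const g (L : seq 'rV[K]_n) : (2 < n)%N ->
  (forall v, v != 0 -> g.@[v 0] = 0 -> exists2 u, u \in L & v \in <[u]>%VS) ->
  (msize g <= 1)%N.
Proof.
move=> n2 zeros_g; have g_const v : (forall u, u \in L -> v \notin <[u]>%VS) ->
    g.@[v 0] = g.@[(0 : 'rV_n) 0].
  move=> vL; have [->//|v0] := eqVneq v 0.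
  have [w wv wL] := @avoid_planes n K v L n2.
  apply: (@meval_const_on_plane _ _ w) => x y xy; apply/negP => /eqP g0.
  have [y0|y0] := eqVneq y 0.
    move: xy g0; rewrite y0 eqxx orbF scale0r addr0 => x0 /zeros_g [|u uL].
      by rewrite scaler_eq0 negb_or x0.
    by move=> /(memvZ x^-1); rewrite scalerK // (negPf (vL u uL)).
  have /zeros_g/(_ g0) [u uL /vlineP [c E]] : x *: v + y *: w != 0.
    apply: contraNneq wv => /eqP; rewrite addrC addr_eq0 => /eqP E.
    by rewrite -[w](scalerK y0) E memvZ // memvN memvZ // memv_line.
  case/negP: (wL u uL); rewrite -[w](scalerK y0) memvZ //.
  rewrite -[y *: w](addKr (x *: v)) E memv_add ?memvN ?memvZ ?memv_line //.
have [|F F0 FL] := @subspaces_hypersurface n K [seq <[u]>%VS | u <- L].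
  by move=> U /mapP [u _ ->]; rewrite dim_vline (leq_ltn_trans (leq_b1 _)) // ltnW.
suff -> : g = g.@[(0 : 'rV_n) 0]%:MP by rewrite msizeC leq_b1.
apply/eqP; rewrite -subr_eq0; apply/eqP/(mpoly_eq0_off_hypersurface F0) => v Fv.
rewrite mevalB mevalC g_const ?subrr // => u uL; apply: contra Fv => vu.
by rewrite (FL <[u]>%VS) //; apply/mapP; exists u.
Qed.

End AnyDimension.
End ClosedField.

(** * Self-intersection of a union of smooth curves *)

Lemma fsbig_fibers (T : choiceType) (A : set T) (I : eqType) (L : seq I) (W : I -> nat)
    (f : I -> T) : (forall a, a \in L -> W a != 0%N -> A (f a)) ->
  finite_set [set x | A x /\ (\sum_(a <- L) W a * (f a == x))%N <> 0%N] /\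
  \big[addn/0%N]_(x \in A) (\sum_(a <- L) W a * (f a == x))%N = (\sum_(a <- L) W a)%N.
Proof.
move=> WA; pose X := seq_fset tt [seq f a | a <- L & W a != 0%N].
have XP x : x \in X -> A x.
  by rewrite seq_fsetE => /mapP [a]; rewrite mem_filter => /andP [Wa aL] ->; apply: WA.
have fX a : a \in L -> W a != 0%N -> f a \in X.
  by move=> aL Wa; rewrite seq_fsetE map_f // mem_filter Wa.
have supp_X x : x \notin X -> (\sum_(a <- L) W a * (f a == x))%N = 0%N.
  move=> xX; rewrite big_seq big1 // => a aL; have [fx|_] := eqVneq; last exact: muln0.
  by apply/eqP; rewrite muln1; apply: contraNT xX; rewrite -fx; apply: fX.
split.
  apply: (sub_finite_set _ (finite_fset X)) => x /= [_ /eqP].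
  by apply: contraNT => /supp_X ->.
rewrite (fsbigE (enum_fset X)) ?fset_uniq //= => [|x _]; last exact: supp_X.
rewrite big_mkcond [LHS]big_seq; under eq_bigr => x xX do rewrite (mem_set (XP x xX)).
rewrite -big_seq exchange_big !big_seq; apply: eq_bigr => a aL /=.
have [->|Wa] := eqVneq (W a) 0%N; first by rewrite big1.
rewrite (bigD1_seq (f a)) ?fset_uniq ?fX //= eqxx muln1 big1 ?addn0 // => x.
by rewrite eq_sym => /negPf ->; rewrite muln0.
Qed.

Section LocalIntersection.
Variable K : fieldType.
Implicit Types (P : set (proj_point K)) (D : divisor K) (x : blowup_point K)
  (B : 'M[K]_3).

Lemma intersection_number_fibers P D D' (I : eqType) (L : seq I) (W : I -> nat)
    (f : I -> blowup_point K) :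
  (forall a, a \in L -> W a != 0%N -> blowup P (f a)) ->
  (forall x, blowup P x -> local_intersection x D D'
    (\sum_(a <- L) W a * (f a == x))%N) ->
  intersection_number P D D' (\sum_(a <- L) W a)%N.
Proof.
move=> fP localP; have [fin sumE] := fsbig_fibers fP.
by exists (fun x => (\sum_(a <- L) W a * (f a == x))%N).
Qed.

Lemma local_equation_exceptional p l B D m k f0 :
  exceptional_type (pullback (p, Some l) B (div_curve D)) m k f0 ->
  local_equation (p, Some l) B D (coord_s K ^+ div_exc D p * f0).
Proof. by move=> /split_exceptional_type splitD; exists m, f0. Qed.

Lemma local_equation_off x B G : G.@[row 0 B 0] != 0 ->
  local_equation x B (strict_transform G) (pullback x B G).
Proof.
case: x => p [l|] G0 //; rewrite -[pullback _ _ _]mul1r -(expr0 (coord_s K)).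
apply: local_equation_exceptional.
by apply: exceptional_type_unit; rewrite meval0_pullback.
Qed.

End LocalIntersection.

Section SmoothUnion.
Variables (K : numClosedFieldType) (cs : seq {mpoly K[3]}) (d : nat).
Implicit Types (p : proj_point K) (x : blowup_point K) (v : 'rV[K]_3).
Let F := \prod_(G <- cs) G.
Hypotheses (smooth_cs : forall G, G \in cs -> smooth_curve G) (homF : homogeneous F d).

Definition curve_mult p := count (fun G => on_curve G p) cs.
Definition tangent_count p (l : proj_line K) :=
  count (fun G => on_curve G p && (tangent_space G p == val l)) cs.

Let smooth_at_cs G p : G \in cs -> smooth_at (pt_vec p) G.
Proof. by move=> /smooth_cs; apply: smooth_curve_at. Qed.

Let homog_cs G : G \in cs -> exists e, homogeneous G e.
Proof. by move=> /smooth_cs [[_ [e _ homG]] _]; exists e. Qed.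

Lemma smooth_union_exceptional_type p l : on_line p l -> exists B f0,
  [/\ adapted_frame (p, Some l) B, row 0 B = pt_vec p &
      exceptional_type (pullback (p, Some l) B F) (curve_mult p) (tangent_count p l) f0].
Proof.
move=> pl; have [B aB r0] := @exists_adapted_frame _ (p, Some l) pl; have [uB _ _] := aB.
have [|f0] := @pullback_exceptional_type_prod _ p l B cs uB.
  by move=> G Gcs; rewrite r0; split; [apply: smooth_at_cs | apply: homog_cs].
rewrite r0 -/F => f0P; exists B, f0; split=> //.
congr (exceptional_type _ _ _ _): f0P; apply: eq_in_count => G Gcs.
rewrite -/(on_curve G p); case: (boolP (on_curve G p)) => //= Gp.
have [e homG] := homog_cs Gcs.
by rewrite (tangent_line homG (smooth_at_cs Gcs) Gp pl aB r0).
Qed.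

Lemma smooth_union_local_equation x : (if x.2 is Some l then on_line x.1 l else true) ->
  exists B f, [/\ adapted_frame x B, row 0 B = pt_vec x.1 &
                  local_equation x B (strict_transform F) f].
Proof.
case: x => p [l|] /= pl.
  have [B [f0 [aB r0 f0P]]] := smooth_union_exceptional_type pl.
  exists B, (coord_s K ^+ 0 * f0); split=> //.
  exact: (local_equation_exceptional (D := strict_transform F) f0P).
by have [B aB r0] := @exists_adapted_frame _ (p, None) pl;
  exists B, (pullback (p, None) B F).
Qed.

Lemma local_intersection_off x G : (if x.2 is Some l then on_line x.1 l else true) ->
  ~~ on_curve G x.1 -> local_intersection x (strict_transform F) (strict_transform G) 0.
Proof.
move=> /smooth_union_local_equation [B [f [aB r0 Ff]]] Gx; rewrite /on_curve -r0 in Gx.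
exists B, f, (pullback x B G); split=> //; first exact: local_equation_off.
by apply: quotient_dim_local_unitr; rewrite meval0_pullback.
Qed.

Section TransversalLine.
Variables (B : 'M[K]_3) (rs : seq K).
Hypotheses (uB : B \in unitmx) (F1 : F.@[row 1 B 0] != 0)
  (rsE : line_restrict (row 0 B) (row 1 B) F =
    F.@[row 1 B 0] *: \prod_(z <- rs) ('X - z%:P)).

Definition transversal := linear_form (invmx B) 2.
Definition line_vec r := row 0 B + r *: row 1 B.

Lemma line_vec_neq0 r : line_vec r != 0.
Proof. by rewrite /line_vec -[row 0 B]scale1r frame_line_eq0 // oner_eq0. Qed.

Definition line_point r := point_of (line_vec_neq0 r).

Lemma line_vec_inj a r r' : line_vec r = a *: line_vec r' -> r = r'.
Proof.
move/eqP; rewrite -subr_eq0 /line_vec scalerDr opprD addrACA -{1}[row 0 B]scale1r.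
rewrite scalerA -!scalerBl frame_line_eq0 // !subr_eq0 => /andP [/eqP <- /eqP ->].
by rewrite mul1r.
Qed.

Lemma transversal_line_vec r : transversal.@[line_vec r 0] = 0.
Proof.
rewrite meval_linear_form /line_vec -[row 0 B]scale1r -mul_row3_line mulmxK //.
by rewrite row3E.
Qed.

Lemma transversal_zero v : v != 0 -> transversal.@[v 0] = 0 -> F.@[v 0] = 0 ->
  exists a r, a != 0 /\ v = a *: line_vec r.
Proof.
rewrite meval_linear_form => v0 tv Fv; set c := v *m invmx B in tv.
have vE : v = c 0 0 *: row 0 B + c 0 1 *: row 1 B.
  by rewrite -mul_row3_line -[X in row3 _ _ X]tv row3K mulmxKV.
have c0 : c 0 0 != 0.
  apply: contraNneq F1 => c0; move/eqP: Fv.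
  rewrite vE c0 scale0r add0r (meval_homogZ homF).
  rewrite mulf_eq0 expf_eq0 => /orP [/andP [_ /eqP c1]|//].
  by case/eqP: v0; rewrite vE c0 c1 !scale0r addr0.
exists (c 0 0), (c 0 1 / c 0 0); split=> //.
by rewrite scalerDr scalerA mulrCA divff // mulr1.
Qed.

Lemma mem_line_roots r : (r \in rs) = (F.@[line_vec r 0] == 0).
Proof.
rewrite -horner_line_restrict rsE hornerZ mulf_eq0 (negPf F1) /=.
by rewrite -rootE root_prod_XsubC.
Qed.

Lemma local_intersection_line_point r :
  local_intersection (line_point r, None) (strict_transform F)
    (strict_transform (transversal ^+ d)) (d * count_mem r rs).
Proof.
pose B' := frame3 (line_vec r) (row 1 B) (row 2 B).
have B'E a b c : row3 a b c *m B' = row3 a (a * r + b) c *m B.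
  by rewrite !mul_row3 !row_frame3 scalerDr scalerDl scalerA addrA.
have uB' : B' \in unitmx.
  rewrite -row_free_unit; apply: inj_row_free => v; rewrite -[v]row3K B'E => /eqP.
  rewrite unitmx_mulmx_eq0 // row3_eq0 => /and3P [/eqP -> + /eqP ->].
  by rewrite mul0r add0r => /eqP ->; apply/eqP; rewrite row3_eq0 eqxx.
have transversalE : pullback (line_point r, None) B' transversal = coord_t K.
  rewrite pullback_linear_form big_ord3 !row_frame3 -/transversal transversal_line_vec.
  by rewrite !linear_form_row // !scale0r !add0r scale1r.
have [g gE g0] := comp_prod_roots r rs F1.
exists B', (pullback (line_point r, None) B' F), (coord_t K ^+ d); split=> //.
- by split=> //; rewrite row_frame3; apply: mem_point_of.
- by rewrite /local_equation /= rmorphXn /= transversalE.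
- apply: (@quotient_dim_local_axis_exp _ ord_max ord0 isT _ _ g) => //.
  by rewrite pullback_line_restrict !row_frame3 line_restrict_shift rsE gE.
Qed.

Lemma local_intersection_transversal x :
  (if x.2 is Some l then on_line x.1 l /\ ~~ on_curve transversal x.1 else true) ->
  local_intersection x (strict_transform F) (strict_transform (transversal ^+ d))
    (\sum_(r <- rs) d * ((line_point r, None) == x))%N.
Proof.
have off_transversal p : ~~ on_curve transversal p -> ~~ on_curve (transversal ^+ d) p.
  by rewrite /on_curve rmorphXn /= => /expf_neq0.
case: x => p [l|] /= => [[pl lp]|_].
  rewrite big1 => [|r _]; last by case: eqP => // _; rewrite muln0.
  by apply: local_intersection_off => //; apply: off_transversal.
have [[r ->]|not_line] := pselect (exists r, p = line_point r).
  rewrite -big_distrr /= (_ : (\sum_(r' <- rs) _)%N = count_mem r rs).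
    exact: local_intersection_line_point.
  rewrite -sum1_count [RHS]big_mkcond; apply: eq_bigr => r' _ /=.
  have [->|rr'] := eqVneq r' r; first by rewrite eqxx.
  case: eqP => // /(congr1 (fun x => val x.1)) /= span_eq.
  have := memv_line (line_vec r'); rewrite span_eq => /vlineP [a /line_vec_inj E].
  by rewrite E eqxx in rr'.
rewrite big1 => [|r _]; last by case: eqP => [[pE]|];
  [case: not_line; exists r | rewrite muln0].
have [tp|/off_transversal tp] := boolP (on_curve transversal p); last first.
  exact: (@local_intersection_off (p, None)).
have [Fp|Fp] := boolP (on_curve F p).
  have [a [r [a0 pE]]] := transversal_zero (pt_vec_neq0 p) (eqP tp) (eqP Fp).
  case: not_line; exists r; apply: (point_eq (pt_vec_neq0 p)); first exact: mem_pt_vec.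
  by rewrite pE memvZ // mem_point_of.
have [B0 aB0 r0] := @exists_adapted_frame _ (p, None) isT.
exists B0, (pullback (p, None) B0 F), (pullback (p, None) B0 (transversal ^+ d));
  split=> //.
by apply: quotient_dim_local_unitl; rewrite meval0_pullback r0.
Qed.

Variable P : set (proj_point K).
Hypothesis avoids_P : forall p, P p -> ~~ on_curve transversal p.

Lemma intersection_number_transversal : size rs = d ->
  intersection_number P (strict_transform F) (strict_transform (transversal ^+ d))
    (d ^ 2).
Proof.
move=> size_rs; have -> : (d ^ 2 = \sum_(r <- rs) d)%N.
  by rewrite big_const_seq count_predT size_rs iter_addn_0 mulnn.
apply: (intersection_number_fibers (f := fun r => (line_point r, None))) => [r _ _|x xP].
  move=> /avoids_P.
  rewrite (on_curve_mem (linear_form_homog _ _) (line_vec_neq0 r)) ?mem_point_of //.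
  by rewrite transversal_line_vec eqxx.
by apply: local_intersection_transversal; case: x xP => p [l|] //= [/avoids_P].
Qed.

Lemma no_common_component_transversal :
  no_common_component P (strict_transform F) (strict_transform (transversal ^+ d)).
Proof.
split=> [g h h' FE tE|]; last by left.
apply: (@zeros_on_lines_const _ _ g [seq line_vec r | r <- rs]) => // v v0 gv.
have Fv : F.@[v 0] = 0 by rewrite [F]FE mevalM gv mul0r.
have /eqP : (transversal ^+ d).@[v 0] = 0 by rewrite [_ ^+ d]tE mevalM gv mul0r.
rewrite rmorphXn expf_eq0 => /andP [_ /eqP tv].
have [a [r [a0 vE]]] := transversal_zero v0 tv Fv.
exists (line_vec r); last by rewrite vE memvZ // memv_line.
apply: map_f; rewrite mem_line_roots; apply: contraTT (introT eqP Fv).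
by rewrite vE (meval_homogZ homF); apply: mulf_neq0; apply: expf_neq0.
Qed.

Lemma lin_equiv_transversal :
  lin_equiv P (add_divisor (strict_transform F) (Divisor 1 curve_mult))
    (strict_transform (transversal ^+ d)).
Proof.
exists d, F, (transversal ^+ d); split=> //.
- by apply: contraNneq F1 => ->; rewrite meval0.
- by rewrite expf_neq0 // linear_form_neq0.
- by have := dhomogMn d (linear_form_homog (invmx B) 2); rewrite mul1n.
split=> [|p Pp]; first by rewrite /= mulr1 mulrC.
have [l pl] := exists_line_through p.
have [B' [f0 [aB' r0 f0P]]] := smooth_union_exceptional_type pl.
exists (curve_mult p), 0%N; split; last by rewrite /= add0n addn0.
  by exists (p, Some l), B', f0; split=> //; apply: split_exceptional_type f0P.
exists (p, Some l), B', (pullback (p, Some l) B' (transversal ^+ d)); split=> //.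
apply: split_exceptional_type; apply: exceptional_type_unit.
by rewrite meval0_pullback r0 rmorphXn expf_neq0 // avoids_P.
Qed.

End TransversalLine.

Lemma exists_transversal (P : set (proj_point K)) : F != 0 -> finite_set P ->
  (forall p, P p -> on_curve F p) ->
  exists B, [/\ B \in unitmx, F.@[row 1 B 0] != 0 &
    forall p, P p -> ~~ on_curve (transversal B) p].
Proof.
move=> F0 finP PF; have [|v] := @exists_meval_neq0 3 K (F * 'X_0).
  by rewrite mulf_neq0 // mpolyX_neq0.
rewrite mevalM mevalXU mulf_eq0 negb_or => /andP [Fv v00].
have v0 : v != 0 by apply: contraNneq v00 => ->; rewrite mxE.
have [//|w wv w_avoids] := @avoid_planes 3 K v [seq pt_vec p | p <- fset_set P].
have [|B uB BE] := @exists_frame 3 K [:: w; v].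
  by rewrite free_cons seq1_free span_seq1 wv v0.
have r0 : row 0 B = w := BE 0 isT; have r1 : row 1 B = v := BE 1 isT.
exists B; split; rewrite ?r1 // => p Pp; apply/negP => /eqP.
rewrite meval_linear_form; set c := pt_vec p *m invmx B => c2.
have pE : pt_vec p = c 0 0 *: w + c 0 1 *: v.
  by rewrite -r0 -r1 -mul_row3_line -[X in row3 _ _ X]c2 row3K mulmxKV.
have [c0|c0] := eqVneq (c 0 0) 0.
  have := PF p Pp; rewrite /on_curve pE c0 scale0r add0r (meval_homogZ homF).
  rewrite mulf_eq0 (negPf Fv).
  rewrite orbF expf_eq0 => /andP [_ /eqP c1].
  by case/eqP: (pt_vec_neq0 p); rewrite pE c0 c1 !scale0r addr0.
have p_P : pt_vec p \in [seq pt_vec q | q <- fset_set P].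
  by apply: map_f; rewrite in_fset_set //; apply: mem_set.
case/negP: (w_avoids _ p_P); rewrite -[w](scalerK c0) memvZ //.
rewrite -[c 0 0 *: w](addrK (c 0 1 *: v)) -pE addrC.
by rewrite memv_add ?memvN ?memvZ ?memv_line.
Qed.

Lemma local_intersection_exceptional x :
  (if x.2 is Some l then on_line x.1 l else true) ->
  local_intersection x (strict_transform F) (Divisor 1 curve_mult)
    (if x.2 is Some l then curve_mult x.1 * tangent_count x.1 l else 0).
Proof.
case: x => p [l|] /= pl; last first.
  have [B aB r0] := @exists_adapted_frame _ (p, None) isT.
  exists B, (pullback (p, None) B F), 1; split=> //;
    first by rewrite /local_equation /= rmorph1.
  by apply: quotient_dim_local_unitr; rewrite meval1 oner_neq0.
have [B [f0 [aB r0 f0P]]] := smooth_union_exceptional_type pl.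
exists B, f0, (coord_s K ^+ curve_mult p); split=> //;
  last exact: quotient_dim_exceptional f0P.
  rewrite -[f0]mul1r -(expr0 (coord_s K)).
  exact: (local_equation_exceptional (D := strict_transform F) f0P).
have unit1 : exceptional_type (pullback (p, Some l) B 1) 0 0 1.
  by rewrite rmorph1; apply: exceptional_type_unit; rewrite meval1 oner_neq0.
rewrite -[coord_s K ^+ _]mulr1.
exact: (local_equation_exceptional (D := Divisor 1 curve_mult) unit1).
Qed.

Lemma insub_tangent_space G p : G \in cs -> on_curve G p ->
  exists2 l : proj_line K, insub (tangent_space G p) = Some l & val l = tangent_space G p.
Proof.
move=> Gcs Gp; have dimT := dim_tangent_space (smooth_at_cs Gcs) Gp.
by exists (Sub (tangent_space G p) dimT); rewrite ?insubT.
Qed.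

Lemma intersection_number_exceptional (P : set (proj_point K)) : finite_set P ->
  intersection_number P (strict_transform F) (Divisor 1 curve_mult)
    (\sum_(p <- fset_set P) curve_mult p ^ 2)%N.
Proof.
move=> finP; pose L := [seq (p, G) | p <- enum_fset (fset_set P), G <- cs].
pose W (a : proj_point K * {mpoly K[3]}) := (on_curve a.2 a.1 * curve_mult a.1)%N.
pose tangent_dir (a : proj_point K * {mpoly K[3]}) : blowup_point K :=
  (a.1, insub (tangent_space a.2 a.1)).
have -> : (\sum_(p <- fset_set P) curve_mult p ^ 2 = \sum_(a <- L) W a)%N.
  rewrite big_allpairs_dep; apply: eq_bigr => p _ /=.
  by rewrite -mulnn {1}/curve_mult -sumn_count sumnE big_map big_distrl.
have inL a : a \in L -> P a.1 /\ a.2 \in cs.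
  by move=> /allpairsP [[p G] [pP Gcs ->]]; move: pP; rewrite in_fset_set // => /set_mem.
apply: (intersection_number_fibers (f := tangent_dir)) => [[p G] /inL [/= Pp Gcs]|x xP].
  rewrite /W /tangent_dir /=; case: (boolP (on_curve G p)) => // Gp _.
  have [l -> lE] := insub_tangent_space Gcs Gp; split=> //.
  have [e homG] := homog_cs Gcs.
  rewrite /on_line /= lE val_pt_vec -memvE mem_tangent_space.
  by rewrite (differential_euler homG) // (eqP Gp).
suff -> : (\sum_(a <- L) W a * (tangent_dir a == x) =
    if x.2 is Some l then curve_mult x.1 * tangent_count x.1 l else 0)%N.
  by apply: local_intersection_exceptional; case: x xP => p [l|] //= [].
case: x xP => p [l|] /= => [[Pp pl]|_]; last first.
  rewrite big_seq big1 // => -[q G] /inL [_ Gcs]; rewrite /W /tangent_dir /=.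
  case: (boolP (on_curve G q)) => // /(insub_tangent_space Gcs) [l -> _].
  by case: eqP; rewrite ?muln0.
have pP : p \in fset_set P by rewrite in_fset_set //; apply: mem_set.
rewrite big_allpairs_dep /= (bigD1_seq p pP (fset_uniq _)) /=.
rewrite [X in (_ + X)%N]big1 ?addn0 => [|q qp]; last first.
  by rewrite big1 // => G _; rewrite xpair_eqE (negPf qp) muln0.
rewrite /tangent_count -sum1_count big_distrr [RHS]big_mkcond !big_seq.
apply: eq_bigr => G Gcs; rewrite /W /tangent_dir /= xpair_eqE eqxx.
case: (boolP (on_curve G p)) => //= /(insub_tangent_space Gcs) [l' -> <-].
rewrite mul1n (inj_eq val_inj); case: ifP => [/eqP ->|/negP l'l];
  first by rewrite eqxx muln1.
by case: eqP => [[E]|]; [case: l'l; rewrite E | rewrite muln0].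
Qed.

Lemma no_common_component_exceptional (P : set (proj_point K)) :
  no_common_component P (strict_transform F) (Divisor 1 curve_mult).
Proof.
split=> [g h h' _ gE|]; last by left.
apply: (@zeros_on_lines_const _ _ g [::]) => // v _ gv.
have /eqP : (1 : {mpoly K[3]}).@[v 0] = 0 by rewrite [1]gE mevalM gv mul0r.
by rewrite meval1 oner_eq0.
Qed.

Lemma self_intersection_smooth_union (P : set (proj_point K)) : finite_set P ->
  (forall p, P p -> on_curve F p) ->
  self_intersection P (strict_transform F)
    ((d ^ 2)%N%:Z - (\sum_(p <- fset_set P) curve_mult p ^ 2)%N%:Z).
Proof.
move=> finP PF; have F0 : F != 0.
  by rewrite prodf_seq_neq0; apply/allP => G /smooth_cs [[]].
have [B [uB F1 avoids_P]] := exists_transversal F0 finP PF.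
have [rs size_rs rsE] := line_restrict_roots (row 0 B) homF F1.
exists (strict_transform (transversal B ^+ d)), (Divisor 1 curve_mult).
do 2!eexists; split.
- split; split=> /=; rewrite ?expf_neq0 ?linear_form_neq0 ?oner_neq0 //.
  + by exists (1 * d)%N; apply/dhomogMn/linear_form_homog.
  + by exists 0%N; apply: dhomog1.
- split; first exact: no_common_component_transversal rsE _.
  exact: no_common_component_exceptional.
- exact: lin_equiv_transversal.
- split; first exact: intersection_number_transversal size_rs.
  exact: intersection_number_exceptional.
- by [].
Qed.

End SmoothUnion.

(** * Singular points and genus of plane curves *)

Section Singularities.
Variable K : numClosedFieldType.
Implicit Types (F G : {mpoly K[3]}) (p : proj_point K) (cs : seq {mpoly K[3]}).

Lemma gradientM n (F G : {mpoly K[n]}) (v : 'rV_n) :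
  gradient (F * G) v = F.@[v 0] *: gradient G v + G.@[v 0] *: gradient F v.
Proof. by apply/colP => j; rewrite !mxE mderivM mevalD !mevalM; ring. Qed.

Lemma Sing_mem F d p v : homogeneous F d -> v != 0 -> v \in val p ->
  Sing F p <-> F.@[v 0] = 0 /\ gradient F v = 0.
Proof.
move=> homF v0 vp; split=> [[Fp dFp]|[Fv /colP dFv]].
  split; first by apply/eqP; rewrite -(on_curve_mem homF v0 vp); apply/on_curveP.
  apply/colP => i; rewrite !mxE; apply/eqP.
  by rewrite -(on_curve_mem (mderiv_homog homF i) v0 vp); apply/on_curveP/dFp.
split=> [|i]; apply/on_curveP; first by rewrite (on_curve_mem homF v0 vp) Fv.
by have := dFv i; rewrite !mxE (on_curve_mem (mderiv_homog homF i) v0 vp) => ->.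
Qed.

Lemma gradient_prod_eq0 cs p : (forall G, G \in cs -> smooth_curve G) ->
  (0 < curve_mult cs p)%N ->
  (gradient (\prod_(G <- cs) G) (pt_vec p) == 0) = (1 < curve_mult cs p)%N.
Proof.
elim: cs => [|G cs ih] //= smooth_cs; rewrite big_cons gradientM.
have {}ih := ih (fun H Hcs => smooth_cs H (mem_behead (s := G :: cs) Hcs)).
have := on_curve_prod cs p; rewrite {1}/on_curve has_count -/(curve_mult cs p) => prod0.
case: (boolP (on_curve G p)) => Gp /=.
  rewrite (eqP Gp) scale0r add0r scaler_eq0 prod0 ltnS => _.
  by rewrite (negPf (smooth_curve_at (smooth_cs G (mem_head _ _)) (eqP Gp))) orbF.
move=> /[dup] /ih <-; rewrite -prod0 => /eqP ->.
by rewrite scale0r addr0 scaler_eq0; move: Gp; rewrite /on_curve => /negPf ->.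
Qed.

Lemma plane_curve_prod cs : cs != [::] -> (forall G, G \in cs -> plane_curve G) ->
  plane_curve (\prod_(G <- cs) G).
Proof.
elim: cs => // G cs ih _ csP; have [G0 [d d0 homG]] := csP G (mem_head _ _).
rewrite big_cons; have [->|cs0] := eqVneq cs [::].
  by rewrite big_nil mulr1; split=> //; exists d.
have [|F0 [e _ homF]] := ih cs0; first by move=> H Hcs; apply: csP; rewrite inE Hcs orbT.
by split; [rewrite mulf_neq0 | exists (d + e)%N; [rewrite addn_gt0 d0 | apply: dhomogM]].
Qed.

Lemma Sing_prod cs p : cs != [::] -> (forall G, G \in cs -> smooth_curve G) ->
  Sing (\prod_(G <- cs) G) p <-> (1 < curve_mult cs p)%N.
Proof.
move=> cs0 smooth_cs; have [|F0 [d _ homF]] := @plane_curve_prod cs cs0.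
  by move=> G /smooth_cs [].
rewrite (Sing_mem homF (pt_vec_neq0 p) (mem_pt_vec p)).
have := on_curve_prod cs p; rewrite /on_curve has_count -/(curve_mult cs p) => prod0.
split=> [[/eqP + /eqP]|mult2];
  first by rewrite prod0 => /(gradient_prod_eq0 smooth_cs) ->.
have mult1 := ltnW mult2; split; apply/eqP; first by rewrite prod0.
by rewrite gradient_prod_eq0.
Qed.

Lemma finite_Sing_reduced F : plane_curve F -> finite_set (Sing F) -> reduced_curve F.
Proof.
move=> curveF finS; split=> // g h FE; have [_ [d _ homF]] := curveF.
apply: (@zeros_on_lines_const _ _ g [seq pt_vec p | p <- fset_set (Sing F)]) => //.
move=> v v0 gv.
exists (pt_vec (point_of v0)); last by rewrite -val_pt_vec mem_point_of.
apply: map_f; rewrite in_fset_set //; apply/mem_set/(Sing_mem homF v0 (mem_point_of v0)).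
by rewrite FE expr2 !gradientM !mevalM gv !mul0r !scale0r !addr0 scaler0 addr0.
Qed.

Lemma hilbert_function_curve F e m : F != 0 -> homogeneous F e -> (e <= m)%N ->
  hilbert_function F m ('C(m + 2, 2) - 'C(m - e + 2, 2)).
Proof.
move=> F0 homF le_em; set k := (m - e)%N; have mE : m = (k + e)%N by rewrite subnK.
have dim_dhomog i : \dim {: dhomog 3 K i} = 'C(i + 2, 2).
  by rewrite dimvf /dim /= -['C(i + 2, i)]bin_sub ?leq_addr // addKn.
have homM (h : dhomog 3 K k) : (h : {mpoly K[3]}) * F \is m.-homog for mdeg.
  by rewrite mE; apply: dhomogM => //; apply: dhomog_is_dhomog.
pose mulF (h : dhomog 3 K k) : dhomog 3 K m := DHomog (homM h).
have linear_mulF : linear mulF.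
  by move=> c h h'; apply: val_inj; rewrite /= mulrDl scalerAl.
pose linear_map : {linear dhomog 3 K k -> dhomog 3 K m} := HB.pack mulF
  (GRing.isLinear.Build K (dhomog 3 K k) (dhomog 3 K m) _ mulF linear_mulF).
pose f := linfun linear_map.
have ker0 : lker f == 0%VS.
  apply/lker0P => h h'; rewrite !lfunE /= => /(congr1 val) /= E; apply: val_inj => /=.
  exact: (mulIf F0).
have dimf : \dim (limg f) = 'C(k + 2, 2).
  by rewrite limg_dim_eq ?dim_dhomog // (eqP ker0) capv0.
rewrite -dim_dhomog -dimf.
apply: (@quotient_dim_image K (dhomog 3 K m) _ (@mpoly_of_dhomog 3 K m)
  (fun h => h \in limg f)).
- move=> G; split=> [homG|[h ->]]; last exact: dhomog_is_dhomog.
  by exists (DHomog homG).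
- move=> G; split=> [[h GE]|/memv_imgP [h _ ->]]; last by exists (val h); rewrite lfunE.
  have [|h' homh' GE'] := @homog_quotient _ _ k e (val G) F h _ homF GE.
    by rewrite -mE; apply: dhomog_is_dhomog.
  by apply/memv_imgP; exists (DHomog homh'); rewrite ?memvf // lfunE; apply: val_inj.
- exact: quotient_dim_vspace.
Qed.

Lemma genus_degree F e :
  F != 0 -> homogeneous F e -> (0 < e)%N -> has_genus F 'C(e.-1, 2).
Proof.
move=> F0 homF e0; exists e, e => m le_em; eexists;
  first exact: hilbert_function_curve le_em.
have bin2_double i : ('C(i, 2) * 2 = i * i.-1)%N.
  by case: i => // i; rewrite mulnC -mul_bin_diag bin1.
have := bin2_double (m + 2)%N; have := bin2_double (m - e + 2)%N.
have := bin2_double e.-1.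
move: (m - e)%N (subnK le_em) => k <-.
by case: (e) e0 => [//|[|e']] _; rewrite !addnS !addn0 /=; lia.
Qed.

End Singularities.

(** * Torsion parameters *)

Section CubeRoots.
Variables (K : numClosedFieldType) (w : K).
Hypothesis sqr_w : w ^+ 2 = - w - 1.
Implicit Types (x y a b c : K) (t u v : K * K).

Lemma natr3_neq0 : 3 != 0 :> K.
Proof. by rewrite pnatr_eq0. Qed.

Lemma prim_cube_root : 3.-primitive_root w.
Proof.
have [|m m_prim] := @prim_order_exists K 3 w isT; first by ring: sqr_w.
rewrite dvdn_divisors // !inE => /orP [] /eqP mE; rewrite mE in m_prim => //.
have w1 : w = 1 by have := prim_expr_order m_prim; rewrite expr1.
by case/eqP: natr3_neq0; transitivity (w ^+ 2 + w + 1); [rewrite w1 | ]; ring: sqr_w.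
Qed.

Lemma cube_root_exp3 j : (w ^+ j) ^+ 3 = 1.
Proof. by rewrite exprAC (prim_expr_order prim_cube_root) expr1n. Qed.

Lemma cube_root_exp_neq0 j : w ^+ j != 0.
Proof. by rewrite expf_neq0 // (prim_root_eq0 prim_cube_root). Qed.

Lemma cube_root_exp_inj i j : (i < 3)%N -> (j < 3)%N -> (w ^+ i == w ^+ j) = (i == j).
Proof. by move=> i3 j3; rewrite (eq_prim_root_expr prim_cube_root) !modn_small. Qed.

Lemma subr1_cube_root_neq0 : w - 1 != 0.
Proof. by rewrite subr_eq0 -[w]expr1 -(expr0 w) cube_root_exp_inj. Qed.

Lemma cube_rootsP x y : x ^+ 3 = y ^+ 3 -> exists2 j, (j < 3)%N & x = w ^+ j * y.
Proof.
have [->|y0] := eqVneq y 0.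
  by rewrite expr0n => /eqP; rewrite expf_eq0 => /eqP ->; exists 0%N; rewrite ?mulr0.
move=> xy3; have /(prim_rootP prim_cube_root) [j jE] : (x / y) ^+ 3 = 1.
  by rewrite expr_div_n xy3 divff // expf_neq0.
by exists j; rewrite // -jE divfK.
Qed.

Lemma count_cube_roots x y : (x != 0) || (y != 0) ->
  count (fun j => x == w ^+ j * y) (iota 0 3) = (x ^+ 3 == y ^+ 3).
Proof.
move=> xy0; have [/cube_rootsP [j j3 xE]|xy3] := eqVneq.
  have y0 : y != 0 by apply: contraTneq xy0 => y0; rewrite xE y0 mulr0 eqxx.
  rewrite -[RHS](_ : count_mem j (iota 0 3) = 1%N); last first.
    by rewrite count_uniq_mem ?iota_uniq // mem_iota j3.
  apply: eq_in_count => i; rewrite mem_iota /= => i3.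
  by rewrite xE (inj_eq (mulIf y0)) cube_root_exp_inj // eq_sym.
apply/eqP; rewrite -leqn0 leqNgt -has_count; apply/hasPn => j _.
by apply: contra_neqN xy3 => /eqP ->; rewrite exprMn cube_root_exp3 mul1r.
Qed.

(* A pair [t] stands for the point [t.1 : t.2] of the projective line. The
   coordinate [u] makes the elliptic curve [v ^ 3 = u ^ 3 - 1] a triple cover
   of this line, branched at the points [branch]; [lattes] is induced by an
   endomorphism of degree 3 of the curve, so its iterates map to [branch]
   exactly the images of certain torsion points. *)
Definition branch t := t.1 ^+ 3 == t.2 ^+ 3.
Definition lattes t : K * K :=
  (w ^+ 2 * t.1 ^+ 3 + t.2 ^+ 3, t.1 ^+ 3 + w ^+ 2 * t.2 ^+ 3).
Definition torsion n t := ~~ branch t && branch (iter n lattes t).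
Definition swap t : K * K := (t.2, t.1).
Definition proportional t u := t.1 * u.2 == t.2 * u.1.

(* Collinearity of three points with first coordinates [a_i / b_i] on the
   elliptic curve [v ^ 3 = u ^ 3 - 1], with [v] eliminated. *)
Definition collinear t1 t2 t3 :=
  (t1.1 * t2.1 * t3.1 - t1.2 * t2.2 * t3.2) ^+ 3 =
  (t1.1 ^+ 3 - t1.2 ^+ 3) * (t2.1 ^+ 3 - t2.2 ^+ 3) * (t3.1 ^+ 3 - t3.2 ^+ 3).

Lemma pair_neq0 t : (t != 0) = (t.1 != 0) || (t.2 != 0).
Proof. by case: t => a b; rewrite -negb_and. Qed.

Lemma branchE t : branch t = (t.1 ^+ 3 - t.2 ^+ 3 == 0).
Proof. by rewrite subr_eq0. Qed.

Lemma branch_neq0 t : t != 0 -> branch t -> (t.1 != 0) && (t.2 != 0).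
Proof.
move=> + /eqP /(congr1 (eq_op^~ 0)); rewrite !expf_eq0 pair_neq0 /= => + e.
by rewrite e orbb andbb.
Qed.

Lemma branch_swap t : branch (swap t) = branch t.
Proof. by rewrite /branch eq_sym. Qed.

Lemma swap_neq0 t : (swap t != 0) = (t != 0).
Proof. by rewrite !pair_neq0 orbC. Qed.

Lemma iter_lattes_swap n t : iter n lattes (swap t) = swap (iter n lattes t).
Proof. by elim: n => //= n ->; rewrite /lattes /swap /=; congr pair; ring. Qed.

Lemma proportional_refl t : proportional t t.
Proof. by rewrite /proportional mulrC. Qed.

Lemma proportional_scale c t : proportional (c * t.1, c * t.2) t.
Proof. by rewrite /proportional /= mulrAC. Qed.

Lemma proportionalP t u : u != 0 -> proportional t u -> exists c, t = (c * u.1, c * u.2).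
Proof.
case: t => x y; rewrite pair_neq0 /proportional /= => /orP [u0|u0] /eqP tu.
  by exists (x / u.1); rewrite divfK // mulrAC tu mulfK.
by exists (y / u.2); rewrite divfK // mulrAC -tu mulfK.
Qed.

Lemma lattes_cubes t : (lattes t).1 ^+ 3 - (lattes t).2 ^+ 3 =
  3 * (2 * w + 1) * (t.1 ^+ 3 - t.2 ^+ 3) * (t.1 * t.2) ^+ 3.
Proof. rewrite /lattes /=; ring: sqr_w. Qed.

Lemma lattes_det t u : (lattes t).1 * (lattes u).2 - (lattes t).2 * (lattes u).1 =
  (w - 1) * ((t.1 * u.2) ^+ 3 - (t.2 * u.1) ^+ 3).
Proof. rewrite /lattes /=; ring: sqr_w. Qed.

Lemma proportional_lattes t u :
  proportional (lattes t) (lattes u) = ((t.1 * u.2) ^+ 3 == (t.2 * u.1) ^+ 3).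
Proof.
rewrite /proportional -subr_eq0 lattes_det mulf_eq0 (negPf subr1_cube_root_neq0).
by rewrite subr_eq0.
Qed.

Lemma lattes_eq0 t : (lattes t == 0) = (t == 0).
Proof.
apply/eqP/eqP => [lt0|->]; last by rewrite /lattes /= expr0n mulr0 addr0.
have cube0 x : (w - 1) * x ^+ 3 = 0 -> x = 0.
  by move=> /eqP; rewrite mulf_eq0 (negPf subr1_cube_root_neq0) expf_eq0 => /eqP.
move: lt0 => [e1 e2]; rewrite [t]surjective_pairing; congr pair; apply: cube0.
  rewrite -[RHS](mulr0 (w ^+ 2)) -[RHS]subr0 -{1}e1 -e2; ring: sqr_w.
rewrite -[RHS](mulr0 (w ^+ 2)) -[RHS]subr0 -{1}e2 -e1; ring: sqr_w.
Qed.

Lemma iter_lattes_neq0 n t : t != 0 -> iter n lattes t != 0.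
Proof. by elim: n => //= n ih /ih; rewrite lattes_eq0. Qed.

Lemma sqrt_neg3_neq0 : 2 * w + 1 != 0.
Proof.
apply: contra_neq natr3_neq0 => e; apply/eqP; rewrite -oppr_eq0; apply/eqP.
by rewrite -[RHS](mulr0 (2 * w + 1)) -[in RHS]e; ring: sqr_w.
Qed.

Lemma branch_lattes t : branch (lattes t) = [|| branch t, t.1 == 0 | t.2 == 0].
Proof.
rewrite branchE lattes_cubes !(expf_eq0, mulf_eq0) -branchE (negPf natr3_neq0).
by rewrite (negPf sqrt_neg3_neq0).
Qed.

Lemma branch_iter n t : branch t -> branch (iter n lattes t).
Proof. by move=> bt; elim: n => //= n; rewrite branch_lattes => ->. Qed.

Lemma torsionS n t : t != 0 ->
  torsion n.+1 t = ((t.1 == 0%R) + ((t.2 == 0%R) + torsion n (lattes t)))%N :> nat.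
Proof.
move=> t0; rewrite /torsion iterSr; have := branch_lattes t.
have [bt|bt] := boolP (branch t).
  by have /andP [/negPf -> /negPf ->] := branch_neq0 t0 bt; move=> /= ->.
move: t0; rewrite pair_neq0.
by case: (t.1 == 0); case: (t.2 == 0) => //= _ bl; rewrite bl // (branch_iter _ bl).
Qed.

Lemma collinear_rot t1 t2 t3 : collinear t1 t2 t3 -> collinear t2 t3 t1.
Proof. by rewrite /collinear => e; rewrite [RHS]mulrC mulrA -e; congr (_ ^+ 3); ring. Qed.

Lemma collinear_lattes t1 t2 t3 : collinear t1 t2 t3 ->
  collinear (lattes t1) (lattes t2) (lattes t3).
Proof.
rewrite /collinear !lattes_cubes.
set D := t1.1 * t2.1 * t3.1 - _; set E := (t1.1 ^+ 3 - _) * _ * _ => col.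
pose p := t1.1 * t2.1 * t3.1; pose q := t1.2 * t2.2 * t3.2.
have -> : (lattes t1).1 * (lattes t2).1 * (lattes t3).1 -
    (lattes t1).2 * (lattes t2).2 * (lattes t3).2 =
      (2 * w + 1) * (3 * p * q * D - (E - D ^+ 3)).
  by rewrite /lattes /E /D /p /q /=; ring: sqr_w.
rewrite col subrr subr0 !exprMn col /E /p /q; ring.
Qed.

Lemma branch_collinear t1 t2 t3 : t1 != 0 -> t2 != 0 -> collinear t1 t2 t3 ->
  branch t1 -> branch t2 -> branch t3.
Proof.
move=> t10 t20 + b1 b2; have /andP [t11 _] := branch_neq0 t10 b1.
have /andP [t21 _] := branch_neq0 t20 b2; move: b1 b2.
rewrite /collinear /branch => /eqP c1 /eqP c2; rewrite c1 subrr !mul0r => /eqP.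
rewrite expf_eq0 subr_eq0 => /eqP /(congr1 (fun x => x ^+ 3)).
by rewrite !exprMn -c1 -c2 => /mulfI -> //; rewrite mulf_neq0 ?expf_neq0.
Qed.

Lemma branch_iter_collinear n t1 t2 t3 : t1 != 0 -> t2 != 0 -> collinear t1 t2 t3 ->
  branch (iter n lattes t1) -> branch (iter n lattes t2) -> branch (iter n lattes t3).
Proof.
move=> t10 t20 col; apply: branch_collinear; rewrite ?iter_lattes_neq0 //.
by elim: n => //= n; apply: collinear_lattes.
Qed.

Definition lattes_preimage t : K * K :=
  (3.-root ((w ^+ 2 * t.1 - t.2) / (w - 1)), 3.-root ((w ^+ 2 * t.2 - t.1) / (w - 1))).

Lemma lattes_preimageK : cancel lattes_preimage lattes.
Proof.
move=> t; rewrite /lattes !rootCK // [RHS]surjective_pairing.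
have nz := subr1_cube_root_neq0.
by congr pair; apply: (mulIf nz);
  rewrite mulrDl ?mulrA ?divfK // -?mulrA ?divfK //; ring: sqr_w.
Qed.

Lemma lattes_preimage_neq0 t : ~~ branch t ->
  (lattes_preimage t).1 != 0 /\ (lattes_preimage t).2 != 0.
Proof.
have cubes x y : w ^+ 2 * x - y = 0 -> x ^+ 3 = y ^+ 3.
  by move/eqP; rewrite subr_eq0 => /eqP <-; rewrite exprMn cube_root_exp3 mul1r.
move=> nb; rewrite !rootC_eq0 // !mulf_eq0 !invr_eq0 (negPf subr1_cube_root_neq0) !orbF.
by split; apply: contraNneq nb => /cubes; rewrite /branch => ->.
Qed.

Definition lattes_fiber t : seq (K * K) :=
  [seq (w ^+ j * (lattes_preimage t).1, (lattes_preimage t).2) | j <- iota 0 3].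
Arguments lattes_fiber : simpl never.

Fixpoint torsion_params n : seq (K * K) :=
  if n is n'.+1 then
    (0, 1) :: (1, 0) :: flatten [seq lattes_fiber t | t <- torsion_params n']
  else [::].

Lemma size_torsion_params n : size (torsion_params n) = (3 ^ n).-1.
Proof.
elim: n => //= n ih; rewrite size_flatten /shape -map_comp.
have -> : map (size \o lattes_fiber) (torsion_params n) =
  nseq (size (torsion_params n)) 3%N.
  by elim: torsion_params => //= t T ->.
rewrite sumn_nseq ih expnS; have : (0 < 3 ^ n)%N by rewrite expn_gt0.
lia.
Qed.

Lemma torsion_params_nonbranch n : {in torsion_params n, forall t, ~~ branch t}.
Proof.
elim: n => //= n ih t; rewrite !inE => /or3P
  [/eqP ->|/eqP ->|/flatten_mapP [u uT /mapP [j _ ->]]].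
- by rewrite /branch /= expr0n expr1n eq_sym oner_eq0.
- by rewrite /branch /= expr0n expr1n oner_eq0.
- rewrite /branch /= exprMn cube_root_exp3 mul1r -/(branch (lattes_preimage u)).
  by apply: contra (ih _ uT) => b; rewrite -[u]lattes_preimageK branch_lattes b.
Qed.

Lemma count_lattes_fiber t u : t != 0 -> ~~ branch u ->
  count (proportional t) (lattes_fiber u) = proportional (lattes t) u.
Proof.
move=> t0 /lattes_preimage_neq0; rewrite /lattes_fiber.
rewrite -[X in proportional (lattes t) X]lattes_preimageK.
move=> [u1 u2]; rewrite count_map proportional_lattes -count_cube_roots.
  by apply: eq_count => j; rewrite /proportional /= mulrCA.
by rewrite !mulf_eq0 !negb_or u1 u2 !andbT -pair_neq0.
Qed.

Lemma count_torsion_params n t :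
  t != 0 -> count (proportional t) (torsion_params n) = torsion n t.
Proof.
elim: n t => [|n ih] t t0; first by rewrite /torsion /= andNb.
rewrite torsionS // -ih ?lattes_eq0 //= /proportional /= !mulr1 !mulr0 [0 == _]eq_sym.
congr (_ + (_ + _))%N; rewrite count_flatten -map_comp -sumn_count; congr sumn.
by apply/eq_in_map => u uT; apply: count_lattes_fiber (torsion_params_nonbranch uT).
Qed.

End CubeRoots.

(** * Four pencils of cubics *)

Section Pencils.
Variables (K : numClosedFieldType) (w : K).
Hypothesis sqr_w : w ^+ 2 = - w - 1.
Implicit Types (t : K * K) (x y z c e : K) (u v : 'rV[K]_3) (p : proj_point K).

Definition cyclic_form x y z := x ^+ 2 * y + y ^+ 2 * z + z ^+ 2 * x.
Definition anticyclic_form x y z := x ^+ 2 * z + y ^+ 2 * x + z ^+ 2 * y.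
Definition cubes_disc x y z := (x ^+ 3 - y ^+ 3) * (y ^+ 3 - z ^+ 3) * (z ^+ 3 - x ^+ 3).

Definition hesse e x y z : K * K :=
  (anticyclic_form (e * x) y z, cyclic_form (e * x) y z).
Definition fermat x y z : K * K :=
  (x ^+ 3 + w * y ^+ 3 + w ^+ 2 * z ^+ 3, x ^+ 3 + w ^+ 2 * y ^+ 3 + w * z ^+ 3).

(* The member with parameter [t] of the [k]-th pencil passes through [v] when
   [pencil k v] is proportional to [t]; [v] is a base point when
   [pencil k v = 0]. *)
Definition pencil k v :=
  if k == 3%N then fermat (v 0 0) (v 0 1) (v 0 2)
  else hesse (w ^+ k) (v 0 0) (v 0 1) (v 0 2).

Lemma cyclic_form_cubes x y z : y * cyclic_form x y z - x * anticyclic_form x y z =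
  z * (y ^+ 3 - x ^+ 3).
Proof. rewrite /cyclic_form /anticyclic_form; ring. Qed.

Lemma cyclic_form_rot x y z : cyclic_form y z x = cyclic_form x y z.
Proof. rewrite /cyclic_form; ring. Qed.

Lemma anticyclic_form_rot x y z : anticyclic_form y z x = anticyclic_form x y z.
Proof. rewrite /anticyclic_form; ring. Qed.

Lemma cyclic_disc x y z :
  anticyclic_form x y z ^+ 3 - cyclic_form x y z ^+ 3 = cubes_disc x y z.
Proof. rewrite /cyclic_form /anticyclic_form /cubes_disc; ring. Qed.

Lemma hesse_cubes e x y z : e ^+ 3 = 1 ->
  (hesse e x y z).1 ^+ 3 - (hesse e x y z).2 ^+ 3 = cubes_disc x y z.
Proof. by move=> e3; rewrite cyclic_disc /cubes_disc exprMn e3 mul1r. Qed.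

Lemma fermat_cubes x y z :
  (fermat x y z).1 ^+ 3 - (fermat x y z).2 ^+ 3 = (2 * w + 1) ^+ 3 * cubes_disc x y z.
Proof. rewrite /cubes_disc /=; ring: sqr_w. Qed.

Lemma branch_pencil k v : branch (pencil k v) = (cubes_disc (v 0 0) (v 0 1) (v 0 2) == 0).
Proof.
rewrite branchE /pencil; case: ifP => _;
  last by rewrite hesse_cubes ?(cube_root_exp3 sqr_w).
by rewrite fermat_cubes mulf_eq0 expf_eq0 (negPf (sqrt_neg3_neq0 sqr_w)).
Qed.

Lemma branch_pencil_base k l v : pencil k v = 0 -> branch (pencil l v).
Proof. by move=> pk; rewrite branch_pencil -(branch_pencil k) pk /branch. Qed.

Lemma hesse_collinear x y z :
  collinear (hesse 1 x y z) (hesse w x y z) (hesse (w ^+ 2) x y z).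
Proof.
rewrite /collinear !hesse_cubes ?expr1n ?(cube_root_exp3 sqr_w) //; last first.
  by rewrite -[w]expr1 (cube_root_exp3 sqr_w).
rewrite (_ : _ - _ = cubes_disc x y z); first by ring.
rewrite /= /cyclic_form /anticyclic_form /cubes_disc; ring: sqr_w.
Qed.

Lemma hesse_fermat_collinear e x y z : e ^+ 3 = 1 ->
  collinear (swap (hesse e x y z)) (hesse (w * e) x y z) (fermat x y z).
Proof.
move=> e3; have disc_e : cubes_disc (e * x) y z = cubes_disc x y z.
  by rewrite /cubes_disc exprMn e3 mul1r.
have fermat_e : fermat (e * x) y z = fermat x y z by rewrite /fermat exprMn e3 mul1r.
rewrite -fermat_e /collinear fermat_cubes disc_e hesse_cubes; last first.
  by rewrite exprMn e3 -[w]expr1 (cube_root_exp3 sqr_w) mulr1.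
rewrite -[_.1 ^+ 3 - _]opprB hesse_cubes //.
rewrite (_ : _ - _ = - (2 * w + 1) * cubes_disc (e * x) y z).
  by rewrite disc_e; ring.
rewrite /hesse -[w * e * x]mulrA; move: (e * x) => x'.
by rewrite /= /cyclic_form /anticyclic_form /cubes_disc; ring: sqr_w.
Qed.

Definition two_imply_third (a b c : bool) :=
  [&& a && b ==> c, b && c ==> a & c && a ==> b].

Lemma collinear_two_imply_third n t1 t2 t3 :
  t1 != 0 -> t2 != 0 -> t3 != 0 -> collinear t1 t2 t3 ->
  two_imply_third (branch (iter n (lattes w) t1)) (branch (iter n (lattes w) t2))
    (branch (iter n (lattes w) t3)).
Proof.
move=> t10 t20 t30 col123; have col231 := collinear_rot col123.
have col312 := collinear_rot col231.
by apply/and3P; split; apply/implyP => /andP [];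
  [apply: (branch_iter_collinear sqr_w t10 t20) |
    apply: (branch_iter_collinear sqr_w t20 t30)
  | apply: (branch_iter_collinear sqr_w t30 t10)].
Qed.

Lemma pencil_two_imply_four n v : (forall k, (k < 4)%N -> pencil k v != 0) ->
  let C k := branch (iter n (lattes w) (pencil k v)) in
  (1 < count C (iota 0 4))%N -> all C (iota 0 4).
Proof.
move=> nz.
have [nz0 nz1 nz2 nz3] := And4 (nz 0%N isT) (nz 1%N isT) (nz 2%N isT) (nz 3%N isT).
move=> C; have C012 : two_imply_third (C 0%N) (C 1%N) (C 2%N).
  by apply: collinear_two_imply_third nz0 nz1 nz2 _; apply: hesse_collinear.
have hesse_fermat i j : (i < 3)%N -> (j < 3)%N -> w ^+ j = w * w ^+ i ->
    pencil i v != 0 -> pencil j v != 0 -> two_imply_third (C i) (C j) (C 3%N).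
  move=> i3 j3 wj i0 j0; rewrite /C -branch_swap -iter_lattes_swap.
  apply: collinear_two_imply_third; rewrite ?swap_neq0 //.
  rewrite /pencil (ltn_eqF i3) (ltn_eqF j3) wj.
  apply/hesse_fermat_collinear/(cube_root_exp3 sqr_w).
have C013 := hesse_fermat 0%N 1%N isT isT (exprS w 0) nz0 nz1.
have C123 := hesse_fermat 1%N 2%N isT isT (exprS w 1) nz1 nz2.
have C203 : two_imply_third (C 2%N) (C 0%N) (C 3%N).
  by apply: hesse_fermat; rewrite // -exprS (prim_expr_order (prim_cube_root sqr_w)).
move: C012 C013 C123 C203; rewrite /two_imply_third /=.
by case: (C 0%N); case: (C 1%N); case: (C 2%N); case: (C 3%N).
Qed.

Lemma pencil_scale k c v :
  pencil k (c *: v) = (c ^+ 3 * (pencil k v).1, c ^+ 3 * (pencil k v).2).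
Proof.
rewrite /pencil !mxE; case: ifP => _;
  rewrite /fermat /hesse /cyclic_form /anticyclic_form; congr pair => /=; ring.
Qed.

Lemma pencil_scale_eq0 k c v : c != 0 -> (pencil k (c *: v) == 0) = (pencil k v == 0).
Proof.
move=> c0; rewrite pencil_scale; case: (pencil k v) => a b /=.
by rewrite !xpair_eqE !(expf_eq0, mulf_eq0) (negPf c0).
Qed.

(** * Base points of the pencils *)

Lemma fermat_eq0 x y z : (fermat x y z == 0) = (x ^+ 3 == y ^+ 3) && (y ^+ 3 == z ^+ 3).
Proof.
apply/eqP/andP => [[e1 e2]|[/eqP xy /eqP yz]]; last first.
  by rewrite /fermat xy yz; congr pair; ring: sqr_w.
have yz : y ^+ 3 = z ^+ 3.
  have : (w ^+ 1 * (w - 1)) * (y ^+ 3 - z ^+ 3) = 0.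
    by transitivity ((fermat x y z).2 - (fermat x y z).1);
      [rewrite /=; ring | rewrite /= e1 e2 subrr].
  move/eqP; rewrite !mulf_eq0 (negPf (cube_root_exp_neq0 sqr_w 1)).
  rewrite (negPf (subr1_cube_root_neq0 sqr_w)).
  by rewrite subr_eq0 => /eqP.
rewrite yz eqxx; split=> //; rewrite -subr_eq0 -e1 yz; apply/eqP; ring: sqr_w.
Qed.

Lemma hesse_eq0 e x y z : e ^+ 3 = 1 -> hesse e x y z = 0 ->
  [\/ x ^+ 3 = y ^+ 3 /\ y ^+ 3 = z ^+ 3, x = 0 /\ y = 0, y = 0 /\ z = 0 |
    x = 0 /\ z = 0].
Proof.
move=> e3 [V0 U0]; have e0 : e != 0.
  by apply: contra_eq_neq e3 => ->; rewrite expr0n eq_sym oner_eq0.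
have := cyclic_form_cubes (e * x) y z; have := cyclic_form_cubes y z (e * x).
rewrite cyclic_form_rot anticyclic_form_rot U0 V0 !mulr0 subrr exprMn e3 mul1r.
have ex0 : (e * x == 0) = (x == 0) by rewrite mulf_eq0 (negPf e0).
move=> /esym/eqP; rewrite mulf_eq0 subr_eq0 ex0 => yz /esym/eqP.
rewrite mulf_eq0 subr_eq0 => xy; move/eqP: V0; rewrite /anticyclic_form.
have [x0|xn] /= := eqVneq x 0.
  rewrite x0 mulr0 expr0n mul0r mulr0 !add0r mulf_eq0 expf_eq0 => /orP [] /eqP ->;
    first exact: Or44.
  exact: Or42.
have [y0|yn] := eqVneq y 0.
  rewrite y0 expr0n mul0r mulr0 !addr0 !(expf_eq0, mulf_eq0).
  rewrite (negPf e0) (negPf xn) => /eqP ->.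
  exact: Or43.
have [z0|zn] := eqVneq z 0.
  rewrite z0 expr0n mul0r mulr0 addr0 add0r !(expf_eq0, mulf_eq0).
  by rewrite (negPf e0) (negPf xn) (negPf yn).
move: xy yz; rewrite (negPf zn) (negPf xn) /= => /eqP yx /eqP zy _.
by apply: Or41; rewrite yx zy.
Qed.

Lemma equal_cubes_span v : v != 0 -> v 0 0 ^+ 3 = v 0 1 ^+ 3 -> v 0 1 ^+ 3 = v 0 2 ^+ 3 ->
  exists i j : 'I_3, v = v 0 0 *: row3 1 (w ^+ i) (w ^+ j) /\ v 0 0 != 0.
Proof.
move=> v0 xy yz; have [i i3 yE] := cube_rootsP sqr_w (esym xy).
have [j j3 zE] := cube_rootsP sqr_w (etrans (esym yz) (esym xy)).
have vE : v = v 0 0 *: row3 1 (w ^+ i) (w ^+ j).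
  by rewrite -{1}[v]row3K scale_row3 mulr1 yE zE ![v 0 0 * _]mulrC.
exists (Ordinal i3), (Ordinal j3); split=> //.
by apply: contraNneq v0 => x0; rewrite vE x0 scale0r.
Qed.

Definition base_vecs : seq 'rV[K]_3 :=
  [:: row3 1 0 0; row3 0 1 0; row3 0 0 1] ++
  [seq row3 1 (w ^+ i) (w ^+ j) | i <- iota 0 3, j <- iota 0 3].

Lemma size_base_vecs : size base_vecs = 12%N.
Proof. by rewrite size_cat size_allpairs. Qed.

Lemma base_vecsP v : reflect ([\/ v = row3 1 0 0, v = row3 0 1 0, v = row3 0 0 1 |
    exists i j, [/\ (i < 3)%N, (j < 3)%N & v = row3 1 (w ^+ i) (w ^+ j)]])
      (v \in base_vecs).
Proof.
rewrite mem_cat; apply: (iffP orP) => [[|/allpairsP [[i j] [+ + ->]]]|].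
- by rewrite !inE => /or3P [] /eqP ->; [apply: Or41 | apply: Or42 | apply: Or43].
- by rewrite !mem_iota => i3 j3; apply: Or44; exists i, j.
case=> [->|->|->|[i [j [i3 j3 ->]]]]; try by left; rewrite !inE eqxx ?orbT.
by right; apply/allpairsP; exists (i, j); rewrite !mem_iota.
Qed.

Lemma base_vec_span k v : v != 0 -> pencil k v = 0 ->
  exists2 u, u \in base_vecs & exists2 c, c != 0 & v = c *: u.
Proof.
move=> v0 pv; set x := v 0 0; set y := v 0 1; set z := v 0 2.
have vE : v = row3 x y z by rewrite row3K.
have : [\/ x ^+ 3 = y ^+ 3 /\ y ^+ 3 = z ^+ 3, x = 0 /\ y = 0, y = 0 /\ z = 0 |
    x = 0 /\ z = 0].
  move: pv; rewrite /pencil; case: ifP => _ => [/eqP|];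
    last exact/hesse_eq0/(cube_root_exp3 sqr_w).
  by rewrite fermat_eq0 => /andP [/eqP xy /eqP yz]; apply: Or41.
move: (v0); rewrite {1}vE row3_eq0 => nz.
case=> [[xy yz]|[x0 y0]|[y0 z0]|[x0 z0]].
- have [i [j [vij x0]]] := equal_cubes_span v0 xy yz.
  by exists (row3 1 (w ^+ i) (w ^+ j));
    [apply/base_vecsP; apply: Or44; exists i, j | exists x].
- exists (row3 0 0 1); [by apply/base_vecsP; apply: Or43 | exists z].
    by move: nz; rewrite x0 y0 !eqxx.
  by rewrite vE scale_row3 x0 y0 !mulr0 mulr1.
- exists (row3 1 0 0); [by apply/base_vecsP; apply: Or41 | exists x].
    by move: nz; rewrite y0 z0 !eqxx !andbT.
  by rewrite vE scale_row3 y0 z0 !mulr0 mulr1.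
- exists (row3 0 1 0); [by apply/base_vecsP; apply: Or42 | exists y].
    by move: nz; rewrite x0 z0 !eqxx andbT.
  by rewrite vE scale_row3 x0 z0 !mulr0 mulr1.
Qed.

Lemma hesse_cube_roots_eq0 k i j : (k < 3)%N -> (i < 3)%N -> (j < 3)%N ->
  (hesse (w ^+ k) 1 (w ^+ i) (w ^+ j) == 0) = ((i + j + k) %% 3 != 0)%N.
Proof.
move=> k3 i3 j3; have [c|c] := boolP ((i + j + k) %% 3 != 0)%N.
  apply/eqP; move: c; case: k i j k3 i3 j3 => [|[|[|//]]] [|[|[|//]]] [|[|[|//]]] //=
    _ _ _ _;
  by rewrite /hesse /cyclic_form /anticyclic_form; congr pair; ring: sqr_w.
suff cyclicE : cyclic_form (w ^+ k * 1) (w ^+ i) (w ^+ j) =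
  3 * (w ^+ k * (w ^+ k * w ^+ i)).
  apply/negbTE/eqP => -[_ /eqP]; apply/negP.
  by rewrite cyclicE !mulf_neq0 ?natr3_neq0 ?(cube_root_exp_neq0 sqr_w).
move: c; case: k i j k3 i3 j3 => [|[|[|//]]] [|[|[|//]]] [|[|[|//]]] //= _ _ _ _;
by rewrite /cyclic_form; ring: sqr_w.
Qed.

Lemma count_pencil_base_vec v : v \in base_vecs ->
  count (fun k => pencil k v == 0) (iota 0 4) = 3%N.
Proof.
have pencilE k x y z : pencil k (row3 x y z) =
    if k == 3%N then fermat x y z else hesse (w ^+ k) x y z by rewrite /pencil !row3E.
have axis e x y z : anticyclic_form (e * x) y z = 0 -> cyclic_form (e * x) y z = 0 ->
    (hesse e x y z == 0) = true by rewrite /hesse => -> ->; apply/eqP.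
case/base_vecsP => [->|->|->|[i [j [i3 j3 ->]]]]; rewrite [LHS]/= !pencilE /= fermat_eq0;
  last first.
  rewrite !(hesse_cube_roots_eq0, cube_root_exp3 sqr_w, expr1n, eqxx) //.
  by case: i j i3 j3 => [|[|[|//]]] [|[|[|//]]].
all: rewrite !axis ?expr0n ?expr1n /= ?oner_eq0 1?[0 == 1]eq_sym ?oner_eq0 ?andbF //.
all: by rewrite /cyclic_form /anticyclic_form; ring.
Qed.

Definition leading v := if v 0 0 != 0 then v 0 0 else if v 0 1 != 0 then v 0 1 else v 0 2.

Lemma leading_scale c v : leading (c *: v) = c * leading v.
Proof.
rewrite /leading !mxE !mulf_eq0; have [->|c0] := eqVneq c 0; first by rewrite !mul0r.
by case: ifP => // _; case: ifP.
Qed.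

Lemma leading_base_vec v : v \in base_vecs -> leading v = 1.
Proof.
rewrite /leading; case/base_vecsP => [->|->|->|[i [j [_ _ ->]]]];
by rewrite !row3E ?eqxx ?oner_eq0.
Qed.

Lemma base_vec_neq0 v : v \in base_vecs -> v != 0.
Proof.
move=> /leading_base_vec; apply: contra_eq_neq => ->; rewrite -(scale0r (0 : 'rV[K]_3)).
by rewrite leading_scale mul0r eq_sym oner_eq0.
Qed.

Lemma base_vec_scale_eq u v c : u \in base_vecs -> v \in base_vecs -> v = c *: u -> v = u.
Proof.
move=> /leading_base_vec u1 /leading_base_vec + vE.
rewrite vE leading_scale u1 mulr1 => ->.
exact: scale1r.
Qed.

Lemma uniq_base_vecs : uniq base_vecs.
Proof.
rewrite cat_uniq; apply/and3P; split.
- by rewrite /= !inE !row3_eq !eqxx [0 == 1]eq_sym oner_eq0.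
- apply/hasPn => _ /allpairsP [[i j] [_ _ ->]]; rewrite !inE !row3_eq.
  by rewrite !(negPf (cube_root_exp_neq0 sqr_w _)) oner_eq0 !andbF.
- apply: allpairs_uniq; rewrite ?iota_uniq // => -[i j] [i' j'].
  move=> /allpairsP [[a b] [+ + [-> ->]]] /allpairsP [[a' b'] [+ + [-> ->]]] /=.
  rewrite !mem_iota => a3 b3 a'3 b'3 /eqP.
  by rewrite row3_eq eqxx !(cube_root_exp_inj sqr_w) //= => /andP [/eqP -> /eqP ->].
Qed.

Lemma base_points : exists B : seq (proj_point K),
  [/\ uniq B, size B = 12%N,
      forall p, p \in B -> count (fun k => pencil k (pt_vec p) == 0) (iota 0 4) = 3%N &
      forall p k, pencil k (pt_vec p) = 0 -> p \in B].
Proof.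
have /choice [pt ptP] : forall v, exists p, v != 0 -> v \in val p.
  move=> v; have [_|v0] := eqVneq v 0; last by exists (point_of v0); rewrite mem_point_of.
  have n0 : row3 (1 : K) 0 0 != 0 by rewrite row3_eq0 oner_eq0.
  by exists (point_of n0).
have pt_scale v : v \in base_vecs -> exists2 c, c != 0 & v = c *: pt_vec (pt v).
  by move=> /base_vec_neq0 v0; apply: mem_pointP (ptP v v0).
exists [seq pt v | v <- base_vecs]; split.
- rewrite map_inj_in_uniq ?uniq_base_vecs // => u v uB vB pt_eq.
  have [c c0 uE] := pt_scale u uB; have [d d0 vE] := pt_scale v vB.
  apply/esym/(@base_vec_scale_eq _ _ (d / c)) => //.
  by rewrite [in RHS]uE scalerA divfK // pt_eq.
- by rewrite size_map size_base_vecs.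
- move=> p /mapP [v vB ->]; apply: etrans (count_pencil_base_vec vB).
  have [c c0 vE] := pt_scale v vB.
  by apply: eq_count => k; rewrite [in RHS]vE pencil_scale_eq0.
- move=> p k /(base_vec_span (pt_vec_neq0 p)) [u uB [c c0 pE]]; apply/mapP;
    exists u => //.
  have u0 := base_vec_neq0 uB; apply: (point_eq u0); last exact: ptP.
  by rewrite -[u](scalerK c0) -pE memvZ // mem_pt_vec.
Qed.

End Pencils.

(** * Intersections of members of two pencils *)

Lemma parallel_scale (K : fieldType) (n : nat) (u v : 'rV[K]_n) :
  u != 0 -> (forall i j, u 0 i * v 0 j = u 0 j * v 0 i) -> exists c, v = c *: u.
Proof.
move=> /rV0Pn [i ui] uv; exists (v 0 i / u 0 i); apply/rowP => j; rewrite !mxE.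
by apply: (mulfI ui); rewrite uv mulrA [u 0 i * _]mulrC divfK // mulrC.
Qed.

Section CyclicSystem.
Variables (K : numClosedFieldType).
Implicit Types (a b c al be ga : K) (u v : 'rV[K]_3).

(* With [x, y, z] the coordinates of [v], these are the linear equations
   satisfied by a point where [cyclic_form : anticyclic_form = a : b] and
   [y ^ 3 - x ^ 3], [z ^ 3 - y ^ 3], [x ^ 3 - z ^ 3] are proportional to [al],
   [be], [ga]. *)
Definition cyclic_system a b al be ga v :=
  [/\ a * v 0 1 - b * v 0 0 = al * v 0 2, a * v 0 2 - b * v 0 1 = be * v 0 0 &
      a * v 0 0 - b * v 0 2 = ga * v 0 1].

Definition cyclic_values a b al be ga c v :=
  [/\ cyclic_form (v 0 0) (v 0 1) (v 0 2) = a * c,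
      anticyclic_form (v 0 0) (v 0 1) (v 0 2) = b * c,
      v 0 1 ^+ 3 - v 0 0 ^+ 3 = al * c, v 0 2 ^+ 3 - v 0 1 ^+ 3 = be * c &
      v 0 0 ^+ 3 - v 0 2 ^+ 3 = ga * c].

Definition rotate v := row3 (v 0 1) (v 0 2) (v 0 0).

Lemma rotate_eq0 v : (rotate v == 0) = (v == 0).
Proof. by rewrite row3_eq0 -[v in RHS]row3K row3_eq0 andbA andbC. Qed.

Lemma rotate3 v : rotate (rotate (rotate v)) = v.
Proof. by rewrite -[RHS]row3K /rotate !row3E. Qed.

Lemma rotateZ c v : rotate (c *: v) = c *: rotate v.
Proof. by rewrite /rotate scale_row3 !mxE. Qed.

Lemma cyclic_system_rotate a b al be ga v :
  cyclic_system a b be ga al (rotate v) <-> cyclic_system a b al be ga v.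
Proof. by rewrite /cyclic_system !row3E; split=> -[]. Qed.

Lemma cyclic_systemZ a b al be ga c v :
  cyclic_system a b al be ga v -> cyclic_system a b al be ga (c *: v).
Proof.
by move=> [e1 e2 e3]; split; rewrite !mxE ![_ * (c * _)]mulrCA -mulrBr ?e1 ?e2 ?e3.
Qed.

Definition minor a b al be := row3 (a ^+ 2 - b * al) (al * be + a * b) (b ^+ 2 + a * be).

Lemma minor_system a b al be ga : al + be + ga = 0 -> al * be * ga = a ^+ 3 - b ^+ 3 ->
  cyclic_system a b al be ga (minor a b al be).
Proof.
move=> sum0 prod; have gaE : ga = - al - be.
  by apply: (addrI (al + be)); rewrite sum0; ring.
have a3 : a ^+ 3 = b ^+ 3 + al * be * (- al - be) by rewrite -gaE prod addrC subrK.
by split; rewrite !row3E ?gaE; ring: a3.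
Qed.

Lemma system_minor a b al be ga v :
  cyclic_system a b al be ga v -> minor a b al be != 0 ->
  exists c, v = c *: minor a b al be.
Proof.
move=> [e1 e2 _] m0; apply: (parallel_scale m0).
by move/esym in e1; move/esym in e2; apply: ord3_ind; apply: ord3_ind; rewrite !row3E;
  ring: e1 e2.
Qed.

Section Rank.
Variables a b al be ga : K.
Hypotheses (sum0 : al + be + ga = 0) (ab0 : (a != 0) || (b != 0)).

Lemma minors_neq0 :
  [|| minor a b al be != 0, minor a b be ga != 0 | minor a b ga al != 0].
Proof.
apply: contraTT ab0; rewrite !negb_or !negbK !row3_eq0.
move=> /and3P [/and3P [/eqP e1 _ /eqP f1] /and3P [/eqP e2 _ _] /and3P [/eqP e3 _ _]].
have a0 : a = 0.
  have /eqP : 3 * a ^+ 2 = 0.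
    transitivity ((a ^+ 2 - b * al) + (a ^+ 2 - b * be) + (a ^+ 2 - b * ga)
                  + b * (al + be + ga)); first by ring.
    by rewrite e1 e2 e3 sum0 mulr0 !addr0.
  by rewrite mulf_eq0 (negPf (natr3_neq0 K)) expf_eq0 => /eqP.
by move/eqP: f1; rewrite a0 mul0r addr0 eqxx expf_eq0.
Qed.

Lemma cyclic_system_exists : al * be * ga = a ^+ 3 - b ^+ 3 ->
  exists2 v, v != 0 & cyclic_system a b al be ga v.
Proof.
move=> prod; case/or3P: minors_neq0 => m0.
- by exists (minor a b al be); rewrite //; apply: minor_system.
- exists (rotate (rotate (minor a b be ga))); rewrite ?rotate_eq0 //.
  apply: (cyclic_system_rotate _ _ _ _ _ _).1; rewrite rotate3; apply: minor_system.
    by rewrite -[RHS]sum0 addrC addrA.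
  by rewrite -prod mulrC mulrA.
- exists (rotate (minor a b ga al)); rewrite ?rotate_eq0 //.
  do 2!apply: (cyclic_system_rotate _ _ _ _ _ _).1.
  rewrite rotate3; apply: minor_system.
    by rewrite -[RHS]sum0 -addrA addrC.
  by rewrite -prod -mulrA mulrC.
Qed.

Lemma cyclic_system_unique u v : u != 0 ->
  cyclic_system a b al be ga u -> cyclic_system a b al be ga v -> exists c, v = c *: u.
Proof.
have multiples m x y : x != 0 -> (exists c, x = c *: m) -> (exists c, y = c *: m) ->
    exists c, y = c *: x :> 'rV[K]_3.
  move=> x0 [c xE] [d ->]; exists (d / c); rewrite xE scalerA divfK //.
  by apply: contraNneq x0 => c0; rewrite xE c0 scale0r.
have unrotate x y : (exists c, rotate y = c *: rotate x) -> exists c, y = c *: x.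
  by case=> c yE; exists c; rewrite -[y]rotate3 yE !rotateZ rotate3.
have rot1 x := (cyclic_system_rotate a b al be ga x).2.
have rot2 x := (cyclic_system_rotate a b be ga al x).2.
move=> u0 su sv; case/or3P: minors_neq0 => m0.
- exact: multiples u0 (system_minor su m0) (system_minor sv m0).
- apply: unrotate.
  apply: multiples (system_minor (rot1 _ su) m0) (system_minor (rot1 _ sv) m0).
  by rewrite rotate_eq0.
- apply/unrotate/unrotate; move/rot1/rot2: su => su; move/rot1/rot2: sv => sv.
  by apply: multiples (system_minor su m0) (system_minor sv m0); rewrite !rotate_eq0.
Qed.

End Rank.

Lemma cyclic_system_neq0 a b al be ga v : (a != 0) || (b != 0) -> v != 0 ->
  cyclic_system a b al be ga v -> (v 0 0 != 0) || (v 0 1 != 0).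
Proof.
move=> ab0 + [_ e2 e3]; rewrite row3_neq0; apply: contraTT; rewrite !negb_or !negbK.
move=> /andP [/eqP x0 /eqP y0]; move: e2 e3.
rewrite x0 y0 eqxx !mulr0 subr0 sub0r => /eqP.
rewrite mulf_eq0 => + /eqP; rewrite oppr_eq0 mulf_eq0.
by case/orP: ab0 => /negPf -> //= /eqP ->.
Qed.

Lemma two_neq0_three_eq0 x y z p q r : (x != 0) || (y != 0) -> (y != 0) || (z != 0) ->
  (z != 0) || (x != 0) -> z * p = 0 -> x * q = 0 -> y * r = 0 -> p + q + r = 0 :> K ->
  [/\ p = 0, q = 0 & r = 0].
Proof.
move=> xy yz zx zp xq yr sum; have cancel s t : s != 0 -> s * t = 0 -> t = 0 :> K.
  by move=> s0 /eqP; rewrite mulf_eq0 (negPf s0) => /eqP.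
have [x0|x0] := eqVneq x 0.
  rewrite x0 eqxx ?orbF in xy zx.
  have p0 := cancel _ _ zx zp; have r0 := cancel _ _ xy yr.
  by move: sum; rewrite p0 r0 add0r addr0.
have q0 := cancel _ _ x0 xq; have [z0|z0] := eqVneq z 0.
  rewrite z0 eqxx orbF in yz; have r0 := cancel _ _ yz yr.
  by move: sum; rewrite q0 r0 !addr0.
have p0 := cancel _ _ z0 zp.
by move: sum; rewrite p0 q0 !add0r.
Qed.

Lemma cyclic_system_values a b al be ga v : al + be + ga = 0 -> (a != 0) || (b != 0) ->
  v != 0 -> cyclic_system a b al be ga v -> exists c, cyclic_values a b al be ga c v.
Proof.
move=> sum0 ab0 v0 sv; have xy := cyclic_system_neq0 ab0 v0 sv.
have [yz zx] : (v 0 1 != 0) || (v 0 2 != 0) /\ (v 0 2 != 0) || (v 0 0 != 0).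
  have sv1 := (cyclic_system_rotate _ _ _ _ _ _).2 sv.
  have sv2 := (cyclic_system_rotate _ _ _ _ _ _).2 sv1.
  have := cyclic_system_neq0 ab0 _ sv1; have := cyclic_system_neq0 ab0 _ sv2.
  by rewrite !rotate_eq0 !row3E => /(_ v0) ? /(_ v0) ?; split.
have [e1 e2 e3] := sv; move: e1 e2 e3 xy yz zx; rewrite /cyclic_values.
move: (v 0 0) (v 0 1) (v 0 2) => x y z e1 e2 e3 xy yz zx.
have forms : a * anticyclic_form x y z = b * cyclic_form x y z.
  apply/eqP; rewrite -subr_eq0; apply/eqP.
  transitivity ((a * y - b * x) * (x * y) + (a * z - b * y) * (y * z) +
    (a * x - b * z) * (z * x)).
    by rewrite /cyclic_form /anticyclic_form; ring.
  rewrite e1 e2 e3; transitivity (x * y * z * (al + be + ga)).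
    by ring.
  by rewrite sum0 mulr0.
have [c [cU cV]] : exists c, cyclic_form x y z = a * c /\ anticyclic_form x y z = b * c.
  case/orP: ab0 => h0.
    exists (cyclic_form x y z / a); split; first by rewrite mulrC divfK.
    by rewrite mulrA -forms mulrAC divff // mul1r.
  exists (anticyclic_form x y z / b); split; last by rewrite mulrC divfK.
  by rewrite mulrA forms mulrAC divff // mul1r.
have relation r s t m k : a * s - b * r = m * t ->
    s * cyclic_form x y z - r * anticyclic_form x y z = t * k -> t * (k - m * c) = 0.
  move=> e; rewrite cU cV mulrBr => <-.
  by transitivity ((a * s - b * r - m * t) * c); [ring | rewrite e subrr mul0r].
have xyz := cyclic_form_cubes x y z; have yzx := cyclic_form_cubes y z x.
have zxy := cyclic_form_cubes z x y.
rewrite cyclic_form_rot anticyclic_form_rot in yzx.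
rewrite -cyclic_form_rot -anticyclic_form_rot in zxy.
have := two_neq0_three_eq0 xy yz zx (relation _ _ _ _ _ e1 xyz)
  (relation _ _ _ _ _ e2 yzx)
  (relation _ _ _ _ _ e3 zxy).
case=> [|/subr0_eq -> /subr0_eq -> /subr0_eq ->]; last by exists c.
by transitivity (- c * (al + be + ga)); [ring | rewrite sum0 mulr0].
Qed.

Lemma cyclic_values_system a b al be ga c v :
  c != 0 -> cyclic_values a b al be ga c v -> cyclic_system a b al be ga v.
Proof.
rewrite /cyclic_values /cyclic_system.
move: (v 0 0) (v 0 1) (v 0 2) => x y z c0 [cU cV e1 e2 e3].
have relation r s t m k : k = m * c ->
    s * cyclic_form x y z - r * anticyclic_form x y z = t * k -> a * s - b * r = m * t.
  move=> ->; rewrite cU cV => e; apply: (mulfI c0).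
  transitivity (s * (a * c) - r * (b * c)); first by ring.
  by rewrite e; ring.
split; [apply: relation e1 _ | apply: relation e2 _ | apply: relation e3 _].
- exact: cyclic_form_cubes.
- by rewrite -cyclic_form_cubes [in RHS]cyclic_form_rot [in RHS]anticyclic_form_rot.
- by rewrite -cyclic_form_cubes -[in RHS]cyclic_form_rot -[in RHS]anticyclic_form_rot.
Qed.

End CyclicSystem.

Section Meeting.
Variables (K : numClosedFieldType) (w : K).
Hypothesis sqr_w : w ^+ 2 = - w - 1.
Implicit Types (t : K * K) (s : K) (v : 'rV[K]_3) (p : proj_point K).
Local Notation pencil := (pencil w).

(* Proportional to [y ^ 3 - x ^ 3], [z ^ 3 - y ^ 3], [x ^ 3 - z ^ 3] when
   [t = fermat x y z]. *)
Definition diff_yx t := w * t.1 - w ^+ 2 * t.2.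
Definition diff_zy t := t.1 - t.2.
Definition diff_xz t := w ^+ 2 * t.1 - w * t.2.

Lemma sum_diff t s : s * diff_yx t + s * diff_zy t + s * diff_xz t = 0.
Proof. rewrite /diff_yx /diff_zy /diff_xz; ring: sqr_w. Qed.

Lemma prod_diff t : diff_yx t * diff_zy t * diff_xz t = t.1 ^+ 3 - t.2 ^+ 3.
Proof. rewrite /diff_yx /diff_zy /diff_xz; ring: sqr_w. Qed.

Let conj_neq0 : w ^+ 2 - w != 0.
Proof.
have -> : w ^+ 2 - w = w ^+ 1 * (w - 1) by ring.
exact: mulf_neq0 (cube_root_exp_neq0 sqr_w 1) (subr1_cube_root_neq0 sqr_w).
Qed.

Lemma diff_proportional t1 t2 : diff_yx t1 * diff_zy t2 = diff_zy t1 * diff_yx t2 ->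
  proportional t1 t2.
Proof.
move=> e; apply/eqP/(mulfI conj_neq0)/subr0_eq.
transitivity (diff_yx t1 * diff_zy t2 - diff_zy t1 * diff_yx t2); last by rewrite e subrr.
by rewrite /diff_yx /diff_zy; ring.
Qed.

Lemma diff_fermat x y z : [/\ diff_yx (fermat w x y z) = (w ^+ 2 - w) * (y ^+ 3 - x ^+ 3),
  diff_zy (fermat w x y z) = (w ^+ 2 - w) * (z ^+ 3 - y ^+ 3) &
  diff_xz (fermat w x y z) = (w ^+ 2 - w) * (x ^+ 3 - z ^+ 3)].
Proof. by split; rewrite /diff_yx /diff_zy /diff_xz /=; ring: sqr_w. Qed.

Lemma diff_neq0 t : ~~ branch t -> [/\ diff_yx t != 0, diff_zy t != 0 & diff_xz t != 0].
Proof. by rewrite branchE -prod_diff !mulf_eq0 !negb_or => /andP [/andP [? ?] ?]. Qed.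

(* The members with parameters [t1] of the pencil 3 and [t2] of the pencil 0
   meet at the points solving the linear systems given by the three scalars. *)
Definition meeting_scalar t1 t2 s :=
  s ^+ 3 * (t1.1 ^+ 3 - t1.2 ^+ 3) = t2.2 ^+ 3 - t2.1 ^+ 3.
Definition meeting_system t1 t2 s v :=
  cyclic_system t2.2 t2.1 (s * diff_yx t1) (s * diff_zy t1) (s * diff_xz t1) v.

Let coord_neq0 t : ~~ branch t -> (t.2 != 0) || (t.1 != 0).
Proof.
by move=> nb; rewrite orbC -pair_neq0; apply: contraNneq nb => ->; rewrite /branch.
Qed.

Lemma meeting_system_exists t1 t2 s : ~~ branch t2 -> meeting_scalar t1 t2 s ->
  exists2 v, v != 0 & meeting_system t1 t2 s v.
Proof.
move=> nb2 ms; apply: cyclic_system_exists; [exact: sum_diff | exact: coord_neq0 |].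
by rewrite -ms -prod_diff; ring.
Qed.

Lemma meeting_system_unique t1 t2 s u v : ~~ branch t2 -> u != 0 ->
  meeting_system t1 t2 s u -> meeting_system t1 t2 s v -> exists c, v = c *: u.
Proof.
by move=> nb2; apply: cyclic_system_unique; [exact: sum_diff | exact: coord_neq0].
Qed.

Lemma meeting_system_pencil t1 t2 s v :
  ~~ branch t2 -> v != 0 -> meeting_system t1 t2 s v ->
  exists c, [/\ pencil 0 v = (c * t2.1, c * t2.2), proportional (pencil 3 v) t1 &
                c = 0 -> v 0 0 ^+ 3 = v 0 1 ^+ 3 /\ v 0 1 ^+ 3 = v 0 2 ^+ 3].
Proof.
move=> nb2 v0 sys; have [c [cU cV e1 e2 e3]] :=
  cyclic_system_values (sum_diff t1 s) (coord_neq0 nb2) v0 sys.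
exists c; split.
- by rewrite /pencil /hesse expr0 mul1r cU cV ![c * _]mulrC.
- apply: diff_proportional; rewrite /pencil /=.
  have [-> -> _] := diff_fermat (v 0 0) (v 0 1) (v 0 2).
  by rewrite e1 e2; ring.
- by move=> c0; move: e1 e2; rewrite c0 !mulr0 => /subr0_eq -> /subr0_eq ->.
Qed.

Lemma pencil_meeting_system t1 t2 v : ~~ branch t1 -> ~~ branch t2 -> pencil 0 v != 0 ->
  proportional (pencil 3 v) t1 -> proportional (pencil 0 v) t2 ->
  exists2 s, meeting_scalar t1 t2 s & meeting_system t1 t2 s v.
Proof.
move=> nb1 nb2 p0.
have nz t : ~~ branch t -> t != 0 by move=> /coord_neq0; rewrite pair_neq0 orbC.
move=> /(proportionalP (nz _ nb1)) [m p3] /(proportionalP (nz _ nb2)) [c p0E].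
have c0 : c != 0 by apply: contraNneq p0 => c0; rewrite p0E c0 !mul0r.
have [s mE] : exists s, m = s * ((w ^+ 2 - w) * c).
  by exists (m / ((w ^+ 2 - w) * c)); rewrite divfK // mulf_neq0.
have [fyx fzy fxz] := diff_fermat (v 0 0) (v 0 1) (v 0 2).
have fE : fermat w (v 0 0) (v 0 1) (v 0 2) = (m * t1.1, m * t1.2) by [].
have [cV cU] : anticyclic_form (v 0 0) (v 0 1) (v 0 2) = t2.1 * c /\
    cyclic_form (v 0 0) (v 0 1) (v 0 2) = t2.2 * c.
  by move: p0E; rewrite /pencil /= /hesse expr0 mul1r => -[-> ->]; rewrite ![c * _]mulrC.
have values : cyclic_values t2.2 t2.1
    (s * diff_yx t1) (s * diff_zy t1) (s * diff_xz t1) c v.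
  split=> //; apply: (mulfI conj_neq0); rewrite -?fyx -?fzy -?fxz fE.
  - by rewrite /diff_yx /= mE; ring.
  - by rewrite /diff_zy /= mE; ring.
  - by rewrite /diff_xz /= mE; ring.
exists s; last exact: cyclic_values_system values.
have [_ _ e1 e2 e3] := values; rewrite /meeting_scalar -prod_diff.
apply: (mulfI (expf_neq0 3 c0)); transitivity (- cubes_disc (v 0 0) (v 0 1) (v 0 2)).
  transitivity ((s * diff_yx t1 * c) * (s * diff_zy t1 * c) * (s * diff_xz t1 * c)).
    by ring.
  by rewrite -e1 -e2 -e3 /cubes_disc; ring.
by rewrite -cyclic_disc cU cV; ring.
Qed.

Lemma meeting_scalar_neq0 t1 t2 s : ~~ branch t2 -> meeting_scalar t1 t2 s -> s != 0.
Proof.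
move=> nb2 ms; apply: contraNneq nb2 => s0; move/esym/eqP: ms; rewrite s0 expr0n mul0r.
by rewrite subr_eq0 eq_sym.
Qed.

Lemma meeting_scalar_inj t1 t2 s s' v : ~~ branch t1 -> v != 0 ->
  meeting_system t1 t2 s v -> meeting_system t1 t2 s' v -> s = s'.
Proof.
move=> /diff_neq0 [yx0 zy0 xz0] + [e1 e2 e3] [e1' e2' e3']; rewrite row3_neq0.
rewrite {}e1 {}e2 {}e3 in e1' e2' e3'.
by case/or3P => nz; [apply/(mulIf zy0)/(mulIf nz)|apply/(mulIf xz0)/(mulIf nz)|
  apply/(mulIf yx0)/(mulIf nz)].
Qed.

Lemma meeting_system_inj t1 t1' t2 s s' v :
  s != 0 -> s' != 0 -> v 0 0 != 0 -> v 0 2 != 0 ->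
  meeting_system t1 t2 s v -> meeting_system t1' t2 s' v -> proportional t1 t1'.
Proof.
move=> s0 s'0 x0 z0 [e1 e2 _] [e1' e2' _]; rewrite {}e1 {}e2 in e1' e2'.
have yx := mulIf z0 e1'; have zy := mulIf x0 e2'.
apply: diff_proportional; apply: (mulfI (mulf_neq0 s0 s'0)).
transitivity ((s * diff_yx t1) * (s' * diff_zy t1')); first by ring.
by rewrite yx -zy; ring.
Qed.

Section QuadruplePoints.
Variable T : seq (K * K).
Hypotheses (T_unique : forall t, t != 0 -> (count (proportional t) T <= 1)%N)
  (T_nonbranch : {in T, forall t, ~~ branch t}).

Let M := size T.
Local Notation triple := (K * K * (K * K) * nat)%type.
Implicit Types i : triple.

Let T_neq0 t : t \in T -> t != 0.
Proof. by move=> /T_nonbranch; apply: contraNneq => ->; rewrite /branch. Qed.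

Let T_inj t t1 t2 :
  t != 0 -> t1 \in T -> t2 \in T -> proportional t t1 -> proportional t t2 ->
  t1 = t2.
Proof.
move=> t0 t1T t2T tt1 tt2; have := T_unique t0; rewrite -size_filter.
have : t1 \in [seq u <- T | proportional t u] by rewrite mem_filter tt1.
have : t2 \in [seq u <- T | proportional t u] by rewrite mem_filter tt2.
by case: (seq.filter _ T) => [|u []] //; rewrite !inE => /eqP -> /eqP ->.
Qed.

Let uniq_T : uniq T.
Proof.
apply: count_mem_uniq => t; case: (boolP (t \in T)) => [tT|/count_memPn -> //].
apply/eqP; rewrite eqn_leq -has_count has_pred1 tT andbT.
apply: leq_trans (T_unique (T_neq0 tT)); apply: sub_count => u /eqP ->.
exact: proportional_refl.
Qed.

Definition root_scalar i : K :=
  w ^+ i.2 * 3.-root ((i.1.2.2 ^+ 3 - i.1.2.1 ^+ 3) / (i.1.1.1 ^+ 3 - i.1.1.2 ^+ 3)).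

Lemma root_scalarP i : ~~ branch i.1.1 -> meeting_scalar i.1.1 i.1.2 (root_scalar i).
Proof.
rewrite branchE => nb; rewrite /meeting_scalar /root_scalar exprMn.
rewrite (cube_root_exp3 sqr_w) mul1r.
by rewrite rootCK // divfK.
Qed.

Lemma meeting_scalar_root t1 t2 s : ~~ branch t1 -> meeting_scalar t1 t2 s ->
  exists2 j, (j < 3)%N & s = root_scalar (t1, t2, j).
Proof.
move=> nb1 ms; pose r := (t2.2 ^+ 3 - t2.1 ^+ 3) / (t1.1 ^+ 3 - t1.2 ^+ 3).
have /(cube_rootsP sqr_w) [j j3 sE] : s ^+ 3 = (3.-root r) ^+ 3.
  by rewrite rootCK // /r -ms mulfK // -branchE.
by exists j.
Qed.

Lemma root_scalar_inj t1 t2 j j' :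
  (j < 3)%N -> (j' < 3)%N -> root_scalar (t1, t2, j) != 0 ->
  root_scalar (t1, t2, j) = root_scalar (t1, t2, j') -> j = j'.
Proof.
move=> j3 j'3; rewrite mulf_eq0 negb_or => /andP [_ r0] /(mulIf r0) /eqP.
by rewrite (cube_root_exp_inj sqr_w) // => /eqP.
Qed.

Definition meeting_triples : seq triple :=
  [seq (q, j) | q <- [seq (t1, t2) | t1 <- T, t2 <- T], j <- iota 0 3].

Lemma mem_meeting_triples i :
  (i \in meeting_triples) = [&& i.1.1 \in T, i.1.2 \in T & (i.2 < 3)%N].
Proof.
apply/allpairsP/and3P => [[[q j] [/allpairsP [[t1 t2] [? ? ->]] + ->]]|[t1T t2T j3]].
  by rewrite mem_iota.
case: i t1T t2T j3 => -[t1 t2] j t1T t2T j3; exists ((t1, t2), j); rewrite mem_iota.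
by split=> //; apply/allpairsP; exists (t1, t2).
Qed.

Lemma uniq_meeting_triples : uniq meeting_triples.
Proof.
by apply: allpairs_uniq; [apply: allpairs_uniq uniq_T uniq_T _ | exact: iota_uniq |];
  move=> [? ?] [? ?].
Qed.

Lemma size_meeting_triples : size meeting_triples = (3 * M ^ 2)%N.
Proof. by rewrite !size_allpairs size_iota mulnC mulnn. Qed.

Lemma exists_meeting_points :
  exists sol : triple -> proj_point K, forall i, i \in meeting_triples ->
  meeting_system i.1.1 i.1.2 (root_scalar i) (pt_vec (sol i)).
Proof.
suff /choice [sol solP] : forall i, exists p, i \in meeting_triples ->
    meeting_system i.1.1 i.1.2 (root_scalar i) (pt_vec p) by exists sol.
move=> i; have n0 : row3 (1 : K) 0 0 != 0 by rewrite row3_eq0 oner_eq0.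
have [|_] := boolP (i \in meeting_triples); last by exists (point_of n0).
rewrite mem_meeting_triples => /and3P [/T_nonbranch nb1 /T_nonbranch nb2 _].
have [v v0 sys] := meeting_system_exists nb2 (root_scalarP nb1).
exists (point_of v0) => _.
have [c c0 vE] := mem_pointP v0 (mem_point_of v0).
by rewrite -[pt_vec _](scalerK c0) -vE; apply: cyclic_systemZ.
Qed.

Section MeetingPoints.
Variable sol : triple -> proj_point K.
Hypothesis solP : forall i, i \in meeting_triples ->
  meeting_system i.1.1 i.1.2 (root_scalar i) (pt_vec (sol i)).
Let good i := pencil 0 (pt_vec (sol i)) != 0.

Lemma meeting_triples_nonbranch i :
  i \in meeting_triples -> ~~ branch i.1.1 /\ ~~ branch i.1.2.
Proof. by rewrite mem_meeting_triples => /and3P [/T_nonbranch ? /T_nonbranch ? _]. Qed.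

Lemma root_scalar_neq0 i : i \in meeting_triples -> root_scalar i != 0.
Proof.
by move=> /meeting_triples_nonbranch [nb1 nb2];
  apply: meeting_scalar_neq0 (root_scalarP nb1).
Qed.

Lemma meeting_triples_eq i i' v :
  i \in meeting_triples -> i' \in meeting_triples -> v != 0 ->
  i.1 = i'.1 -> meeting_system i.1.1 i.1.2 (root_scalar i) v ->
  meeting_system i'.1.1 i'.1.2 (root_scalar i') v -> i = i'.
Proof.
move=> iT i'T v0.
have [nb1 _] := meeting_triples_nonbranch iT; have := root_scalar_neq0 iT.
move: iT i'T nb1; rewrite !mem_meeting_triples.
case: i i' => -[t1 t2] j [[t1' t2'] j'] /=.
move=> /and3P [_ _ j3] /and3P [_ _ j'3] nb1 s0 [<- <-] sys sys'; congr (_, _).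
exact: root_scalar_inj s0 (meeting_scalar_inj nb1 v0 sys sys').
Qed.

Lemma good_meeting_point_inj : {in [seq i <- meeting_triples | good i] &, injective sol}.
Proof.
move=> i i'; rewrite !mem_filter => /andP [gi iT] /andP [_ i'T] E.
have sys := solP iT; have sys' := solP i'T; rewrite -E in sys'.
have [_ nb2] := meeting_triples_nonbranch iT.
have [_ nb2'] := meeting_triples_nonbranch i'T.
have v0 := pt_vec_neq0 (sol i).
have [c [p0E p3 _]] := meeting_system_pencil nb2 v0 sys.
have [c' [p0E' p3' _]] := meeting_system_pencil nb2' v0 sys'.
have p30 : pencil 3 (pt_vec (sol i)) != 0.
  apply: contraNneq nb2 => p30; have : branch (pencil 0 (pt_vec (sol i))).
    exact: branch_pencil_base p30.
  have c0 : c != 0 by apply: contraNneq gi => c0; rewrite p0E c0 !mul0r.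
  by rewrite p0E /branch /= !exprMn (inj_eq (mulfI (expf_neq0 3 c0))).
move: (iT) (i'T); rewrite !mem_meeting_triples => /and3P [t1T t2T _] /and3P [t1'T t2'T _].
apply: (meeting_triples_eq iT i'T v0 _ sys sys');
  rewrite [LHS]surjective_pairing [RHS]surjective_pairing.
congr (_, _); first exact: T_inj p30 t1T t1'T p3 p3'.
by apply: T_inj gi t2T t2'T _ _; [rewrite p0E | rewrite p0E']; apply: proportional_scale.
Qed.

Lemma mem_good_meeting_points p : p \in [seq sol i | i <- meeting_triples & good i] <->
  [/\ pencil 0 (pt_vec p) != 0, has (proportional (pencil 3 (pt_vec p))) T &
      has (proportional (pencil 0 (pt_vec p))) T].
Proof.
split=> [pS|[p0 /hasP [t1 t1T p3t1] /hasP [t2 t2T p0t2]]].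
  have [i iS ->] : exists2 i, i \in [seq i <- meeting_triples | good i] & p = sol i.
    by apply/mapP.
  move: iS; rewrite mem_filter => /andP [gi iT].
  have [_ nb2] := meeting_triples_nonbranch iT.
  have [c [p0E p3 _]] := meeting_system_pencil nb2 (pt_vec_neq0 _) (solP iT).
  move: iT; rewrite mem_meeting_triples => /and3P [t1T t2T _].
  split=> //; apply/hasP; [by exists i.1.1 | exists i.1.2 => //].
  by rewrite p0E; apply: proportional_scale.
have nb1 := T_nonbranch t1T; have nb2 := T_nonbranch t2T.
have [s ms sys] := pencil_meeting_system nb1 nb2 p0 p3t1 p0t2.
have [j j3 sE] := meeting_scalar_root nb1 ms; rewrite {}sE in sys.
have iT : (t1, t2, j) \in meeting_triples by rewrite mem_meeting_triples /= t1T t2T.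
have [c pE] := meeting_system_unique nb2 (pt_vec_neq0 _) (solP iT) sys.
have -> : p = sol (t1, t2, j).
  by apply: (point_eq (pt_vec_neq0 p)); rewrite ?mem_pt_vec // pE memvZ // mem_pt_vec.
apply: map_f; rewrite mem_filter iT andbT /good; move: p0.
by rewrite pE !pencil_scale; apply: contraNneq => ->; rewrite !mulr0.
Qed.

Lemma bad_meeting_point i :
  i \in meeting_triples -> ~~ good i -> exists (kl : 'I_3 * 'I_3) (c : K),
  row3 1 (w ^+ kl.1) (w ^+ kl.2) = c *: pt_vec (sol i).
Proof.
move=> iT; rewrite negbK => /eqP p0; have [_ nb2] := meeting_triples_nonbranch iT.
have v0 := pt_vec_neq0 (sol i).
have [c [p0E _ c0]] := meeting_system_pencil nb2 v0 (solP iT).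
have [|xy yz] := c0.
  move: p0E; rewrite p0 => -[/esym/eqP + /esym/eqP]; rewrite !mulf_eq0.
  by case: eqP => //= _; have := coord_neq0 nb2; case: eqP => // _ /= /negPf ->.
have [k [l [vE x0]]] := equal_cubes_span sqr_w v0 xy yz.
by exists (k, l), (pt_vec (sol i) 0 0)^-1; rewrite {2}vE scalerK.
Qed.

Lemma count_bad_meeting_points : (count (predC good) meeting_triples <= 9 * M)%N.
Proof.
have /choice [kl klP] : forall i, exists kl : 'I_3 * 'I_3,
    i \in meeting_triples -> ~~ good i ->
    exists c : K, row3 1 (w ^+ kl.1) (w ^+ kl.2) = c *: pt_vec (sol i).
  move=> i; have [iT|] := boolP (i \in meeting_triples); last by exists (ord0, ord0).
  have [gi|bi] := boolP (good i); first by exists (ord0, ord0).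
  by have [kl klP] := bad_meeting_point iT bi; exists kl.
pose position i := (i.1.2, kl i).
have position_inj : {in [seq i <- meeting_triples | predC good i] &, injective position}.
  move=> i i'; rewrite !mem_filter => /andP [bi iT] /andP [bi' i'T] [t2E klE].
  pose v := row3 1 (w ^+ (kl i).1) (w ^+ (kl i).2).
  have sys : meeting_system i.1.1 i.1.2 (root_scalar i) v.
    by have [c vE] := klP i iT bi; rewrite /v vE; apply/cyclic_systemZ/solP.
  have sys' : meeting_system i'.1.1 i'.1.2 (root_scalar i') v.
    by have [c vE] := klP i' i'T bi'; rewrite /v klE vE; apply/cyclic_systemZ/solP.
  have v0 : v != 0 by rewrite row3_eq0 oner_eq0.
  apply: (meeting_triples_eq iT i'T v0 _ sys sys').
  rewrite [LHS]surjective_pairing [RHS]surjective_pairing t2E; congr (_, _).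
  move: (iT) (i'T); rewrite !mem_meeting_triples => /and3P [t1T _ _] /and3P [t1'T _ _].
  apply: (T_inj (T_neq0 t1T) t1T t1'T (proportional_refl _)).
  rewrite -t2E in sys'.
  apply: (meeting_system_inj (root_scalar_neq0 iT) (root_scalar_neq0 i'T) _ _ sys sys').
    by rewrite row3E oner_eq0.
  by rewrite row3E (cube_root_exp_neq0 sqr_w).
rewrite -size_filter -(size_map position).
have -> : (9 * M = size [seq (t, a) | t <- T, a <- enum {: 'I_3 * 'I_3}])%N.
  by rewrite size_allpairs -cardE card_prod card_ord mulnC.
apply: uniq_leq_size => [|_ /mapP [i + ->]].
  by rewrite map_inj_in_uniq // filter_uniq // uniq_meeting_triples.
rewrite mem_filter mem_meeting_triples => /and4P [_ _ t2T _].
by apply/allpairsP; exists (position i); rewrite mem_enum.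
Qed.

End MeetingPoints.

Lemma quadruple_points : exists pts : seq (proj_point K),
  [/\ uniq pts,
      forall p, p \in pts <-> [/\ pencil 0 (pt_vec p) != 0,
        has (proportional (pencil 3 (pt_vec p))) T &
          has (proportional (pencil 0 (pt_vec p))) T] &
      (size pts <= 3 * M ^ 2)%N /\ (3 * M ^ 2 <= size pts + 9 * M)%N].
Proof.
have [sol solP] := exists_meeting_points.
exists [seq sol i | i <- meeting_triples & pencil 0 (pt_vec (sol i)) != 0]; split.
- by rewrite map_inj_in_uniq ?filter_uniq ?uniq_meeting_triples //;
    apply: good_meeting_point_inj.
- exact: mem_good_meeting_points.
rewrite -size_meeting_triples size_map size_filter count_size; split=> //.
rewrite -(count_predC (fun i => pencil 0 (pt_vec (sol i)) != 0)) leq_add2l.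
exact: count_bad_meeting_points.
Qed.

End QuadruplePoints.
End Meeting.

(** * The torsion configurations *)

Section DiagonalCubics.
Variable K : numClosedFieldType.

Section AnyDimension.
Variable n : nat.
Implicit Types (c v : 'rV[K]_n) (A : 'M[K]_n).

Definition diagonal_cubic c A : {mpoly K[n]} := \sum_i c 0 i *: linear_form A i ^+ 3.

Lemma diagonal_cubic_homog c A : diagonal_cubic c A \is 3.-homog for mdeg.
Proof. by apply: rpred_sum => i _; apply/rpredZ/(dhomogMn 3 (linear_form_homog A i)). Qed.

Lemma meval_diagonal_cubic c A v :
  (diagonal_cubic c A).@[v 0] = \sum_i c 0 i * (v *m A) 0 i ^+ 3.
Proof.
rewrite raddf_sum; apply: eq_bigr => i _ /=.
by rewrite mevalZ rmorphXn /= meval_linear_form.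
Qed.

Lemma gradient_diagonal_cubic c A v :
  gradient (diagonal_cubic c A) v = A *m \col_i (3 * c 0 i * (v *m A) 0 i ^+ 2).
Proof.
apply/colP => j; rewrite !mxE (raddf_sum (mderiv j)) (raddf_sum (meval (v 0))).
apply: eq_bigr => i _; rewrite /= mderivZ mevalZ 2!exprS expr1 !mderivM.
rewrite mderiv_linear_form.
by rewrite !(mevalD, mevalM) mevalC meval_linear_form mxE; ring.
Qed.

Lemma gradient_diagonal_cubic_eq0 c A v : A \in unitmx -> (forall i, c 0 i != 0) ->
  gradient (diagonal_cubic c A) v = 0 -> v = 0.
Proof.
move=> uA c0; rewrite gradient_diagonal_cubic => grad0.
have /colP q0 : \col_i (3 * c 0 i * (v *m A) 0 i ^+ 2) = 0.
  by rewrite -[LHS](mulKmx uA) grad0 mulmx0.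
apply/eqP; rewrite -(unitmx_mulmx_eq0 _ uA); apply/eqP/rowP => i.
have /eqP := q0 i; rewrite !mxE !(expf_eq0, mulf_eq0).
rewrite (negPf (natr3_neq0 K)) (negPf (c0 i)).
by move=> /eqP.
Qed.

End AnyDimension.

Lemma diagonal_cubic_smooth (c : 'rV[K]_3) (A : 'M[K]_3) : A \in unitmx ->
  (forall i, c 0 i != 0) -> smooth_cubic (diagonal_cubic c A).
Proof.
move=> uA c0; have homF := diagonal_cubic_homog c A; split=> //; split.
  split; last by exists 3%N.
  have e0 : row3 (1 : K) 0 0 != 0 by rewrite row3_eq0 oner_eq0.
  apply: contraNneq e0 => F0; apply/eqP/(gradient_diagonal_cubic_eq0 uA c0).
  by rewrite F0; apply/colP => j; rewrite !mxE raddf0 meval0.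
apply/seteqP; split=> // p /(Sing_mem homF (pt_vec_neq0 p) (mem_pt_vec p)) [_].
by move=> /(gradient_diagonal_cubic_eq0 uA c0) /eqP; rewrite (negPf (pt_vec_neq0 p)).
Qed.

End DiagonalCubics.

Section TorsionConfiguration.
Variables (K : numClosedFieldType) (w : K).
Hypothesis sqr_w : w ^+ 2 = - w - 1.
Implicit Types (t : K * K) (p : proj_point K) (k n : nat).

Definition hesse_mx e := frame3 (row3 e e e) (row3 1 w (w ^+ 2)) (row3 1 (w ^+ 2) w).

Lemma hesse_mx_unit e : e ^+ 3 = 1 -> hesse_mx e \in unitmx.
Proof.
move=> e3; pose H' := frame3 (row3 (e ^+ 2) 1 1) (row3 (e ^+ 2) (w ^+ 2) w)
  (row3 (e ^+ 2) w (w ^+ 2)).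
suff /mulmx1_unit [] : hesse_mx e *m (3^-1 *: H') = 1%:M by [].
rewrite -scalemxAr; apply: (scalerI (natr3_neq0 K)); rewrite scalerA divff ?natr3_neq0 //.
rewrite scale1r; apply/matrixP; apply: ord3_ind; apply: ord3_ind;
  rewrite !mxE big_ord3 !mxE /=; ring: sqr_w e3.
Qed.

Definition pencil_cubic k t :=
  diagonal_cubic (row3 (diff_zy t) (diff_xz w t) (diff_yx w t))
  (if k == 3%N then 1%:M else hesse_mx (w ^+ k)).

Lemma pencil_cubic_smooth k t : ~~ branch t -> smooth_cubic (pencil_cubic k t).
Proof.
move=> /(diff_neq0 sqr_w) [yx0 zy0 xz0]; apply: diagonal_cubic_smooth.
  by case: ifP => _; rewrite ?unitmx1 ?hesse_mx_unit ?(cube_root_exp3 sqr_w).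
by apply: ord3_ind; rewrite row3E.
Qed.

Lemma on_pencil_cubic k t p :
  on_curve (pencil_cubic k t) p = proportional (pencil w k (pt_vec p)) t.
Proof.
rewrite /on_curve meval_diagonal_cubic big_ord3 !row3E /proportional -[RHS]subr_eq0.
rewrite -[RHS]oppr_eq0 /pencil; move: (pt_vec p) => v; case: ifP => _.
  by rewrite mulmx1; congr (_ == 0); rewrite /diff_yx /diff_zy /diff_xz /=; ring.
have nine_neq0 : 9 != 0 :> K by rewrite pnatr_eq0.
rewrite -[RHS](mulrI_eq0 _ (mulfI nine_neq0)); congr (_ == 0).
rewrite !mxE !big_ord3 !mxE /=.
by rewrite /cyclic_form /anticyclic_form /diff_yx /diff_zy /diff_xz; ring: sqr_w.
Qed.

Variable n : nat.
Hypothesis n0 : (0 < n)%N.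
Let T := torsion_params w n.
Let M := size T.

Definition torsion_cubics := [seq pencil_cubic k t | k <- iota 0 4, t <- T].

Lemma torsion_cubics_smooth G : G \in torsion_cubics -> smooth_cubic G.
Proof.
case/allpairsP=> -[k t] [_ tT ->]; apply: pencil_cubic_smooth.
exact: (torsion_params_nonbranch sqr_w) tT.
Qed.

Lemma size_torsion_cubics : size torsion_cubics = (4 * M)%N.
Proof. by rewrite size_allpairs. Qed.

Let M_gt0 : (0 < M)%N.
Proof.
by rewrite /M size_torsion_params -ltnS prednK ?expn_gt0 // -{1}(expn0 3) ltn_exp2l.
Qed.

Lemma torsion_cubics_mult p : curve_mult torsion_cubics p =
  (\sum_(0 <= k < 4) count (proportional (pencil w k (pt_vec p))) T)%N.
Proof.
rewrite /curve_mult /torsion_cubics count_flatten sumnE !big_map -/(index_iota 0 4).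
apply: eq_bigr => k _; rewrite count_map; apply: eq_count => t /=.
exact: on_pencil_cubic.
Qed.

Lemma torsion_cubics_mult_base p :
  count (fun k => pencil w k (pt_vec p) == 0) (iota 0 4) = 3%N ->
  curve_mult torsion_cubics p = (3 * M)%N.
Proof.
move=> zeros; have /hasP [k0 _ /eqP pk0] :
    has (fun k => pencil w k (pt_vec p) == 0) (iota 0 4).
  by rewrite has_count zeros.
rewrite torsion_cubics_mult -[in RHS]zeros -sumn_count sumnE big_map big_distrl /=.
apply: eq_bigr => k _; have [->|pk] := eqVneq.
  rewrite mul1n -[RHS](count_predT T); apply: eq_count => t.
  by rewrite /proportional !mul0r eqxx.
by rewrite (count_torsion_params sqr_w) // /torsion (branch_pencil_base sqr_w k pk0).
Qed.

Lemma torsion_cubics_mult_nonbase p :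
  (forall k, (k < 4)%N -> pencil w k (pt_vec p) != 0) ->
  curve_mult torsion_cubics p =
    count (fun k => torsion w n (pencil w k (pt_vec p))) (iota 0 4).
Proof.
move=> nz; rewrite torsion_cubics_mult -sumn_count sumnE big_map !big_seq.
by apply: eq_bigr => k; rewrite mem_iota => /nz k0; apply: count_torsion_params.
Qed.

Lemma torsion_cubics_nonbase_torsion p :
  (forall k, (k < 4)%N -> pencil w k (pt_vec p) != 0) ->
  (1 < curve_mult torsion_cubics p)%N ->
  all (fun k => torsion w n (pencil w k (pt_vec p))) (iota 0 4).
Proof.
move=> nz; rewrite torsion_cubics_mult_nonbase //.
have torsionE k : torsion w n (pencil w k (pt_vec p)) =
    ~~ branch (pencil w 0 (pt_vec p)) &&
      branch (iter n (lattes w) (pencil w k (pt_vec p))).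
  by rewrite /torsion !(branch_pencil sqr_w).
rewrite (eq_count torsionE) (eq_all torsionE).
have [_|_] := boolP (branch (pencil w 0 (pt_vec p))); first by rewrite count_pred0.
exact: pencil_two_imply_four.
Qed.

Lemma torsion_cubics_multiple_points : exists B Q : seq (proj_point K),
  [/\ uniq (B ++ Q), size B = 12%N,
      forall p, p \in B ++ Q <-> (1 < curve_mult torsion_cubics p)%N,
      {in B, forall p, curve_mult torsion_cubics p = (3 * M)%N} /\
      {in Q, forall p, curve_mult torsion_cubics p = 4%N} &
      (size Q <= 3 * M ^ 2)%N /\ (3 * M ^ 2 <= size Q + 9 * M)%N].
Proof.
have [B [uB sB zerosB Bzeros]] := base_points sqr_w.
have T_unique t : t != 0 -> (count (proportional t) T <= 1)%N.
  by move=> t0; rewrite (count_torsion_params sqr_w) // leq_b1.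
have [Q [uQ memQ sQ]] := quadruple_points sqr_w T_unique
  (@torsion_params_nonbranch _ _ sqr_w n).
have nonbase p : p \notin B -> forall k, (k < 4)%N -> pencil w k (pt_vec p) != 0.
  by move=> pB k _; apply: contra pB => /eqP /Bzeros.
have multB p : p \in B -> curve_mult torsion_cubics p = (3 * M)%N.
  by move=> /zerosB; apply: torsion_cubics_mult_base.
have memQ_torsion p : p \notin B -> p \in Q <->
    torsion w n (pencil w 0 (pt_vec p)) /\ torsion w n (pencil w 3 (pt_vec p)).
  move=> /nonbase nz; rewrite memQ !has_count !(count_torsion_params sqr_w) ?nz // !lt0b.
  by split=> [[]|[]] //; rewrite nz.
have disjoint p : p \in Q -> p \notin B.
  move=> /memQ [p0 _]; rewrite has_count (count_torsion_params sqr_w) // lt0b.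
  move=> /andP [nb _].
  apply: contra nb => /zerosB zeros.
  have /hasP [k _ /eqP pk] : has (fun k => pencil w k (pt_vec p) == 0) (iota 0 4).
    by rewrite has_count zeros.
  exact: branch_pencil_base pk.
have mult_gt1 p : p \notin B -> p \in Q <-> (1 < curve_mult torsion_cubics p)%N.
  move=> pB; rewrite (memQ_torsion p pB); split=> [[tor0 tor3]|].
    by rewrite (torsion_cubics_mult_nonbase (nonbase p pB)) /=
      tor0 tor3 !addnA addn1 addn0; lia.
  by move=> /(torsion_cubics_nonbase_torsion (nonbase p pB)) /= /and5P [].
exists B, Q; split=> //.
- by rewrite cat_uniq uB uQ andbT; apply/hasPn => p /disjoint.
- move=> p; rewrite mem_cat; have [/multB ->|pB] := boolP (p \in B); last exact: mult_gt1.
  by split=> // _; have := M_gt0; lia.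
- split=> // p pQ; have pB := disjoint p pQ; have m1 := (mult_gt1 p pB).1 pQ.
  rewrite (torsion_cubics_mult_nonbase (nonbase p pB)); apply/eqP.
  by rewrite -[4%N]/(size (iota 0 4)) -all_count;
    apply: torsion_cubics_nonbase_torsion (nonbase p pB) m1.
Qed.

End TorsionConfiguration.

(** * H-constants *)

Lemma homogeneous_prod (K : fieldType) (cs : seq {mpoly K[3]}) d :
  (forall G, G \in cs -> homogeneous G d) ->
  homogeneous (\prod_(G <- cs) G) (d * size cs).
Proof.
elim: cs => [|G cs ih] homs; first by rewrite big_nil muln0; apply: dhomog1.
rewrite big_cons mulnS; apply: dhomogM; first by apply/homs/mem_head.
by apply: ih => H Hcs; apply: homs; rewrite inE Hcs orbT.
Qed.

Lemma exists_primitive_cube_root (K : numClosedFieldType) :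
  exists w : K, w ^+ 2 = - w - 1.
Proof.
have [w wE] := @solve_monicpoly K 2%N (fun=> -1) isT; exists w.
by rewrite wE !big_ord_recl big_ord0 /= expr0 expr1; ring.
Qed.

Lemma elliptic_cubic_configuration (K : numClosedFieldType) (F : {mpoly K[3]}) :
  cubic_configuration F -> elliptic_configuration F.
Proof.
move=> [redF [cs cubics FE]]; split=> //; exists cs => // G /cubics [smoothG homG].
by split=> //; apply: (genus_degree _ homG); case: smoothG => -[].
Qed.

Lemma self_intersection_at_Sing (K : numClosedFieldType) (cs : seq {mpoly K[3]})
    (S : seq (proj_point K)) (d : nat) : let F := \prod_(G <- cs) G in
  cs != [::] -> (forall G, G \in cs -> smooth_curve G) -> homogeneous F d ->
  uniq S -> S != [::] -> (forall p, p \in S <-> (1 < curve_mult cs p)%N) ->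
  [/\ finite_set (Sing F), Sing F !=set0, #|` fset_set (Sing F)| = size S &
      self_intersection (Sing F) (strict_transform F)
        ((d ^ 2)%N%:Z - (\sum_(p <- S) curve_mult cs p ^ 2)%N%:Z)].
Proof.
move=> F cs0 smooth_cs homF uS S0 SP; have SingE : Sing F = [set` S].
  by apply/seteqP; split=> p /=; rewrite (Sing_prod p cs0 smooth_cs) => /SP.
have finS : finite_set (Sing F) by rewrite SingE; apply: finite_seq.
have permS : perm_eq (fset_set (Sing F)) S.
  apply: uniq_perm => // p; rewrite in_fset_set // SingE.
  by apply/idP/idP; rewrite inE.
split=> //.
- by rewrite SingE; case: (S) S0 => // p S' _; exists p; rewrite /= mem_head.
- exact: perm_size permS.
rewrite -(perm_big _ permS); apply: self_intersection_smooth_union => // p Fp.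
by apply/on_curveP; have [] := Fp.
Qed.

Definition torsion_H (R : realType) (M t : nat) : R :=
  ((36 * M ^ 2)%:R - (16 * t)%:R) / (12 + t)%:R.

Lemma torsion_H_value (R : realType) (n : nat) :
  exists (F : {mpoly R[i][3]}) (t : nat), let M := (3 ^ n.+1).-1 in
  [/\ cubic_configuration F, H_value F (Sing F) (torsion_H R M t) &
      (t <= 3 * M ^ 2)%N /\ (3 * M ^ 2 <= t + 9 * M)%N].
Proof.
have [w sqr_w] := exists_primitive_cube_root R[i].
have [B [Q []]] := torsion_cubics_multiple_points sqr_w (ltn0Sn n).
rewrite size_torsion_params; set cs := torsion_cubics w n.+1; set M := _.-1.
move=> uS sB SP [multB multQ] sQ; exists (\prod_(G <- cs) G), (size Q).
have cubic_cs : forall G, G \in cs -> smooth_cubic G :=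
  torsion_cubics_smooth sqr_w (n := n.+1).
have smooth_cs G : G \in cs -> smooth_curve G by move=> /cubic_cs [].
have cs0 : cs != [::] by [].
have S0 : B ++ Q != [::] by rewrite -size_eq0 size_cat sB.
have homF : homogeneous (\prod_(G <- cs) G) (12 * M).
  have := homogeneous_prod (fun G Gcs => (cubic_cs G Gcs).2).
  by rewrite size_torsion_cubics size_torsion_params mulnA.
have [finS SingS0 cardS selfS] := self_intersection_at_Sing cs0 smooth_cs homF uS S0 SP.
split=> //.
  split; last by exists cs.
  by apply: finite_Sing_reduced => //; apply: plane_curve_prod => // G /smooth_cs [].
split=> //; eexists; first exact: selfS.
have sumE : (\sum_(p <- B ++ Q) curve_mult cs p ^ 2 = 108 * M ^ 2 + 16 * size Q)%N.
  rewrite big_cat; congr (_ + _)%N.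
    rewrite (eq_big_seq (fun=> (3 * M) ^ 2)%N) => [|p /multB -> //].
    by rewrite big_const_seq count_predT iter_addn_0 sB expnMn mulnAC.
  rewrite (eq_big_seq (fun=> 16%N)) => [|p /multQ -> //].
  by rewrite big_const_seq count_predT iter_addn_0.
rewrite cardS size_cat sB sumE /torsion_H rmorphB /= -!pmulrn; congr (_ / _).
by rewrite !natrD !natrX !natrM; ring.
Qed.

Section Limit.
Variable R : realType.

Lemma torsion_H_bounds (M t : nat) :
  (0 < M)%N -> (t <= 3 * M ^ 2)%N -> (3 * M ^ 2 <= t + 9 * M)%N ->
  -4 <= torsion_H R M t <= -4 + 156 / M%:R.
Proof.
move=> M0 t1 t2; have t0 : (12 + t)%:R != 0 :> R by rewrite pnatr_eq0.
have -> : torsion_H R M t = -4 + (36 * M ^ 2 + 48 - 12 * t)%:R / (12 + t)%:R.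
  rewrite natrB; last by lia.
  by rewrite /torsion_H; move: t0; rewrite !natrD !natrM => t0; field.
rewrite lerDl divr_ge0 ?ler0n //= lerD2l ler_pdivrMr ?ltr0n //.
rewrite mulrAC ler_pdivlMr ?ltr0n // -!natrM ler_nat.
have sqrM : (M ^ 2 <= 12 + t)%N.
  have : (9 * M <= 2 * M ^ 2 + 12)%N; last by lia.
  by case: (leqP M 4) => [|M4]; [move: M {M0 t1 t2} => [|[|[|[|[|]]]]] | rewrite -mulnn;
    nia].
by rewrite -mulnn in t1 t2 sqrM *; nia.
Qed.

Lemma torsion_H_limit (t : nat -> nat) :
  (forall n, let M := (3 ^ n.+1).-1 in
    (t n <= 3 * M ^ 2)%N /\ (3 * M ^ 2 <= t n + 9 * M)%N) ->
  (fun n => torsion_H R (3 ^ n.+1).-1 (t n)) @ \oo --> (-4 : R).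
Proof.
move=> t_bounds; pose upper (n : nat) : R := -4 + 156 * harmonic n.
apply: (squeeze_cvgr (f := cst (-4)) (h := upper)); last first.
- rewrite -[X in _ --> X]addr0 -[X in _ + X](mulr0 156).
  by apply: cvgD; [exact: cvg_cst | apply: cvgM cvg_harmonic; exact: cvg_cst].
- exact: cvg_cst.
apply: nearW => n; have [t1 t2] := t_bounds n; have nM : (n < (3 ^ n.+1).-1)%N.
  by rewrite -ltnS prednK ?expn_gt0 // ltn_expl.
have /andP [-> /le_trans] := torsion_H_bounds (leq_ltn_trans (leq0n n) nM) t1 t2; apply.
by rewrite lerD2l ler_pM2l ?ltr0n // lef_pV2 ?posrE ?ltr0n ?ler_nat //
  (leq_ltn_trans _ nM).
Qed.

End Limit.

Lemma H_P2_le_El (R : realType) : (H_P2 R <= H_El_P2 R)%E.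
Proof.
apply: ereal_inf_le_tmp => _ [h [F [P [[redF _] HF]]] <-]; exists h => //.
by exists F, P.
Qed.

Lemma H_El_P2_le_lim (R : realType) (C : nat -> {mpoly R[i][3]}) (h : nat -> R) (l : R) :
  (forall n, elliptic_configuration (C n)) ->
  (forall n, H_value (C n) (Sing (C n)) (h n)) ->
  h @ \oo --> l -> (H_El_P2 R <= l%:E)%E.
Proof.
move=> ellC HC hl; have le_h n : (H_El_P2 R <= (h n)%:E)%E.
  by apply: ereal_inf_lbound; exists (h n) => //; exists (C n), (Sing (C n)).
have El : (EFin \o h) @ \oo --> l%:E by apply: cvg_EFin => //; apply: nearW.
by rewrite -(cvg_lim _ El) //; apply: lime_ge; [apply/cvg_ex; exists l%:E | apply: nearW].
Qed.

Theorem proposition3 (R : realType) :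
  (exists (C : nat -> {mpoly R[i][3]}) (h : nat -> R),
     [/\ forall n, cubic_configuration (C n),
         forall n, H_value (C n) (Sing (C n)) (h n) &
         h @ \oo --> (-4 : R)]) /\
  (H_El_P2 R <= (-4)%:E)%E /\
  (H_P2 R <= H_El_P2 R)%E.
Proof.
have /choice [C /choice [t CP]] := torsion_H_value R.
pose h n := torsion_H R (3 ^ n.+1).-1 (t n).
have cubicC n : cubic_configuration (C n) by have [] := CP n.
have HC n : H_value (C n) (Sing (C n)) (h n) by have [] := CP n.
have h_limit : h @ \oo --> (-4 : R) by apply: torsion_H_limit => n; have [] := CP n.
split; first by exists C, h.
split; last exact: H_P2_le_El.
by apply: H_El_P2_le_lim HC h_limit => n; apply/elliptic_cubic_configuration/cubicC.
Qed.
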